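(* Let $\Phi$ be an (LB)-space. (i) For each $(\alpha(\xi),\beta(\xi))\in\mathcal W(\Phi)$, we have $\mathcal R(\alpha(\xi),\beta(\xi))=\alpha(\nabla)+M(\beta(\nabla))$. (ii) The Lie bracket $[\cdot,\cdot]$ on the Lie algebra $\mathfrak s(\Phi)$ of $\mathbb S(\Phi)$ is the commutator of continuous linear operators. Furthermore, for any $(\alpha^{(m)}(\xi),\beta^{(m)}(\xi))\in\mathcal W(\Phi)$ ($m=1,2$), $$\big[\alpha^{(1)}(\nabla)+M(\beta^{(1)}(\nabla)),\ \alpha^{(2)}(\nabla)+M(\beta^{(2)}(\nabla))\big]$$ $$=D_{\beta^{(2)}}\alpha^{(1)}(\nabla)-D_{\beta^{(1)}}\alpha^{(2)}(\nabla)+M\big(D_{\beta^{(2)}}\beta^{(1)}(\nabla)-D_{\beta^{(1)}}\beta^{(2)}(\nabla)\big).$$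
   Context: **Spaces.** All vector spaces are complex; l.c.s. means locally convex topological vector space; $\mathbb N=\{1,2,\dots\}$, $\mathbb N_0=\mathbb N\cup\{0\}$. An (LB)-space $\Phi=\bigcup_n\Phi_n$: each $\Phi_n$ is a Banach space, $\Phi_n$ is a subspace of $\Phi_{n+1}$ on which the two norms coincide, and $\Phi$ has the locally convex inductive limit topology; $\Phi'$ is its continuous dual. For a Banach space $B$, $B^{\hat\otimes k}$ is the $k$-fold completed injective tensor power, $\operatorname{Sym}_k$ the symmetrization projection on it, $B^{\hat\odot k}:=\operatorname{Sym}_k(B^{\hat\otimes k})$. Set $\Phi^{\hat\odot k}:=\operatorname{ind\,lim}_n\Phi_n^{\hat\odot k}$ (an (LB)-space), $\Phi^{\hat\odot 0}:=\mathbb C$. For (LB)-spaces $E=\operatorname{ind\,lim}E_n$, $F=\operatorname{ind\,lim}F_m$, the space $\mathcal L(E,F)$ of continuous linear operators has the topology $\operatorname{proj\,lim}_n\operatorname{ind\,lim}_m\mathcal L(E_n,F_m)$ (via restriction to $E_n$; operator norm on $\mathcal L(E_n,F_m)$); $(\Phi^{\hat\odot k})'=\mathcal L(\Phi^{\hat\odot k},\mathbb C)$. For $A_m\in\mathcal L(\Phi^{\hat\odot i_m},\Phi^{\hat\odot j_m})$ ($m=1,2$), $A_1\odot A_2\in\mathcal L(\Phi^{\hat\odot(i_1+i_2)},\Phi^{\hat\odot(j_1+j_2)})$ is $\operatorname{Sym}_{j_1+j_2}(A_1\otimes A_2)$ restricted to $\Phi^{\hat\odot(i_1+i_2)}$ (multiplication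 by scalars if a factor is a scalar). $\mathbf 1_k$ is the identity of $\Phi^{\hat\odot k}$. **Formal tensor power series.** A formal series $C(\xi)=\sum_{k\ge i}C_k\xi^{\otimes k}$ of $\xi\in\Phi$ with values in $\Phi^{\hat\odot i}$ is a sequence of coefficients $C_k\in\mathcal L(\Phi^{\hat\odot k},\Phi^{\hat\odot i})$. $\mathcal F_0(\Phi)$: scalar-valued series $1+\sum_{k\ge1}A_k\xi^{\otimes k}$. $\mathcal F_1(\Phi)$: $\Phi$-valued series $\xi+\sum_{k\ge2}B_k\xi^{\otimes k}$ (so $B_1=\mathbf 1_1$). $\mathcal W_0(\Phi)$: series $\sum_{k\ge1}\alpha_k\xi^{\otimes k}$, $\alpha_k\in(\Phi^{\hat\odot k})'$. $\mathcal W_1(\Phi)$: series $\sum_{k\ge2}\beta_k\xi^{\otimes k}$, $\beta_k\in\mathcal L(\Phi^{\hat\odot k},\Phi)$. $\mathcal W(\Phi)=\mathcal W_0(\Phi)\times\mathcal W_1(\Phi)$. Product of scalar series: coefficients $\sum_{l=0}^kA^{(1)}_l\odot A^{(2)}_{k-l}$. Composition $C(B(\xi))$ with $B(\xi)=\sum_{k\ge1}B_k\xi^{\otimes k}$ $\Phi$-valued: $k$th coefficient $\sum_{l=1}^kC_l\sum_{i_1+\dots+i_l=k,\,i_j\ge1}B_{i_1}\odot\cdots\odot B_{i_l}$ for $k\ge1$, and $0$th coefficient $C_0$ (if present). For $B(\xi)=\sum_{k\ge1}B_k\xi^{\otimes k}$ $\Phi$-valued and $C(\xi)=\sum_{k\ge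 i}C_k\xi^{\otimes k}$ with values in $\Phi^{\hat\odot i}$, the derivative of $C$ in direction $B$ is $D_BC(\xi)=\sum_{k\ge i}kC_k(\xi^{\otimes(k-1)}\odot B(\xi))$, i.e. the series with $k$th coefficient $\sum_{l=i}^{k}l\,C_l(\mathbf 1_{l-1}\odot B_{k-l+1})$. $\mathcal S(\Phi):=\mathcal F_0(\Phi)\times\mathcal F_1(\Phi)$ is a group for $(A^{(1)},B^{(1)})\ast(A^{(2)},B^{(2)})=(A^{(1)}(B^{(2)}(\xi))A^{(2)}(\xi),\,B^{(1)}(B^{(2)}(\xi)))$. $\operatorname{EXP}:\mathcal W(\Phi)\to\mathcal S(\Phi)$ is its exponential map: $\operatorname{EXP}(\alpha,\beta)=\gamma(1)$, where $\gamma:\mathbb R\to\mathcal S(\Phi)$ is the one-parameter subgroup (with coefficients smooth in $t$) such that coefficientwise $\gamma'(0)=(\alpha,\beta)$. **Operators.** A polynomial on $\Phi'$ is a function $p(\omega)=\sum_{k=0}^K\langle\omega^{\otimes k},f^{(k)}\rangle$, $f^{(k)}\in\Phi^{\hat\odot k}$ (dual pairing; $\langle\omega^{\otimes0},f^{(0)}\rangle=f^{(0)}$); the $f^{(k)}$ are determined by $p$, and $\mathcal P(\Phi')$, the space of polynomials, has the topology of the locally convex direct sum of the $\Phi^{\hat\odot k}$. $\mathbb M(\Phi)$ is the set of continuous linear operators $P$ on $\mathcal P(\Phi')$ with $(P\langle\cdot^{\otimes k},f^{(k)}\rangle)(\omega)=P^{(k)}(\omega,f^{(k)}):=\sum_{i=0}^k\langle\omega^{\otimes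 i},P_{ik}f^{(k)}\rangle$, where $P_{ik}\in\mathcal L(\Phi^{\hat\odot k},\Phi^{\hat\odot i})$ and $P_{kk}=\mathbf 1_k$. $\mathbb V(\Phi)$ is the set of operators of the same form $V=[V_{ik}]$ but with $V_{kk}=0$, with the product topology of the $\mathcal L(\Phi^{\hat\odot k},\Phi^{\hat\odot i})$, $0\le i<k$. The map $\exp(V)=\mathbf 1+\sum_{n\ge1}V^n/n!$ is a bijection $\mathbb V(\Phi)\to\mathbb M(\Phi)$ with inverse $\log(P)=\sum_{n\ge1}\frac{(-1)^{n+1}}n(P-\mathbf 1)^n$. The generating function of $P\in\mathbb M(\Phi)$ is $G(\omega,\xi)=\sum_{k\ge0}\frac1{k!}P^{(k)}(\omega,\xi^{\otimes k})$. $P$ is a Sheffer operator if $G(\omega,\xi)=\exp[\langle\omega,B(\xi)\rangle]A(\xi)$ for some $(A,B)\in\mathcal S(\Phi)$; the set of Sheffer operators $\mathbb S(\Phi)$ is a group under composition, and $\mathcal I:\mathcal S(\Phi)\to\mathbb S(\Phi)$, sending $(A,B)$ to the operator with this generating function, is a group isomorphism. $\mathfrak s(\Phi):=\log(\mathbb S(\Phi))$ is a closed vector subspace of $\mathbb V(\Phi)$; $\mathbb S(\Phi)$ is a Lie group modeled on $\mathfrak s(\Phi)$ through the global parametrization $\varphi=\exp:\mathfrak s(\Phi)\to\mathbb S(\Phi)$, and $\mathfrak s(\Phi)$ is its Lie algebra, with Lie bracket $[v,w]=b(v,w)-b(w,v)$, where $b(v,w)$ is the coefficient of $s_1s_2$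 in the Taylor expansion at $(0,0)$ of $(s_1,s_2)\mapsto\varphi^{-1}(\varphi(s_1v)\varphi(s_2w))$, $s_1,s_2\in\mathbb C$. $\mathcal R:=\log\circ\,\mathcal I\circ\operatorname{EXP}:\mathcal W(\Phi)\to\mathfrak s(\Phi)$. **Gradient notation.** For $p\in\mathcal P(\Phi')$, $\omega\in\Phi'$, $k\ge1$, $\nabla^kp(\omega)\in\Phi^{\hat\odot k}$ is defined by $D_{\sigma_1}\cdots D_{\sigma_k}p(\omega)=\langle\sigma_1\odot\cdots\odot\sigma_k,\nabla^kp(\omega)\rangle$ for all $\sigma_j\in\Phi'$, where $D_\sigma$ is the derivative in direction $\sigma$. For $\alpha_k\in(\Phi^{\hat\odot k})'$, $(\alpha_k\nabla^kp)(\omega):=\alpha_k(\nabla^kp(\omega))$; for $\beta_k\in\mathcal L(\Phi^{\hat\odot k},\Phi)$, $(M(\beta_k\nabla^k)p)(\omega):=\langle\omega,\beta_k(\nabla^kp(\omega))\rangle$. For $\alpha(\xi)=\sum_{k\ge1}\alpha_k\xi^{\otimes k}\in\mathcal W_0(\Phi)$ and $\beta(\xi)=\sum_{k\ge2}\beta_k\xi^{\otimes k}\in\mathcal W_1(\Phi)$: $\alpha(\nabla):=\sum_{k\ge1}\alpha_k\nabla^k$ and $M(\beta(\nabla)):=\sum_{k\ge2}M(\beta_k\nabla^k)$, both in $\mathbb V(\Phi)$. $D_{\beta^{(2)}}\alpha^{(1)}(\nabla)$ means $\alpha(\nabla)$ for the series $\alpha=D_{\beta^{(2)}}\alpha^{(1)}$,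 and similarly for the other terms. *)

(* Defs.v *)
From HB Require Import structures.
From mathcomp Require Import all_boot all_order all_algebra perm complex.
From mathcomp Require Import all_classical all_reals interval_inference.
From mathcomp Require Import topology normedtype derive tvs convex.

Set Implicit Arguments.
Unset Strict Implicit.
Unset Printing Implicit Defensive.

Import Order.TTheory GRing.Theory Num.Theory.
Import numFieldTopology.Exports numFieldNormedType.Exports.

Local Open Scope classical_set_scope.
Local Open Scope ring_scope.

Record seminorm (K : numFieldType) (E : lmodType K) := Seminorm {
  sn_fun :> E -> K;
  sn_triangle : forall x y, sn_fun (x + y) <= sn_fun x + sn_fun y;
  sn_scale : forall a x, sn_fun (a *: x) = `|a| * sn_fun x }.

Section SeminormTheory.
Context (K : numFieldType) (E : lmodType K) (p : seminorm E).

Lemma sn0 : p 0 = 0.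
Proof. by rewrite -(scale0r 0) sn_scale normr0 mul0r. Qed.

Lemma snN x : p (- x) = p x.
Proof. by rewrite -scaleN1r sn_scale normrN1 mul1r. Qed.

Lemma sn_ge0 x : 0 <= p x.
Proof.
have := sn_triangle p x (- x); rewrite subrr sn0 snN -mulr2n.
by rewrite pmulrn_lge0.
Qed.

End SeminormTheory.

(* A copy of E carrying the locally convex topology generated by the family Q
   of seminorms. *)
Definition lctop (K : numFieldType) (E : lmodType K)
  (Q : set (seminorm E)) : Type := E.

Section LocallyConvexTopology.
Context (K : numFieldType) (E : lmodType K) (Q : set (seminorm E)).

HB.instance Definition _ := GRing.Lmodule.on (lctop Q).

Definition lc_ball (x : E) n (p : 'I_n -> seminorm E) (e : 'I_n -> K) : set E :=
  [set y | forall i, p i (y - x) < e i].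

Definition lc_nbhs (x : lctop Q) : set_system (lctop Q) :=
  [set A : set (lctop Q) | exists n (p : 'I_n -> seminorm E) (e : 'I_n -> K),
    [/\ forall i, Q (p i), forall i, 0 < e i & lc_ball x p e `<=` A]].

HB.instance Definition _ := hasNbhs.Build (lctop Q) lc_nbhs.

Lemma lc_nbhs_filter (x : lctop Q) : ProperFilter (nbhs x).
Proof.
split.
  move=> [n [p [e [_ e0 /(_ x)]]]]; apply=> i.
  by rewrite subrr sn0.
split.
- have p0 : 'I_0 -> seminorm E by case.
  by exists 0%N, p0, (fun=> 1); split=> // -[].
- move=> A B [n [p [e [Qp e0 sA]]]] [m [q [d [Qq d0 sB]]]].
  exists (n + m)%N, (fun i : 'I_(n + m) => match fintype.split i with inl j => p j | inr j => q j end),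
    (fun i : 'I_(n + m) => match fintype.split i with inl j => e j | inr j => d j end).
  split; try by move=> i; case: fintype.split.
  move=> y yAB; split.
    by apply: sA => i; have := yAB (lshift m i); rewrite (unsplitK (inl i)).
  by apply: sB => i; have := yAB (rshift n i); rewrite (unsplitK (inr i)).
- move=> A B AB [n [p [e [Qp e0 sA]]]]; exists n, p, e; split=> //.
  exact: subset_trans AB.
Qed.

Lemma lc_nbhs_singleton (x : lctop Q) (A : set (lctop Q)) : nbhs x A -> A x.
Proof.
by move=> [n [p [e [_ e0]]]]; apply=> i; rewrite subrr sn0.
Qed.

Lemma lc_ball_nbhs (x y : lctop Q) n (p : 'I_n -> seminorm E) (e : 'I_n -> K) :
  (forall i, Q (p i)) -> lc_ball x p e y -> nbhs y (lc_ball x p e).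
Proof.
move=> Qp xy; exists n, p, (fun i => e i - p i (y - x)); split=> //.
  by move=> i; rewrite subr_gt0.
move=> z yz i; rewrite -(subrK y z) -addrA.
by rewrite (le_lt_trans (sn_triangle _ _ _))// -ltrBrDr.
Qed.

Lemma lc_nbhs_nbhs (x : lctop Q) (A : set (lctop Q)) :
  nbhs x A -> nbhs x (nbhs^~ A).
Proof.
move=> [n [p [e [Qp e0 sA]]]]; exists n, p, e; split=> // y xy.
have := lc_ball_nbhs Qp xy => -[m [q [d [Qq d0 sB]]]].
by exists m, q, d; split=> //; exact: subset_trans sA.
Qed.

HB.instance Definition _ := Nbhs_isNbhsTopological.Build (lctop Q)
  lc_nbhs_filter lc_nbhs_singleton lc_nbhs_nbhs.

Lemma lc_cvgP (F : set_system (lctop Q)) (x : lctop Q) : Filter F ->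
  F --> x <->
  forall p e, Q p -> 0 < e -> \forall y \near F, (p : seminorm E) (y - x) < e.
Proof.
move=> FF; split=> [Fx p e Qp e0|H A [n [p [e [Qp e0 sA]]]]].
  apply: Fx; exists 1%N, (fun=> p), (fun=> e); split=> // y.
  exact: (@^~ ord0).
apply: (filterS sA).
have := filter_forall FF (fun i => H (p i) (e i) (Qp i) (e0 i)).
by [].
Qed.

Lemma lc_near (x : lctop Q) (p : seminorm E) e : Q p -> 0 < e ->
  \forall y \near x, p (y - x) < e.
Proof. by move=> Qp e0; have /lc_cvgP := @cvg_id _ (nbhs x); apply. Qed.

Lemma lc_add_continuous : continuous (fun x : lctop Q * lctop Q => x.1 + x.2).
Proof.
move=> [x y]; apply/lc_cvgP => p e Qp e0; near=> a b => /=.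
rewrite opprD addrACA (le_lt_trans (sn_triangle _ _ _))//.
rewrite (splitr e) ltrD//.
- by near: a; apply: lc_near => //; rewrite divr_gt0.
- by near: b; apply: lc_near => //; rewrite divr_gt0.
Unshelve. all: by end_near. Qed.

Lemma lc_scale_continuous :
  continuous (fun z : K^o * lctop Q => z.1 *: z.2).
Proof.
move=> [a x]; apply/lc_cvgP => p e Qp e0.
have px := sn_ge0 p x; have a1 : 0 < `|a| + 1 by rewrite ltr_wpDl.
have px1 : 0 < p x + 1 by rewrite ltr_wpDl.
near=> b z => /=.
rewrite (_ : b *: z - a *: x = (b - a) *: z + a *: (z - x)); last first.
  by rewrite scalerBl scalerBr addrA subrK.
rewrite (le_lt_trans (sn_triangle _ _ _))// !sn_scale (splitr e).
have zx : p (z - x) < 1 by near: z; apply: lc_near.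
have zle : p z <= p x + 1.
  rewrite -{1}(subrK x z) (le_trans (sn_triangle _ _ _))// addrC lerD2l.
  exact: ltW.
rewrite ltr_leD//.
- rewrite (@le_lt_trans _ _ (`|b - a| * (p x + 1)))// ?ler_wpM2l//.
  rewrite -ltr_pdivlMr// distrC.
  by near: b; apply: (@cvgr_dist_lt _ K^o); [exact: cvg_id|rewrite !divr_gt0].
- rewrite (@le_trans _ _ ((`|a| + 1) * p (z - x)))//.
    by rewrite ler_wpM2r ?sn_ge0// lerDl.
  rewrite -ler_pdivlMl// mulrC ltW//.
  by near: z; apply: lc_near => //; rewrite !divr_gt0.
Unshelve. all: by end_near. Qed.

Lemma lc_locally_convex : exists2 B : set_system (lctop Q),
  (forall b, b \in B -> convex_set b) & basis B.
Proof.
exists [set b | exists x n (p : 'I_n -> seminorm E) e,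
    [/\ forall i, Q (p i), forall i, 0 < e i & b = lc_ball x p e]].
  move=> b; rewrite inE/= => -[x [n [p [e [Qp e0 ->]]]]].
  apply/convex_setW => y z; rewrite !inE /lc_ball/= => yx zx l l0 l1.
  rewrite inE /= => i; set t := l%:num in l0 l1 *.
  rewrite (_ : _ - x = t *: (y - x) + (1 - t) *: (z - x)); last first.
    have tt : t + (1 - t) = 1 by rewrite addrC subrK.
    by rewrite !scalerBr addrACA -opprD -scalerDl tt scale1r.
  rewrite (le_lt_trans (sn_triangle _ _ _))// !sn_scale.
  have t1 : 0 < 1 - t by rewrite subr_gt0.
  rewrite !gtr0_norm// [ltRHS](_ : e i = t * e i + (1 - t) * e i).
    by rewrite ltrD// ltr_pM2l.
  by rewrite -mulrDl addrC subrK mul1r.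
split.
  move=> b [x [n [p [e [Qp e0 ->]]]]].
  by rewrite openE => y /= xy; exact: lc_ball_nbhs.
move=> x A [n [p [e [Qp e0 sA]]]]; exists (lc_ball x p e) => //.
split; first by exists x, n, p, e.
by move=> i; rewrite subrr sn0.
Qed.

HB.instance Definition _ := PreTopologicalLmod_isTvs.Build K (lctop Q)
  lc_add_continuous lc_scale_continuous lc_locally_convex.
HB.instance Definition _ :=
  PreTopologicalNmodule_isTopologicalNmodule.Build (lctop Q) lc_add_continuous.
HB.instance Definition _ :=
  TopologicalNmodule_isTopologicalLmodule.Build K (lctop Q) lc_scale_continuous.
HB.instance Definition _ := Uniform_isTvs.Build K (lctop Q) lc_locally_convex.

End LocallyConvexTopology.

Section ContinuousLinear.
Context (K : numFieldType) (U V : tvsType K).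

Definition cont_lin : {pred U -> V} := fun f => `[< linear f /\ continuous f >].

Lemma cont_lin_submod : submod_closed cont_lin.
Proof.
split=> [|a f g /asboolP[fl fc] /asboolP[gl gc]].
  apply/asboolP; split; last exact: cst_continuous.
  by move=> a x y; rewrite scaler0 addr0.
apply/asboolP; split=> [b x y|x] /=.
  rewrite /= !fctE/=  fl gl !scalerDr !scalerA mulrC -!addrA; congr (_ + _).
  by rewrite addrCA.
apply: (@continuous_comp _ (V * V)%type _ (fun x => (a *: f x, g x))
  (fun z => z.1 + z.2)); last exact: add_continuous.
apply: cvg_pair; last exact: gc.
apply: (@continuous_comp _ (K^o * V)%type _ (fun x => (a : K^o, f x))
  (fun z => z.1 *: z.2)); last exact: scale_continuous.
by apply: (@cvg_pair _ _ _ _ (nbhs (a : K^o)));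
  [exact: cvg_cst|exact: fc].
Qed.

HB.instance Definition _ := GRing.isSubmodClosed.Build K (U -> V) cont_lin
  cont_lin_submod.

Record clin := Clin { clin_fun :> U -> V; _ : clin_fun \in cont_lin }.

HB.instance Definition _ := [isSub for clin_fun].
HB.instance Definition _ := [Choice of clin by <:].
HB.instance Definition _ := [SubChoice_isSubLmodule of clin by <:].

End ContinuousLinear.

(* This and the similar maps [to_symt], [to_hom], [to_poly], [to_op], [to_V] below
   pack a function into a subtype.  Their default value 0 is irrelevant: they are
   used on functions satisfying the defining predicate of the subtype (see
   [otimes] for the only exception). *)
Definition to_clin (K : numFieldType) (U V : tvsType K) (f : U -> V) : clin U V :=
  insubd 0 f.

Section ClinTheory.
Context (K : numFieldType) (U V : tvsType K) (f : clin U V).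

Lemma clin_linear : linear f.
Proof. by have /asboolP[] := valP f. Qed.

Lemma clin_continuous : continuous f.
Proof. by have /asboolP[] := valP f. Qed.

Lemma clin0 : f 0 = 0.
Proof.
by have := clin_linear (-1) 0 0; rewrite scaler0 addr0 scaleN1r addNr.
Qed.

Lemma clinZ a x : f (a *: x) = a *: f x.
Proof. by have := clin_linear a x 0; rewrite !addr0 clin0 addr0. Qed.

End ClinTheory.

(* An increasing sequence of normed spaces inside a vector space: [nrm n] is the
   norm of [step n], its values outside [step n] are irrelevant. *)
Record chain (K : numFieldType) := Chain {
  ch_sort :> lmodType K;
  step : nat -> set ch_sort;
  nrm : nat -> ch_sort -> K }.

Section InductiveLimit.
Context (K : numFieldType) (E : chain K).

(* The finest locally convex topology making all the inclusions of the steps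
   continuous: it is generated by the seminorms that are bounded (continuous) on
   every step. *)
Definition indlim_seminorms : set (seminorm E) :=
  [set q : seminorm E |
    forall n, exists M, forall x, step n x -> q x <= M * nrm n x].

Definition indlim : tvsType K := lctop indlim_seminorms.

End InductiveLimit.

Section LB.
Context (R : realType).
Local Notation C := R[i].

(* Steps are indexed from 0. *)
Record LBspace := LBSpace {
  lb_chain :> chain C;
  lb_banach : forall n, exists (B : completeNormedModType C)
    (j : {linear B -> lb_chain}),
    [/\ injective j, range j = step n
      & forall x, nrm n (j x) = `|x|];
  lb_subset : forall n, step (c := lb_chain) n `<=` step n.+1;
  lb_norm : forall n (x : lb_chain), step n x -> nrm n.+1 x = nrm n x;
  lb_cover : forall x : lb_chain, exists n, step n x }.

(* Norms take their values in C, as in the library; the supremum of a bounded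
   set of real elements of C. *)
Definition csup (A : set C) : C := (sup [set complex.Re z | z in A])%:C%C.

Section HomTopology.
Context (E F : chain C).

(* L(E_n, F_m). A function is considered as a map on E_n, its values elsewhere
   being ignored. *)
Definition homs n m : set (E -> F) := [set S : E -> F |
  [/\ forall a x y, step n x -> step n y -> S (a *: x + y) = a *: S x + S y,
      forall x, step n x -> step m (S x)
    & exists M, forall x, step n x -> nrm m (S x) <= M * nrm n x]].

Definition opnorm n m (S : E -> F) : C :=
  csup [set nrm m (S x) | x in [set x | step n x /\ nrm n x <= 1]].

(* ind lim_m L(E_n, F_m).  The carrier is larger than the union of the L(E_n, F_m)
   (which is harmless: a seminorm on a vector subspace always extends), and
   the seminorms of [indlim_seminorms (hom_chain n)] do not see the values of a
   function outside E_n since [opnorm n m] does not. *)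
Definition hom_chain n : chain C := @Chain C (E -> F) (homs n) (opnorm n).

(* The projective limit over n of ind lim_m L(E_n, F_m). *)
Definition hom_seminorms : set (seminorm (clin (indlim E) (indlim F))) :=
  [set q : seminorm (clin (indlim E) (indlim F)) |
    exists n, exists2 q' : seminorm (hom_chain n),
      indlim_seminorms q' & forall T, q T = q' (T : E -> F)].

Definition hom : tvsType C := lctop hom_seminorms.

End HomTopology.
End LB.

Section Tensors.
Context (R : realType) (Phi : LBspace R).
Local Notation C := R[i].

Definition dual := clin (indlim Phi) C^o.

(* The norm of the restriction of w to Phi_n. *)
Definition dnorm n (w : dual) : C :=
  csup [set `|w x| | x in [set x | step n x /\ nrm n x <= 1]].

Local Notation forms := (seq dual -> C^o).

(* Tensors of degree k are represented by the k-linear forms on Phi' they induce,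
   i.e. by functions on sequences of elements of Phi' that vanish off the
   sequences of size k.  [etens [:: x1; ...; xk]] is x1 (x) ... (x) xk. *)
Definition etens (t : seq Phi) : forms := fun s =>
  if size s == size t then \prod_(wx <- zip s t) wx.1 wx.2 else 0.

(* The algebraic k-th tensor power of Phi_n. *)
Definition alg_tens n k : set forms := [set f : forms |
  exists N (a : 'I_N -> C) (t : 'I_N -> seq Phi),
  (forall j, size (t j) = k /\ {in t j, forall x, step n x}) /\
  f = \sum_j a j *: etens (t j)].

(* The completed injective k-th tensor power of Phi_n: the closure of the
   algebraic one among the bounded k-linear forms on the dual of Phi_n, for the
   supremum norm over the unit ball of that dual.  Elements of the dual of
   Phi_n are obtained as restrictions of elements of Phi', which by Hahn-Banach
   produces all of them (each with its norm [dnorm n]). *)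
Definition inj_tens n k : set forms := [set f : forms |
  (forall s, size s <> k -> f s = 0) /\
  forall e : C, 0 < e -> exists2 g, alg_tens n k g &
    forall s, size s = k -> `|f s - g s| <= e * \prod_(w <- s) dnorm n w].

Definition inj_norm n k (f : forms) : C := csup [set `|f s| | s in
  [set s : seq dual | size s = k /\ {in s, forall w, dnorm n w <= 1}]].

(* Sym_k, in all degrees k at once. *)
Definition symz (f : forms) : forms := fun s =>
  ((size s)`!%:R)^-1 *:
  \sum_(g : 'S_(size s)) f [seq nth 0 s (g i) | i : 'I_(size s)].

End Tensors.

Section SymTensors.
Context (R : realType) (Phi : LBspace R).
Local Notation C := R[i].
Local Notation dual := (dual Phi).
Local Notation forms := (seq dual -> C^o).

Lemma step0 n : step n (0 : Phi).
Proof. by have [B [j [_ <- _]]] := lb_banach Phi n; exists 0; rewrite ?linear0. Qed.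

Lemma nrm_ge0 n (x : Phi) : step n x -> 0 <= nrm n x.
Proof.
by have [B [j [_ <- jn]]] := lb_banach Phi n => -[b _ <-]; rewrite jn.
Qed.

Lemma stepZ n a (x : Phi) : step n x -> step n (a *: x).
Proof.
by have [B [j [_ <- _]]] := lb_banach Phi n => -[b _ <-]; exists (a *: b); rewrite ?linearZ.
Qed.

Lemma nrmZ n a (x : Phi) : step n x -> nrm n (a *: x) = `|a| * nrm n x.
Proof.
have [B [j [_ <- jn]]] := lb_banach Phi n => -[b _ <-].
by rewrite -linearZ !jn normrZ.
Qed.

Lemma step_mono n m : (n <= m)%N -> step n `<=` step (c := Phi) m.
Proof.
move/subnK <-; elim: (m - n)%N => // d IH.
by apply: subset_trans IH _; exact: lb_subset.
Qed.

Lemma nrm_mono n m (x : Phi) : (n <= m)%N -> step n x -> nrm m x = nrm n x.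
Proof.
move=> nm nx; rewrite -(subnK nm); elim: (m - n)%N => // d IH.
rewrite addSn lb_norm//; apply: step_mono nx; exact: leq_addl.
Qed.

Lemma dual_bounded n (w : dual) :
  exists M : C, forall x : Phi, step n x -> nrm n x <= 1 -> `|w x| <= M.
Proof.
have : nbhs (w 0) [set z : C^o | `|z| < 1].
  rewrite clin0 -nbhs_ballE; exists 1 => //= z.
  by rewrite -ball_normE /= sub0r normrN.
move=> w1; have [k [p [e [Qp e0 pw]]]] := clin_continuous w1.
have /choice[M Mp] : forall i, exists Mi, forall x, step n x -> p i x <= Mi * nrm n x.
  by move=> i; exact: Qp.
pose T := \sum_i `|M i| / e i + 1.
have T0 : 0 < T by rewrite ltr_wpDl// sumr_ge0// => i _; rewrite divr_ge0// ltW.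
have MT i : `|M i| / e i < T.
  rewrite /T (bigD1 i)//= -addrA ltrDl ltr_wpDl// sumr_ge0// => j _.
  by rewrite divr_ge0// ltW.
exists T => x nx x1.
have := pw (T^-1 *: x); rewrite /= clinZ normrZ gtr0_norm ?invr_gt0// => H.
rewrite -[leRHS]mulr1 -ler_pdivrMl// ltW//; apply: H => i.
rewrite subr0 sn_scale gtr0_norm ?invr_gt0// ltr_pdivrMl// mulrC -ltr_pdivrMl//.
apply: le_lt_trans (MT i); rewrite mulrC ler_pM2r ?invr_gt0//.
have := Mp i x nx; rewrite -(ger0_norm (sn_ge0 (p i) x)) => pM.
apply: (le_trans pM).
have -> : M i * nrm n x = `|M i| * nrm n x.
  rewrite -[LHS]ger0_norm; first by rewrite normrM (ger0_norm (nrm_ge0 nx)).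
  exact: le_trans pM.
by rewrite ler_piMr.
Qed.

Lemma dnorm_set_sup n (w : dual) : has_sup
  [set complex.Re z | z in
    [set `|w x| | x in [set x : Phi | step n x /\ nrm n x <= 1]]].
Proof.
have [M wM] := dual_bounded n w; split.
  exists (complex.Re `|w 0|), `|w 0| => //; exists 0 => //.
  split; first exact: step0.
  by rewrite -(scale0r 0) nrmZ ?normr0 ?mul0r//; exact: step0.
exists (complex.Re M) => _ [_ [x [nx x1] <-] <-].
by have := wM x nx x1; rewrite lecE => /andP[].
Qed.

Lemma dnorm_ge0 n (w : dual) : 0 <= dnorm n w.
Proof.
rewrite /dnorm /csup ler0c.
apply: (@le_trans _ _ (complex.Re `|w 0|)); first by rewrite clin0 normr0.
apply: ub_le_sup; first by have [] := dnorm_set_sup n w.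
exists `|w 0| => //; exists 0 => //; split; first exact: step0.
by rewrite -(scale0r 0) nrmZ ?normr0 ?mul0r//; exact: step0.
Qed.

Lemma dnorm_mono n m (w : dual) : (n <= m)%N -> dnorm n w <= dnorm m w.
Proof.
move=> nm; rewrite /dnorm /csup lecR; apply: le_sup.
- move=> _ [_ [x [nx x1] <-] <-]; exists (complex.Re `|w x|); split => //.
  exists `|w x| => //; exists x => //; split; first exact: step_mono nx.
  by rewrite (nrm_mono nm).
- by have [] := dnorm_set_sup n w.
- exact: dnorm_set_sup.
Qed.

Definition lin_set (V : lmodType C) (A : set V) :=
  A 0 /\ forall a x y, A x -> A y -> A (a *: x + y).

Lemma alg_tens_submod n k : lin_set (alg_tens (Phi := Phi) n k).
Proof.
split=> [|a f g].
  have t0 : 'I_0 -> seq Phi by case.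
  exists 0%N, (fun=> 0), t0; split; first by case.
  by rewrite big_ord0.
move=> [N [b [t [tn ->]]]] [M [c [u [un ->]]]].
exists (N + M)%N,
  (fun i : 'I_(N + M) => match fintype.split i with inl j => a * b j | inr j => c j end),
  (fun i : 'I_(N + M) => match fintype.split i with inl j => t j | inr j => u j end).
split; first by move=> i; case: fintype.split.
rewrite big_split_ord/= scaler_sumr; congr (_ + _); apply: eq_bigr => i _.
  by rewrite (unsplitK (inl i)) scalerA.
by rewrite (unsplitK (inr i)).
Qed.

Lemma alg_tens_mono n m k : (n <= m)%N ->
  alg_tens (Phi := Phi) n k `<=` alg_tens m k.
Proof.
move=> nm _ [N [a [t [tn ->]]]]; exists N, a, t; split=> // j.
by have [tk st] := tn j; split=> // x /st; exact: step_mono.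
Qed.

Lemma inj_tens_mono n m k : (n <= m)%N ->
  inj_tens (Phi := Phi) n k `<=` inj_tens m k.
Proof.
move=> nm f [fk fe]; split=> // e e0; have [g gt fg] := fe e e0.
exists g; first exact: alg_tens_mono gt.
move=> s sk; apply: (le_trans (fg s sk)); rewrite ler_wpM2l ?(ltW e0)//.
by rewrite ler_prod// => w _; rewrite dnorm_ge0 dnorm_mono.
Qed.

Lemma inj_tens_submod n k : lin_set (inj_tens (Phi := Phi) n k).
Proof.
have [A0 AD] := alg_tens_submod n k.
split=> [|a f g].
  split=> // e e0; exists 0 => //.
  move=> s _; rewrite subrr normr0 mulr_ge0 ?(ltW e0)// prodr_ge0// => w _.
  exact: dnorm_ge0.
move=> [fk fe] [gk ge]; split=> [s sk|e e0].
  by rewrite /= !fctE/= fk// gk// scaler0 addr0.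
have a1 : 0 < `|a| + 1 by rewrite ltr_wpDl.
have [f' f't ff'] := fe (e / 2 / (`|a| + 1)) ltac:(by rewrite !divr_gt0).
have [g' g't gg'] := ge (e / 2) ltac:(by rewrite !divr_gt0).
exists (a *: f' + g'); first exact: AD.
move=> s sk; rewrite /= !fctE/= opprD addrACA -scalerBr.
rewrite (le_trans (ler_normD _ _))// [X in X * _]splitr mulrDl.
rewrite lerD ?gg'// normrZ (@le_trans _ _ ((`|a| + 1) * `|f s - f' s|))//.
  by rewrite ler_wpM2r// lerDl.
rewrite -ler_pdivlMl// (le_trans (ff' s sk))//.
by rewrite mulrA [_^-1 * _]mulrC.
Qed.

Lemma symz_linear : linear (@symz R Phi).
Proof.
move=> a f g; apply/funext => s; rewrite /symz /= !fctE/= !scaler_sumr -big_split/=.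
by apply: eq_bigr => i _; rewrite scalerDr !scalerA [a * _]mulrC.
Qed.

Definition is_sym_tens k : {pred forms} :=
  fun f => `[< exists n, (@symz R Phi @` inj_tens n k) f >].

Lemma is_sym_tens_submod k : submod_closed (is_sym_tens k).
Proof.
split=> [|a f g /asboolP[n [f' f't <-]] /asboolP[m [g' g't <-]]].
  apply/asboolP; exists 0%N, 0.
    by have [] := inj_tens_submod 0 k.
  have := symz_linear (-1) 0 0; rewrite scaler0 addr0 => ->.
  by rewrite scaleN1r addNr.
apply/asboolP; exists (maxn n m), (a *: f' + g'); last exact: symz_linear.
have [_ /(_ a f' g')] := inj_tens_submod (maxn n m) k.
apply.
  exact: inj_tens_mono (leq_maxl _ _) _ f't.
exact: inj_tens_mono (leq_maxr _ _) _ g't.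
Qed.

HB.instance Definition _ k := GRing.isSubmodClosed.Build C forms (is_sym_tens k)
  (is_sym_tens_submod k).

Record symt k := SymT { symt_fun :> forms; _ : symt_fun \in is_sym_tens k }.

HB.instance Definition _ k := [isSub for @symt_fun k].
HB.instance Definition _ k := [Choice of symt k by <:].
HB.instance Definition _ k := [SubChoice_isSubLmodule of symt k by <:].

Definition to_symt k (f : forms) : symt k := insubd 0 f.

(* The inductive sequence of the symmetric tensor powers Phi_n^k; its inductive
   limit is the k-th symmetric tensor power of Phi.  The power 0 is C, via
   f |-> f [::], and the power 1 is Phi, x in Phi being w |-> w x. *)
Definition symc k : chain C := Chain
  (fun n => [set f : symt k | (@symz R Phi @` inj_tens n k) f])
  (fun n f => inj_norm n k f).

End SymTensors.

Section Operators.
Context (R : realType) (Phi : LBspace R).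
Local Notation C := R[i].
Local Notation dual := (dual Phi).
Local Notation forms := (seq dual -> C^o).
Local Notation symt := (@symt R Phi).

Definition symHom k i : Type := hom (symc Phi k) (symc Phi i).
HB.instance Definition _ k i := Tvs.on (symHom k i).

Definition ap k i (A : symHom k i) (f : symt k) : symt i :=
  @clin_fun C (indlim (symc Phi k)) (indlim (symc Phi i)) A f.
Coercion ap : symHom >-> Funclass.

Definition to_hom k i (T : symt k -> symt i) : symHom k i :=
  to_clin (T : indlim (symc Phi k) -> indlim (symc Phi i)).

(* <w^k, f>; in general <w1 . ... . wk, f> is f [:: w1; ...; wk], for f is
   symmetric. *)
Definition dot (w : dual) k (f : symt k) : C := f (nseq k w).

Lemma dot_linear w k (a : C) (f g : symt k) :
  dot w (a *: f + g) = a * dot w f + dot w g.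
Proof. by []. Qed.

Lemma dot0 w k : dot w (0 : symt k) = 0.
Proof.
have := dot_linear w (-1) (0 : symt k) 0.
by rewrite scaler0 addr0 mulN1r addNr.
Qed.

Definition is_poly : {pred dual -> C^o} := fun p =>
  `[< exists K (f : forall k, symt k),
        p = fun w => \sum_(k < K.+1) dot w (f k) >].

Lemma is_poly_submod : submod_closed is_poly.
Proof.
split=> [|a p q /asboolP[K [f ->]] /asboolP[L [g ->]]].
  apply/asboolP; exists 0%N, (fun=> 0).
  by apply/funext => w; rewrite big_ord1 dot0.
apply/asboolP; exists (maxn K L),
  (fun k => a *: (if (k < K.+1)%N then f k else 0) +
    (if (k < L.+1)%N then g k else 0)).
apply/funext => w.
change (a * \sum_(k < K.+1) dot w (f k) + \sum_(k < L.+1) dot w (g k) =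
  \sum_(k < (maxn K L).+1) dot w (a *: (if (k < K.+1)%N then f k else 0) +
    (if (k < L.+1)%N then g k else 0))).
rewrite (big_ord_widen (maxn K L).+1 (fun k => dot w (f k))) ?ltnS ?leq_maxl//.
rewrite (big_ord_widen (maxn K L).+1 (fun k => dot w (g k))) ?ltnS ?leq_maxr//.
rewrite big_mkcond [X in _ + X]big_mkcond mulr_sumr -big_split.
apply: eq_bigr => k _; rewrite (dot_linear w a).
by do 2 case: ifP => _; rewrite ?dot0.
Qed.

HB.instance Definition _ := GRing.isSubmodClosed.Build C (dual -> C^o) is_poly
  is_poly_submod.

Record polyt := PolyT { polyt_fun :> dual -> C^o; _ : polyt_fun \in is_poly }.

HB.instance Definition _ := [isSub for polyt_fun].
HB.instance Definition _ := [Choice of polyt by <:].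
HB.instance Definition _ := [SubChoice_isSubLmodule of polyt by <:].

Lemma mono_subproof k (f : symt k) : (fun w => dot w f) \in is_poly.
Proof.
apply/asboolP; exists k, (fun j => if j == k then to_symt j f else 0).
apply/funext => w; rewrite (bigD1 ord_max)//= eqxx /to_symt valKd.
rewrite big1 ?addr0// => j jk.
by rewrite ifN ?dot0.
Qed.

Definition mono k (f : symt k) : polyt := PolyT (mono_subproof f).

(* The locally convex direct sum topology: the finest one making all the
   embeddings [mono] of the symmetric powers continuous. *)
Definition poly_seminorms : set (seminorm polyt) := [set q : seminorm polyt |
  forall k, continuous (fun f : indlim (symc Phi k) => q (mono f) : C^o)].

Definition PPhi : tvsType C := lctop poly_seminorms.

Definition to_poly (p : dual -> C^o) : polyt := insubd 0 p.

Definition Op : Type := clin PPhi PPhi.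
HB.instance Definition _ := GRing.Lmodule.on Op.

Definition op_ap (P : Op) (p : polyt) : polyt := @clin_fun C PPhi PPhi P p.
Coercion op_ap : Op >-> Funclass.

Definition to_op (T : polyt -> polyt) : Op := to_clin (T : PPhi -> PPhi).

Definition op_comp (P Q : Op) : Op := to_op (fun p => P (Q p)).

Definition id_hom k : symHom k k := to_hom id.

Definition op_matrix (P : Op) (m : forall i k, symHom k i) :=
  (forall i k, (k < i)%N -> m i k = 0) /\
  forall k (f : symt k) w, P (mono f) w = \sum_(i < k.+1) dot w (m i k f).

Definition in_M : set Op :=
  [set P | exists m, op_matrix P m /\ forall k, m k k = id_hom k].

Definition in_V : {pred Op} :=
  fun V => `[< exists m, op_matrix V m /\ forall k, m k k = 0 >].

Lemma ap_linear k i a (A B : symHom k i) f :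
  ap (a *: A + B) f = a *: ap A f + ap B f.
Proof. by []. Qed.

Lemma op_linear a (P Q : Op) p w : (a *: P + Q) p w = a * P p w + Q p w.
Proof. by []. Qed.

Lemma in_V_submod : submod_closed in_V.
Proof.
split=> [|a P Q /asboolP[m [[m0 mP] m1]] /asboolP[l [[l0 lQ] l1]]].
  apply/asboolP; exists (fun _ _ => 0); split=> //; split=> // k f w.
  by rewrite big1// => i _; exact: dot0.
apply/asboolP; exists (fun i k => a *: m i k + l i k); split; last first.
  by move=> k; rewrite m1 l1 scaler0 addr0.
split=> [i k ik|k f w]; first by rewrite m0// l0// scaler0 addr0.
rewrite op_linear mP lQ mulr_sumr -big_split; apply: eq_bigr => i _.
by rewrite ap_linear dot_linear.
Qed.

HB.instance Definition _ := GRing.isSubmodClosed.Build C Op in_V in_V_submod.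

Record Vt := VT { Vt_op : Op; _ : Vt_op \in in_V }.

HB.instance Definition _ := [isSub for Vt_op].
HB.instance Definition _ := [Choice of Vt by <:].
HB.instance Definition _ := [SubChoice_isSubLmodule of Vt by <:].

Definition entry (V : Vt) : forall i k, symHom k i :=
  xget (fun _ _ => 0) [set m | op_matrix (Vt_op V) m].

(* The product topology of the entries above the diagonal. *)
Definition V_seminorms : set (seminorm Vt) := [set q : seminorm Vt |
  exists i k (q' : seminorm (clin (indlim (symc Phi k)) (indlim (symc Phi i)))),
  [/\ (i < k)%N, hom_seminorms q' & forall V, q V = q' (entry V i k)]].

Definition VPhi : Type := lctop V_seminorms.
HB.instance Definition _ := Tvs.on VPhi.

Definition V_op (V : VPhi) : Op := Vt_op V.
Coercion V_op : VPhi >-> Op.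

Definition to_V (P : Op) : VPhi := insubd (0 : Vt) P.

(* V lowers degrees, so that for each p the sum is finite, as is the one in
   [logM] for P in M(Phi). *)
Definition expV (V : VPhi) : Op := to_op (fun p =>
  \sum_(n \in [set: nat]) (n`!%:R)^-1 *: iter n V p).

Definition logM (P : Op) : VPhi := to_V (to_op (fun p =>
  \sum_(n \in [set n | (0 < n)%N])
    ((-1) ^+ n.+1 / n%:R) *: iter n (fun q => P q - q) p)).

End Operators.

Section Derivatives.
Context (R : realType) (E : tvsType R[i]).
Local Notation C := R[i].

Definition rderiv (c : R -> E) (t : R) (v : E) :=
  (h^-1)%:C%C *: (c (t + h) - c t) @[h --> (0 : R)^'] --> v.

Definition smooth (c : R -> E) := exists d : nat -> R -> E,
  d 0%N = c /\ forall n t, rderiv (d n) t (d n.+1 t).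

Definition cderiv (c : C -> E) (z : C) (v : E) :=
  h^-1 *: (c (z + h) - c z) @[h --> (0 : C^o)^'] --> v.

(* b is the coefficient of s1 s2 in the Taylor expansion of F at (0, 0). *)
Definition taylor11 (F : C -> C -> E) (b : E) := exists2 g : C -> E,
  \forall s1 \near (0 : C^o), cderiv (F s1) 0 (g s1) & cderiv g 0 b.

End Derivatives.

Section FormalSeries.
Context (R : realType) (Phi : LBspace R).
Local Notation C := R[i].
Local Notation dual := (dual Phi).
Local Notation symt := (@symt R Phi).
Local Notation symHom := (@symHom R Phi).
Local Notation Op := (Op Phi).
Local Notation VPhi := (VPhi Phi).

Definition hom_comp k j i (A : symHom j i) (B : symHom k j) : symHom k i :=
  to_hom (fun f => A (B f)).

(* Transport along equalities k = k' and i = i' of the degrees, which hold in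
   all uses below (but in the term l = 0 of [series_deriv], which is 0). *)
Definition hom_cast k i k' i' (A : symHom k i) : symHom k' i' :=
  to_hom (fun f : symt k' => to_symt i' (A (to_symt k f))).

(* A (x) B, i.e. (A (x) 1)(1 (x) B), in terms of multilinear forms: B is applied
   to f as a form in its last i2 variables, then A to the result as a form in
   its first i1 variables.  The slices of f at sequences u of a size other than i1
   vanish or are not of degree i2, and are sent to 0 by [to_symt]. *)
Definition otimes i1 j1 i2 j2 (A : symHom i1 j1) (B : symHom i2 j2)
    (f : symt (i1 + i2)) : seq dual -> C^o := fun s =>
  A (to_symt i1 (fun u => B (to_symt i2 (fun v => f (u ++ v))) (drop j1 s)))
    (take j1 s).

Definition odot i1 j1 i2 j2 (A : symHom i1 j1) (B : symHom i2 j2) :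
    symHom (i1 + i2)%N (j1 + j2)%N :=
  to_hom (fun f => to_symt (j1 + j2)%N (symz (otimes A B f))).

(* The coefficients of a formal series; scalar series have i = 0 and Phi-valued
   ones i = 1, in which case the coefficient of index 0 is to be 0. *)
Definition series i := forall k, symHom k i.

Definition series_mul (A1 A2 : series 0) : series 0 := fun k =>
  \sum_(l < k.+1) hom_cast k 0 (odot (A1 l) (A2 (k - l)%N)).

(* B_{i1} . (B_{i2} . ( ... (B_{il} . 1))) for t = [:: i1; ...; il] *)
Fixpoint odots (B : series 1) (t : seq nat) : symHom (sumn t) (size t) :=
  if t is i :: t' then odot (B i) (odots B t') else id_hom Phi 0.

Definition series_comp_coef i (A : series i) (B : series 1) k : symHom k i :=
  \sum_(1 <= l < k.+1) hom_comp (A l)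
    (\sum_(t : l.-tuple 'I_k.+1 |
        [forall j, 0 < tnth t j]%N && (sumn [seq val j | j <- t] == k))
      hom_cast k l (odots B [seq val j | j <- t])).

Definition series_comp i (A : series i) (B : series 1) : series i := fun k =>
  if k is k'.+1 then series_comp_coef A B k'.+1 else A 0%N.

(* D_B A *)
Definition series_deriv i (B : series 1) (A : series i) : series i := fun k =>
  \sum_(i <= l < k.+1) l%:R *: hom_comp (A l)
    (hom_cast k l (odot (id_hom Phi l.-1) (B (k - l).+1))).

Definition series2 : Type := series 0 * series 1.

Definition in_S : set series2 := [set X |
  [/\ X.1 0%N = id_hom Phi 0, X.2 0%N = 0 & X.2 1%N = id_hom Phi 1]].

Definition in_W : set series2 := [set x |
  [/\ x.1 0%N = 0, x.2 0%N = 0 & x.2 1%N = 0]].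

Definition S_mul (X Y : series2) : series2 :=
  (series_mul (series_comp X.1 Y.2) Y.1, series_comp X.2 Y.2).

Definition one_parameter_subgroup (c : R -> series2) :=
  [/\ forall t, in_S (c t),
      forall s t, c (s + t) = S_mul (c s) (c t),
      forall k, smooth (fun t => (c t).1 k)
    & forall k, smooth (fun t => (c t).2 k)].

Definition EXP (x : series2) : series2 := xget (fun=> 0, fun=> 0)
  [set X | exists c, [/\ one_parameter_subgroup c,
    forall k, rderiv (fun t => (c t).1 k) 0 (x.1 k),
    forall k, rderiv (fun t => (c t).2 k) 0 (x.2 k) & X = c 1]].

Definition scal (z : C) : symt 0 :=
  to_symt 0 (fun s : seq dual => if s is [::] then z else 0).

(* The scalar series <w, B(xi)>. *)
Definition series_dot (w : dual) (B : series 1) : series 0 := fun k =>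
  to_hom (fun f => scal (dot w (B k f))).

Definition series_one : series 0 := fun k =>
  if k is 0%N then id_hom Phi 0 else 0.

(* The exponential of a scalar series with zero constant term, whose n-th power
   has no coefficient of index less than n. *)
Definition series_exp (A : series 0) : series 0 := fun k =>
  \sum_(n < k.+1) (n`!%:R)^-1 *: iter n (series_mul A) series_one k.

(* For all w, G(w, xi) = exp[<w, B(xi)>] A(xi) as formal series of xi. *)
Definition has_gen_fun (P : Op) (X : series2) :=
  forall (w : dual) k (f : symt k),
    (k`!%:R)^-1 * P (mono f) w =
    series_mul (series_exp (series_dot w X.2)) X.1 k f [::].

Definition Sheffer : set Op :=
  [set P | in_M P /\ exists2 X, in_S X & has_gen_fun P X].

Definition Imap (X : series2) : Op :=
  xget 0 [set P | in_M P /\ has_gen_fun P X].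

Definition Rmap (x : series2) : VPhi := logM (Imap (EXP x)).

Definition lie_algebra : set VPhi := [set logM P | P in Sheffer].

Definition lie_b (v w : VPhi) : VPhi := xget 0 [set b : VPhi |
  taylor11 (fun s1 s2 => logM (op_comp (expV (s1 *: v)) (expV (s2 *: w)))) b].

Definition lie_bracket (v w : VPhi) : VPhi := lie_b v w - lie_b w v.

End FormalSeries.

Section Gradient.
Context (R : realType) (Phi : LBspace R).
Local Notation C := R[i].
Local Notation dual := (dual Phi).

Definition dir_deriv (s : dual) (p : dual -> C^o) : dual -> C^o := fun w =>
  derive1 (fun h : C => p (w + h *: s)) 0.

Definition grad k (p : dual -> C^o) (w : dual) : symt Phi k :=
  xget 0 [set g : symt Phi k | forall s : seq dual, size s = k ->
    foldr dir_deriv p s w = g s].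

(* Both sums are finite for each p, whose gradients of order greater than its
   degree vanish. *)
Definition alpha_nabla (a : series Phi 0) : VPhi Phi :=
  to_V (to_op (fun p => \sum_(k \in [set k | (1 <= k)%N])
    to_poly (fun w => a k (grad k p w) [::]))).

Definition M_nabla (b : series Phi 1) : VPhi Phi :=
  to_V (to_op (fun p => \sum_(k \in [set k | (2 <= k)%N])
    to_poly (fun w => dot w (b k (grad k p w))))).

End Gradient.

(* Main.v *)
From HB Require Import structures.
From mathcomp Require Import all_boot all_order all_algebra perm complex.
From mathcomp Require Import zify ring lra.
From mathcomp Require Import all_classical all_reals interval_inference.
From mathcomp Require Import topology normedtype derive realfun tvs.
Require Import Defs.

Set Implicit Arguments.
Unset Strict Implicit.
Unset Printing Implicit Defensive.

Import Order.TTheory GRing.Theory Num.Theory.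
Import numFieldTopology.Exports numFieldNormedType.Exports.

Local Open Scope classical_set_scope.
Local Open Scope ring_scope.

(** The theorem holds because every object in it is determined by its action on the
    exponential series [e^w = sum_k w^k / k!], where it becomes a flow computation.

    The scalar formal series form a commutative algebra on which each Phi-valued
    series [b] without constant term acts by a derivation [D_b], and [e^w e^w' = e^(w + w')],
    [D_b e^w = e^w <w, b>]. A map of series each of whose output coefficients is a
    finite combination of input coefficients vanishes as soon as it vanishes on all
    [e^w] (ff_sexp_eq0): by polarization a symmetric tensor is known from its
    values on the diagonal. So associativity, the Leibniz rule, the laws of
    composition and the like are read off on exponentials.

    (i) Let [L a = D_be a + al a]. The operator [V = al(nabla) + M(be(nabla))] sends
    the monomial [<w^k, f>] to [k!] times the coefficient of [L e^w] at [f]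
    (vfield_symbol), so the generating function of [exp V] is [exp(L) e^w]. As [L] is
    a derivation up to the potential [al], [exp(t L) e^w = A_t exp<w, B_t>] with
    [A_t = exp(t L) 1] and [B_t = exp(t D_be) xi] (lexp_sL_sexp), so that [exp V] is
    the Sheffer operator of [(A_1, B_1)]. Moreover composing with the flow is the
    exponential of the vector field (scomp_flow), which is why [t |-> (A_t, B_t)] is
    a one-parameter subgroup, with derivative [(al, be)] at 0. It is the only one
    (generator_unique): differentiating the group law gives a triangular linear
    system, solved degree by degree. Hence [EXP (al, be) = (A_1, B_1)] and
    [log (I (EXP (al, be))) = log (exp V) = V].

    (ii) Since operators lowering the degree are locally nilpotent, each entry of
    [log (exp (s1 v) exp (s2 w))] is a polynomial in [s1, s2], whose coefficient of
    [s1 s2] is [v w - (v w + w v) / 2] (bch11); antisymmetrization gives the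
    commutator. On exponentials, the commutator of two operators as in (i) is the
    commutator of their [L], that is [e^w] times the difference of the mutual
    derivatives of the two fields (sL_commutator).

    The analysis lies in making sense of these manipulations. A symmetric tensor is a
    limit of algebraic ones, on which slices and tensor products of maps are explicit
    (slice_app_stens, tensor_app_inj); a continuous map between the inductive limits
    sends each step boundedly into a single step (clin_factor); and the evaluations
    [A |-> <s, A f>] are continuous (eval_seminorm), which makes the topologies of
    operators Hausdorff and lets curves of operators be differentiated pointwise. *)

(** * The Hahn-Banach theorem *)

Section HahnBanach.
Context (R : realType) (E : lmodType R[i]).
Local Notation C := R[i].
Implicit Types (x y : E) (G : set (E * R)).

(** Partial functionals are encoded by their graphs, which inclusion orders as Zorn's lemma
    requires. *)
Definition rlin_graph G := G (0, 0) /\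
  forall (r : R) u v, G u -> G v -> G (r%:C%C *: u.1 + v.1, r * u.2 + v.2).

Context (p : E -> R).
Hypothesis pD : forall x y, p (x + y) <= p x + p y.
Hypothesis pZ : forall (r : R) x, 0 <= r -> p (r%:C%C *: x) = r * p x.

Definition dom_graph G := rlin_graph G /\ forall u, G u -> u.2 <= p u.1.

Lemma dom_graph_fun G x a b : dom_graph G -> G (x, a) -> G (x, b) -> a = b.
Proof.
move=> [[G0 Gl] Gp] xa xb.
have p0 : p 0 = 0 by have := pZ 0 (lexx 0); rewrite mul0r scale0r.
have key (r : R) : r * (a - b) <= 0.
  have /Gp /= := Gl r _ _ xa (Gl (- r) _ _ xb G0).
  rewrite !addr0 -scalerDl -rmorphD/= subrr scale0r p0.
  by rewrite mulNr mulrBr.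
have := key (a - b); rewrite -expr2 => H; apply/eqP.
by rewrite -subr_eq0 -sqrf_eq0 eq_le H sqr_ge0.
Qed.

(** The value at [x0] may be any number between the lower bounds and the upper bounds
    that the domination by [p] imposes; they are compatible since [p] is subadditive. *)
Lemma dom_graph_extend G x0 : dom_graph G ->
  exists2 G' : set (E * R), G `<=` G' /\ dom_graph G' & exists c, G' (x0, c).
Proof.
move=> [[G0 Gl] Gp].
pose S := [set u.2 - p (u.1 - x0) | u in G].
have SB u v : G u -> G v -> u.2 - p (u.1 - x0) <= p (v.1 + x0) - v.2.
  move=> Gu Gv; have := Gp _ (Gl 1 _ _ Gu Gv).
  rewrite /= scale1r mul1r => H.
  have := pD (u.1 - x0) (v.1 + x0); rewrite addrACA addNr addr0 => H'.
  by lra.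
have Ssup : has_sup S.
  split; first by exists (0 - p (0 - x0)), (0, 0).
  by exists (p (0 + x0) - 0) => _ [u Gu <-]; exact: SB Gu G0.
pose c := sup S.
have c1 u : G u -> u.2 - p (u.1 - x0) <= c.
  by move=> Gu; apply: ub_le_sup; [case: Ssup|exists u].
have c2 u : G u -> c <= p (u.1 + x0) - u.2.
  move=> Gu; apply: ge_sup; first by case: Ssup.
  by move=> _ [v Gv <-]; exact: SB.
pose G' := [set w | exists u (t : R), G u /\
  w = (u.1 + t%:C%C *: x0, u.2 + t * c)].
exists G'; last first.
  exists c, (0, 0), 1; split=> //=.
  by rewrite scale1r add0r mul1r add0r.
split.
  move=> [y b] Gyb; exists (y, b), 0; split=> //=.
  by rewrite scale0r addr0 mul0r addr0.
split.
  split; first by exists (0, 0), 0; split => //=; rewrite scale0r mul0r !addr0.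
  move=> r _ _ [u [t [Gu ->]]] [v [s [Gv ->]]] /=.
  exists (r%:C%C *: u.1 + v.1, r * u.2 + v.2), (r * t + s); split => /=.
    exact: Gl.
  congr (_, _); last by ring.
  by rewrite scalerDr scalerA -rmorphM addrACA -scalerDl -rmorphD.
move=> _ [u [t [Gu ->]]] /=.
have Gs (r : R) v : G v -> G (r%:C%C *: v.1, r * v.2).
  by move=> Gv; have := Gl r _ _ Gv G0; rewrite /= !addr0.
have [t0|t0|->] := ltgtP t 0; last by rewrite scale0r mul0r !addr0; exact: Gp.
- have := c1 _ (Gs (- t)^-1 _ Gu); rewrite /= => H.
  have t1 : 0 < - t by rewrite oppr_gt0.
  have -> : u.1 + t%:C%C *: x0 = (- t)%:C%C *: ((- t)^-1%:C%C *: u.1 - x0).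
    rewrite scalerBr scalerA -rmorphM/= divff ?gt_eqF// scale1r.
    by rewrite rmorphN scaleNr opprK.
  rewrite (pZ _ (ltW t1)).
  have : (- t) * ((- t)^-1 * u.2 - p ((- t)^-1%:C%C *: u.1 - x0)) <= (- t) * c.
    by rewrite ler_pM2l.
  by rewrite mulrBr mulrA divff ?gt_eqF// mul1r => ?; lra.
- have := c2 _ (Gs t^-1 _ Gu); rewrite /= => H.
  have -> : u.1 + t%:C%C *: x0 = t%:C%C *: (t^-1%:C%C *: u.1 + x0).
    by rewrite scalerDr scalerA -rmorphM/= divff ?gt_eqF// scale1r.
  rewrite (pZ _ (ltW t0)).
  have : t * c <= t * (p (t^-1%:C%C *: u.1 + x0) - t^-1 * u.2).
    by rewrite ler_pM2l.
  by rewrite mulrBr mulrA divff ?gt_eqF// mul1r => ?; lra.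
Qed.

(** A maximal dominated extension has full domain, by the one-step extension. *)
Lemma dom_graph_total G : dom_graph G -> exists g : E -> R,
  [/\ forall (r : R) x y, g (r%:C%C *: x + y) = r * g x + g y,
      forall u, G u -> g u.1 = u.2 & forall x, g x <= p x].
Proof.
move=> Gd.
(* The union with [G] makes the empty chain harmless. *)
pose P := [set X : set (E * R) | dom_graph (X `|` G)].
have Pch (F : set (set (E * R))) : F `<=` P -> total_on F subset ->
    P (\bigcup_(X in F) X).
  move=> FP Ft; rewrite /P/=.
  have key u v : (\bigcup_(X in F) X `|` G) u -> (\bigcup_(X in F) X `|` G) v ->
      exists X : set (E * R), [/\ dom_graph (X `|` G), (X `|` G) u, (X `|` G) v
        & X `<=` \bigcup_(X in F) X].
    move=> [[X FX Xu]|Gu] [[Y FY Yv]|Gv].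
    - have [XY|YX] := Ft X Y FX FY.
        exists Y; split; [exact: FP|by left; exact: XY|by left|exact: bigcup_sup].
      exists X; split; [exact: FP|by left|by left; exact: YX|exact: bigcup_sup].
    - exists X; split; [exact: FP|by left|by right|exact: bigcup_sup].
    - exists Y; split; [exact: FP|by right|by left|exact: bigcup_sup].
    - exists set0; split; [by rewrite set0U|by right|by right|exact: sub0set].
  split; first (split; first by right; case: Gd => -[]).
    move=> r u v Hu Hv; have [X [[[_ Xl] _] Xu Xv XF]] := key u v Hu Hv.
    by have [/XF|] := Xl r _ _ Xu Xv; [left|right].
  move=> u Hu; have [X [[_ Xp] Xu _ _]] := key u u Hu Hu; exact: Xp.
have [A [PA Amax]] := Zorn_bigcup Pch.
have tot x : exists c, (A `|` G) (x, c).
  have [G' [AG' dG'] [c G'c]] := dom_graph_extend x PA.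
  exists c; have [G'A|nG'A] := pselect (G' `<=` A); first by left; exact: G'A.
  exfalso; apply: (Amax G'); last first.
    rewrite /P/= (_ : G' `|` G = G')//; apply/seteqP; split; last by left.
    by move=> u [//|Gu]; apply: AG'; right.
  by split; [move=> u Au; apply: AG'; left|exact: nG'A].
have /choice[g gP] := tot; exists g; split.
- move=> r x y; have [[_ Al] _] := PA.
  have := Al r _ _ (gP x) (gP y); apply: dom_graph_fun PA (gP _).
- by move=> [x a] Ga; apply: dom_graph_fun PA (gP _) _; right.
- by move=> x; have [_] := PA; move=> /(_ _ (gP x)).
Qed.

End HahnBanach.

(** The complex case follows from the real one by recovering a complex functional from its
    real part, as [x |-> g x - i g (i x)]. *)
Lemma hahn_banach (R : realType) (E : lmodType R[i]) (p : E -> R)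
    (L : set E) (f : E -> R[i]) :
  (forall x y, p (x + y) <= p x + p y) ->
  (forall a x, p (a *: x) = complex.Re `|a| * p x) ->
  lin_set L ->
  (forall a x y, L x -> L y -> f (a *: x + y) = a * f x + f y) ->
  (forall x, L x -> `|f x| <= (p x)%:C%C) ->
  exists g : E -> R[i], [/\ forall a x y, g (a *: x + y) = a * g x + g y,
    forall x, L x -> g x = f x & forall x, `|g x| <= (p x)%:C%C].
Proof.
move=> pD pZ [L0 LD] fl fp.
have f0 : f 0 = 0.
  have := fl 1 0 0 L0 L0; rewrite scaler0 addr0 mul1r => /eqP.
  by rewrite addrC -subr_eq subrr eq_sym => /eqP.
pose G := [set u : E * R | L u.1 /\ u.2 = complex.Re (f u.1)].
have pZr (r : R) x : 0 <= r -> p (r%:C%C *: x) = r * p x.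
  by move=> r0; rewrite pZ ger0_norm// lecR.
have ReM (r : R) (z : R[i]) : complex.Re (r%:C%C * z) = r * complex.Re z.
  by case: z => a b /=; rewrite mul0r subr0.
have ReD (z t : R[i]) : complex.Re (z + t) = complex.Re z + complex.Re t.
  by case: z t => [a b] [c d].
have Re_norm (z : R[i]) : complex.Re z <= complex.Re `|z|.
  by rewrite -lecR (le_trans _ (normc_ge_Re z))// lecR ler_norm.
have Gd : dom_graph p G.
  split; [split|].
  - by split => //=; rewrite f0.
  - move=> r u v [Lu uf] [Lv vf]; split => /=; first exact: LD.
    by rewrite uf vf fl// ReD ReM.
  - move=> u [Lu ->]; apply: (le_trans (Re_norm _)).
    by have := fp _ Lu; rewrite lecE => /andP[].
have [g [gl gG gp]] := dom_graph_total pD pZr Gd.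
have gD x y : g (x + y) = g x + g y.
  by have := gl 1 x y; rewrite scale1r mul1r.
have g0 : g 0 = 0.
  by have /eqP := gD 0 0; rewrite addr0 -subr_eq subrr eq_sym => /eqP.
have gZ (r : R) x : g (r%:C%C *: x) = r * g x.
  by have := gl r x 0; rewrite !addr0 g0 addr0.
pose F x : R[i] := (g x)%:C%C - 'i%C * (g ('i%C *: x))%:C%C.
have FD x y : F (x + y) = F x + F y.
  by rewrite /F scalerDr !gD !rmorphD/= mulrDr; ring.
have Fr (r : R) x : F (r%:C%C *: x) = r%:C%C * F x.
  rewrite /F scalerA [_ * r%:C%C]mulrC -scalerA !gZ !rmorphM/=; ring.
have Fi x : F ('i%C *: x) = 'i%C * F x.
  rewrite /F scalerA -expr2 sqr_i scaleN1r.
  have -> : g (- x) = - g x.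
    by rewrite -scaleN1r -[-1](rmorphN1 (real_complex R))/= gZ mulN1r.
  rewrite rmorphN/= mulrBr mulrA -expr2 sqr_i; ring.
have FZ a x : F (a *: x) = a * F x.
  rewrite [a]complexE scalerDl FD -scalerA Fi !Fr mulrDl mulrA; ring.
exists F; split.
- by move=> a x y; rewrite FD FZ.
- move=> x Lx.
  have Lix : L ('i%C *: x) by have := LD 'i%C _ _ Lx L0; rewrite addr0.
  have gf y : L y -> g y = complex.Re (f y).
    by move=> Ly; have /= := gG (y, complex.Re (f y)) (conj Ly erefl).
  rewrite /F (gf _ Lx) (gf _ Lix).
  have := fl 'i%C x 0 Lx L0; rewrite f0 !addr0 => ->.
  by case: (f x) => a b; apply/eqP; rewrite eq_complex /=; apply/andP; split; apply/eqP; ring.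
- move=> x.
  have [->|Fx0] := eqVneq (F x) 0.
    have p0 : p 0 = 0 by have := pZ 0 0; rewrite scale0r normr0/= mul0r.
    have := pD x (- x); rewrite subrr p0 -scaleN1r pZ normrN1/= mul1r.
    by rewrite normr0 lecR => ?; lra.
  (* A rotation of [x] makes its value real, where the bound on the real part applies. *)
  pose u := `|F x| / F x.
  have Hu : F (u *: x) = `|F x| by rewrite FZ /u divfK.
  have u1 : `|u| = 1 by rewrite /u normrM normfV normr_id divff// normr_eq0.
  have Hg : (g (u *: x))%:C%C = `|F x|.
    have : complex.Re (F (u *: x)) = g (u *: x).
      by rewrite /F /=; ring.
    by move=> <-; rewrite Hu; apply/RRe_real/normr_real.
  rewrite -Hg lecR (le_trans (gp _))// pZ u1 /= mul1r//.
Qed.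

(** * Seminorms and inductive limits *)

Section Csup.
Context (R : realType).
Local Notation C := R[i].

Lemma lecRe (a b : C) : a <= b -> complex.Re a <= complex.Re b.
Proof. by rewrite lecE => /andP[]. Qed.

Lemma csup_ub (A : set C) M a : (forall z, A z -> 0 <= z <= M) -> A a ->
  a <= csup A.
Proof.
move=> AM Aa; have /andP[a0 aM] := AM _ Aa.
rewrite -[a]RRe_real ?ger0_real// lecR; apply: ub_le_sup; last by exists a.
by exists (complex.Re M) => _ [z /AM/andP[_ zM] <-]; exact: lecRe.
Qed.

Lemma csup_le (A : set C) M : A !=set0 -> (forall z, A z -> 0 <= z <= M) ->
  csup A <= M.
Proof.
move=> [a Aa] AM; have /andP[a0 aM] := AM _ Aa.
rewrite -[M]RRe_real ?ger0_real ?(le_trans a0)// lecR; apply: ge_sup.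
  by exists (complex.Re a), a.
by move=> _ [z /AM/andP[_ zM] <-]; exact: lecRe.
Qed.

Lemma csup_ge0 (A : set C) : (forall z, A z -> 0 <= z) -> 0 <= csup A.
Proof.
move=> A0; rewrite ler0c; have [hs|nhs] := pselect (has_sup [set complex.Re z | z in A]).
  have [[_ [z Az _]] ub] := hs.
  apply: (@le_trans _ _ (complex.Re z)); last by apply: ub_le_sup => //; exists z.
  by have := lecRe (A0 _ Az).
by rewrite sup_out.
Qed.

(** How equalities between limits of algebraic tensors are proved. *)
Lemma vanish_small (z c : C) : (forall e, 0 < e -> `|z| <= e * c) -> z = 0.
Proof.
move=> zc; apply/eqP; rewrite -normr_le0; apply/ler_addgt0Pr => e e0.
have c0 : 0 <= c by have := zc 1 ltr01; rewrite mul1r; exact: le_trans.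
have c1 : 0 < c + 1 by rewrite ltr_wpDl.
rewrite add0r (le_trans (zc (e / (c + 1)) _)) ?divr_gt0//.
by rewrite -mulrA ler_piMr ?(ltW e0)// ler_pdivrMl// mulr1 lerDl.
Qed.

End Csup.

Section LocallyConvex.
Context (K : numFieldType).

Definition sn_comp_fun (E F : lmodType K) (q : seminorm F) (f : E -> F) (x : E) :=
  q (f x).

Section Comp.
Context (E F : lmodType K) (q : seminorm F) (f : E -> F) (fl : linear f).

Lemma sn_compD x y :
  sn_comp_fun q f (x + y) <= sn_comp_fun q f x + sn_comp_fun q f y.
Proof.
by have := fl 1 x y; rewrite /sn_comp_fun !scale1r => ->; exact: sn_triangle.
Qed.

Lemma sn_compZ a x : sn_comp_fun q f (a *: x) = `|a| * sn_comp_fun q f x.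
Proof.
have f0 : f 0 = 0.
  by have := fl (-1) 0 0; rewrite scaler0 addr0 scaleN1r addNr.
by have := fl a x 0; rewrite /sn_comp_fun !addr0 f0 addr0 => ->; exact: sn_scale.
Qed.

Definition sn_comp := Seminorm sn_compD sn_compZ.

End Comp.

Lemma sn_dist (E : lmodType K) (q : seminorm E) x y : `|q x - q y| <= q (x - y).
Proof.
have qr z : q z \is Num.real by rewrite ger0_real// sn_ge0.
rewrite real_ler_norml ?rpredB//; apply/andP; split.
  rewrite lerNl opprB lerBlDr -(snN q (x - y)) opprB.
  by rewrite -{1}(subrK x y) sn_triangle.
by rewrite lerBlDr -{1}(subrK y x) sn_triangle.
Qed.

Lemma lc_seminorm_continuous (E : lmodType K) (Q : set (seminorm E)) p : Q p ->
  continuous (p : lctop Q -> K^o).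
Proof.
move=> Qp x; have FF : Filter (nbhs (x : lctop Q)) := nbhs_filter (x : lctop Q).
apply/(@cvgrPdist_lt _ _ _ _ (@fmap_filter _ _ _ (nbhs (x : lctop Q)) FF)) => e e0.
apply: (@filterS _ (nbhs (x : lctop Q)) (nbhs_filter (x : lctop Q)) _ _ _ (lc_near x Qp e0)) => y /=.
by rewrite distrC; exact/le_lt_trans/sn_dist.
Qed.

(** A neighbourhood of 0 on which [p < 1] contains a ball of the topology; homogeneity
    turns the inclusion into a bound. *)
Lemma lc_seminorm_dominated (E : lmodType K) (Q : set (seminorm E))
    (p : seminorm E) : continuous (p : lctop Q -> K^o) ->
  exists n (q : 'I_n -> seminorm E) (M : 'I_n -> K),
    [/\ forall i, Q (q i), forall i, 0 <= M i
      & forall x, p x <= \sum_i M i * q i x].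
Proof.
move=> /(_ (0 : lctop Q)) pc.
have : nbhs (p (0 : E) : K^o) [set z : K^o | `|z| < 1].
  rewrite sn0 -nbhs_ballE; exists 1 => //= z.
  by rewrite -ball_normE /= sub0r normrN.
move=> /pc [n [q [e [Qq e0 qp]]]].
exists n, q, (fun i => (e i)^-1); split=> // [i|x]; first by rewrite invr_ge0 ltW.
apply/ler_addgt0Pr => d d0; set S := \sum_i _.
have S0 : 0 <= S by rewrite sumr_ge0// => i _; rewrite mulr_ge0 ?invr_ge0 ?sn_ge0 ?ltW.
have t0 : 0 < S + d by rewrite ltr_wpDl.
have /= := qp ((S + d)^-1 *: x); rewrite /= sn_scale.
rewrite (@ger0_norm _ (S + d)^-1) ?invr_ge0 ?(ltW t0)//.
rewrite ger0_norm ?mulr_ge0 ?invr_ge0 ?sn_ge0 ?(ltW t0)//.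
move=> H; rewrite -[leRHS]mulr1 -ler_pdivrMl// ltW//; apply: H => i.
rewrite subr0 sn_scale ger0_norm ?invr_ge0 ?(ltW t0)// ltr_pdivrMl//.
rewrite -ltr_pdivrMr// mulrC (@le_lt_trans _ _ S)//; last by rewrite ltrDl.
rewrite /S (bigD1 i)//= lerDl sumr_ge0// => j _.
by rewrite mulr_ge0 ?invr_ge0 ?sn_ge0 ?ltW.
Qed.

Lemma lc_clin (E F : lmodType K) (Q : set (seminorm E)) (Q' : set (seminorm F))
    (f : E -> F) : linear f ->
  (forall q, Q' q -> exists2 r : seminorm E, Q r & forall x, q (f x) <= r x) ->
  (f : lctop Q -> lctop Q') \in @cont_lin K (lctop Q) (lctop Q').
Proof.
move=> fl fb; apply/asboolP; split=> // x.
have FF : Filter (nbhs (x : lctop Q)) := nbhs_filter (x : lctop Q).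
apply/(@lc_cvgP _ _ _ _ _ (@fmap_filter _ _ _ (nbhs (x : lctop Q)) FF)) => q e Q'q e0.
have [r Qr qr] := fb q Q'q.
apply: (@filterS _ (nbhs (x : lctop Q)) (nbhs_filter (x : lctop Q)) _ _ _ (lc_near x Qr e0)) => y /=.
have -> : f y - f x = f (y - x).
  by rewrite addrC -scaleN1r -fl scaleN1r addrC.
exact/le_lt_trans/qr.
Qed.

Lemma clin_seminorm_continuous (E F : lmodType K) (Q : set (seminorm E))
    (Q' : set (seminorm F)) (f : clin (lctop Q) (lctop Q')) (q : seminorm F) : Q' q ->
  continuous ((fun x => q (f x)) : lctop Q -> K^o).
Proof.
move=> Qq x; apply: (@continuous_comp _ _ _ (f : lctop Q -> lctop Q') (q : lctop Q' -> K^o)).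
  exact: clin_continuous.
exact: lc_seminorm_continuous.
Qed.

Lemma lc_hausdorff (E : lmodType K) (Q : set (seminorm E)) :
  (forall x, (forall p, Q p -> p x = 0) -> x = 0) -> hausdorff_space (lctop Q).
Proof.
move=> Qsep x y xy; apply/eqP; rewrite -subr_eq0; apply/eqP/Qsep => p Qp.
apply/eqP; rewrite eq_le sn_ge0 andbT; apply/ler_addgt0Pr => e e0.
have e2 : 0 < e / 2 by rewrite divr_gt0.
have [z [/= zx zy]] := xy _ _ (lc_near x Qp e2) (lc_near y Qp e2).
rewrite add0r -(subrK z x) -addrA (le_trans (sn_triangle _ _ _))//.
by rewrite [leRHS]splitr lerD ?ltW// -snN opprB.
Qed.

Lemma to_clinE (U V : tvsType K) (f : U -> V) : f \in @cont_lin K U V ->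
  forall x, to_clin f x = f x.
Proof. by move=> fc x; rewrite /to_clin /= insubdK. Qed.

Section Chain.
Context (E : chain K).

Lemma indlim_seminorm_of_continuous (p : seminorm E) :
  continuous (p : indlim E -> K^o) -> indlim_seminorms p.
Proof.
move=> /lc_seminorm_dominated[m [q [M [Qq M0 pq]]]] n.
have /choice[N qN] : forall i, exists N, forall x, step n x -> q i x <= N * nrm n x.
  by move=> i; exact: Qq.
exists (\sum_i M i * N i) => x nx; rewrite (le_trans (pq x))// mulr_suml.
by apply: ler_sum => i _; rewrite -mulrA ler_wpM2l// qN.
Qed.

Lemma clin_indlim (F : lmodType K) (Q : set (seminorm F)) (f : E -> F) :
  linear f ->
  (forall q, Q q -> forall n, exists M, forall x, step n x -> q (f x) <= M * nrm n x) ->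
  (f : indlim E -> lctop Q) \in @cont_lin K (indlim E) (lctop Q).
Proof. by move=> fl fb; apply: lc_clin => // q Qq; exists (sn_comp q fl) => //; exact: fb. Qed.

(** Continuity on an inductive limit is boundedness on the steps, because continuous
    seminorms are among those defining the topology. *)
Lemma clin_indlim_bound (F : lmodType K) (Q : set (seminorm F))
    (f : clin (indlim E) (lctop Q)) q : Q q ->
  forall n, exists M, forall x, step n x -> q (f x) <= M * nrm n x.
Proof.
move=> Qq n.
have fl : linear (f : E -> F) := clin_linear f.
apply: (@indlim_seminorm_of_continuous (sn_comp q fl)).
exact: (@clin_seminorm_continuous _ _ _ Q f q Qq).
Qed.

End Chain.

Lemma norm_triangle (x y : K^o) : `|x + y| <= `|x| + `|y|.
Proof. exact: ler_normD. Qed.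

Lemma norm_scale (a : K) (x : K^o) : `|a *: x| = `|a| * `|x|.
Proof. exact: normrM. Qed.

Definition abs_seminorm : seminorm (K^o : lmodType K) := Seminorm norm_triangle norm_scale.

End LocallyConvex.

(** * Multilinear forms *)

Section Forms.
Context (R : realType) (Phi : LBspace R).
Local Notation C := R[i].
Local Notation dual := (dual Phi).
Local Notation forms := (seq dual -> C^o).
Implicit Types (f g h : forms) (s u v : seq dual) (w : dual) (n k m : nat).

Definition multilin k f := (forall s, size s <> k -> f s = 0) /\
  forall s1 a w w' s2,
    f (s1 ++ (a *: w + w') :: s2) = a * f (s1 ++ w :: s2) + f (s1 ++ w' :: s2).

Definition permsym f := forall s s', perm_eq s s' -> f s = f s'.

Definition slice u f : forms := fun v => f (u ++ v).

Lemma permsym_slice u f : permsym f -> permsym (slice u f).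
Proof. by move=> fs s s' ss'; apply: fs; rewrite perm_cat2l. Qed.

Lemma symz_perm f n (s : seq dual) : size s = n ->
  symz f s = ((n`!%:R)^-1 : C) * \sum_(g : 'S_n) f [seq nth 0 s (g i) | i : 'I_n].
Proof. by move=> <-. Qed.

Lemma size_map_ord n (F : 'I_n -> dual) : size [seq F i | i : 'I_n] = n.
Proof. by rewrite size_image card_ord. Qed.

Lemma nth_map_ord n (F : 'I_n -> dual) (i : 'I_n) :
  nth 0 [seq F j | j : 'I_n] i = F i.
Proof. by rewrite /image_mem (nth_map i) ?nth_ord_enum// size_enum_ord. Qed.

Lemma map_nth_ord n (s : seq dual) : size s = n ->
  [seq nth 0 s (nat_of_ord i) | i : 'I_n] = s.
Proof.
move=> sn; apply: (@eq_from_nth _ 0); rewrite size_map_ord// => i si.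
by rewrite (nth_map_ord (fun j : 'I_n => nth 0 s j) (Ordinal si)).
Qed.

Lemma perm_eq_ordP n (s s' : seq dual) : size s = n -> perm_eq s' s ->
  exists p : 'S_n, s' = [seq nth 0 s (p i) | i : 'I_n].
Proof.
move=> <- ss'; have /tuple_permP[p pE] : perm_eq s' (in_tuple s) by [].
exists p; rewrite pE /=.
by apply: eq_map => i; rewrite (tnth_nth 0).
Qed.

Lemma perm_map_ord n (s : seq dual) (p : 'S_n) : size s = n ->
  perm_eq [seq nth 0 s (p i) | i : 'I_n] s.
Proof.
move=> sn; rewrite -[X in perm_eq _ X](map_nth_ord sn).
rewrite [X in perm_eq X _](map_comp (fun i : 'I_n => nth 0 s i) p).
apply: perm_map; apply: uniq_perm; rewrite ?enum_uniq//.
  by rewrite map_inj_uniq ?enum_uniq//; exact: perm_inj.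
move=> i; rewrite mem_enum; apply/mapP; exists (p^-1%g i); rewrite ?mem_enum//.
by rewrite permKV.
Qed.

Lemma symz_permsym f : permsym (symz f).
Proof.
move=> s s' ss'; have ns : size s' = size s by rewrite (perm_size ss').
have [p ->] := perm_eq_ordP (erefl (size s')) ss'.
rewrite (@symz_perm f (size s'))// ?size_map_ord//.
rewrite (@symz_perm f (size s') s')//; congr (_ * _).
rewrite [RHS](reindex_inj (mulIg p)) /=; apply: eq_bigr => g _; congr (f _).
rewrite /image_mem; apply: eq_map => i.
by rewrite (nth_map_ord (fun j => nth 0 s' (p j))) permM.
Qed.

Lemma symz_id f : permsym f -> symz f = f.
Proof.
move=> fs; apply/funext => s; rewrite (@symz_perm f (size s))//.
rewrite (eq_bigr (fun=> f s)) => [|g _].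
  rewrite sumr_const cardT -cardE card_Sn -[f s *+ _]mulr_natl mulrA mulVf ?mul1r//.
by apply: fs; exact: perm_map_ord.
Qed.

(** Expansion of a symmetric form along a line; its coefficients polarize the form. *)
Lemma multilin_binom k f (p : seq dual) w w' (z : C) m : multilin k f -> permsym f ->
  f (p ++ nseq m (z *: w + w')) =
  \sum_(j < m.+1) 'C(m, j)%:R * z ^+ j * f (p ++ nseq j w ++ nseq (m - j) w').
Proof.
move=> [_ fl] fs; elim: m p => [|m IH] p.
  by rewrite big_ord1 /= bin0 expr0 !mul1r.
rewrite /= fl -[_ ++ w :: _]/(p ++ [:: w] ++ _) -[_ ++ w' :: _]/(p ++ [:: w'] ++ _).
rewrite !catA !IH.
rewrite [in RHS]big_ord_recl /= bin0 expr0 !mul1r.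
rewrite [X in _ + X = _]big_ord_recl /= bin0 expr0 !mul1r subn0.
rewrite addrCA; congr (_ + _); first by rewrite -catA.
rewrite mulr_sumr [X in _ + X](_ : _ = \sum_(i < m.+1)
    'C(m, i.+1)%:R * z ^+ i.+1 * f (p ++ nseq i.+1 w ++ nseq (m - i) w')).
  rewrite -big_split /=; apply: eq_bigr => i _.
  rewrite /bump leq0n add1n binS natrD exprS subSS !mulrDl addrC; congr (_ + _).
  by rewrite !mulrA [z * _]mulrC -!catA.
rewrite big_ord_recr /= bin_small// !mul0r addr0; apply: eq_bigr => i _.
rewrite /bump leq0n add1n; congr (_ * _); apply: fs.
apply/seq.permP => P; rewrite !count_cat /= !count_cat !count_nseq add0n -(subnSK (ltn_ord i)).
lia.
Qed.

End Forms.

(** * Injective tensor powers *)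

Section Tensors.
Context (R : realType).
Local Notation C := R[i].

Lemma poly_fun_eq0 n (c : nat -> C) :
  (forall z : C, \sum_(j < n) c j * z ^+ j = 0) -> forall j, (j < n)%N -> c j = 0.
Proof.
move=> c0; pose p := \poly_(j < n) c j.
suff p0 : p = 0 by move=> j jn; have := coef0 C j; rewrite -p0 coef_poly jn.
apply/eqP; apply: contraT => pn0.
pose rs := [seq (i%:R : C) | i <- iota 0 n].
have rs0 : all (root p) rs.
  apply/allP => _ /mapP[i _ ->]; rewrite /root horner_poly; apply/eqP.
  by rewrite -[RHS](c0 i%:R).
have rsu : uniq rs.
  by rewrite map_inj_uniq ?iota_uniq// => i j /eqP; rewrite eqr_nat => /eqP.
have := max_poly_roots pn0 rs0 rsu.
by rewrite /rs size_map size_iota ltnNge size_poly.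
Qed.

Context (Phi : LBspace R).
Local Notation dual := (dual Phi).
Local Notation forms := (seq dual -> C^o).
Implicit Types (f g h : forms) (s u v : seq dual) (w : dual) (n k m : nat).

(** Polarization: the values on the diagonal determine a symmetric form. One argument at
    a time is separated from the others, as the linear coefficient of a polynomial. *)
Lemma multilin_diag0 k f : multilin k f -> permsym f ->
  (forall w, f (nseq k w) = 0) -> f = 0.
Proof.
move=> fk fs f0.
have key p j w : (size p + j = k)%N -> f (p ++ nseq j w) = 0.
  elim: p j w => [|w1 p IH] j w; first by rewrite /= add0n => ->; exact: f0.
  move=> /= pk.
  (* The form vanishes along the line through [w] of direction [w1], so the coefficient of
     degree 1 in [z] vanishes, which is the value at one copy of [w1] up to a factor. *)
  have H z := IH j.+1 (z *: w1 + w) ltac:(by rewrite addnS -addSn).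
  pose c i : C := 'C(j.+1, i)%:R * f (p ++ nseq i w1 ++ nseq (j.+1 - i) w).
  have /poly_fun_eq0 /(_ 1%N isT) : forall z : C, \sum_(i < j.+2) c i * z ^+ i = 0.
    move=> z; rewrite -[RHS](H z) (multilin_binom _ _ _ _ _ fk fs).
    by apply: eq_bigr => i _; rewrite /c mulrAC.
  move=> /eqP; rewrite /c bin1 mulf_eq0 pnatr_eq0 /= subn1 /= => /eqP fp.
  rewrite -[RHS]fp; apply: fs; rewrite -!cat_cons -cat1s -[w1 :: nseq _ _]cat1s !catA.
  by rewrite perm_cat2r perm_catC.
apply/funext => s; have [sk|sk] := eqVneq (size s) k.
  by have := key s 0%N 0; rewrite /= cats0; apply; rewrite addn0.
by case: fk => f1 _; apply: f1; apply/eqP.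
Qed.

Lemma nrm0_eq0 n (x : Phi) : step n x -> nrm n x = 0 -> x = 0.
Proof.
have [B [j [ji <- jn]]] := lb_banach Phi n => -[b _ <-].
by rewrite jn => /eqP; rewrite normr_eq0 => /eqP ->; rewrite linear0.
Qed.

Lemma dnorm_ub n w x : step n x -> nrm n x <= 1 -> `|w x| <= dnorm n w.
Proof.
move=> nx x1; have [M wM] := dual_bounded n w.
by apply: (@csup_ub _ _ M) => [_ [y [ny y1] <-]|]; [rewrite normr_ge0 wM|exists x].
Qed.

Lemma dnorm_le n w c :
  (forall x, step n x -> nrm n x <= 1 -> `|w x| <= c) -> dnorm n w <= c.
Proof.
move=> wc; apply: csup_le => [|_ [x [nx x1] <-]]; last by rewrite normr_ge0 wc.
exists `|w 0|, 0 => //; split; first exact: step0.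
by rewrite -(scale0r 0) nrmZ ?normr0 ?mul0r ?ler01//; exact: step0.
Qed.

Lemma dnormP n w x : step n x -> `|w x| <= dnorm n w * nrm n x.
Proof.
move=> nx; have [/(nrm0_eq0 nx) ->|x0] := eqVneq (nrm n x) 0.
  rewrite clin0 normr0; apply: mulr_ge0; first exact: dnorm_ge0.
  by apply: nrm_ge0; exact: step0.
have xp : 0 < nrm n x by rewrite lt_neqAle eq_sym x0 nrm_ge0.
have := @dnorm_ub n w ((nrm n x)^-1 *: x) (stepZ _ nx).
rewrite nrmZ// clinZ normrZ ger0_norm ?invr_ge0 ?nrm_ge0// mulVf// lexx => /(_ isT).
by rewrite ler_pdivrMl// mulrC.
Qed.

Lemma dnormZ n (a : C) w : dnorm n (a *: w) <= `|a| * dnorm n w.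
Proof.
apply: dnorm_le => x nx x1; rewrite normrM ler_wpM2l// dnorm_ub//.
Qed.

(** Unlike an inequality on [inj_norm], a supremum over a unit ball, this bound passes
    directly to slices, sums and products of forms. *)
Definition bnd n k (c : C) f :=
  forall s, size s = k -> `|f s| <= c * \prod_(w <- s) dnorm n w.

Lemma prod_dnorm_ge0 n s : 0 <= \prod_(w <- s) dnorm n w.
Proof. by apply: prodr_ge0 => w _; exact: dnorm_ge0. Qed.

Lemma bnd_le n k c c' f : c <= c' -> bnd n k c f -> bnd n k c' f.
Proof.
by move=> cc fc s sk; rewrite (le_trans (fc s sk))// ler_wpM2r// prod_dnorm_ge0.
Qed.

Lemma bndD n k c c' f g : bnd n k c f -> bnd n k c' g ->
  bnd n k (c + c') (fun s => f s + g s).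
Proof.
move=> fc gc s sk; rewrite (le_trans (ler_normD _ _))// mulrDl lerD//.
  exact: fc.
exact: gc.
Qed.

Lemma bndZ n k c f (a : C) : bnd n k c f -> bnd n k (`|a| * c) (fun s => a * f s).
Proof. by move=> fc s sk; rewrite normrM -mulrA ler_wpM2l// fc. Qed.

Lemma bnd_mono n n' k c f : (n <= n')%N -> 0 <= c -> bnd n k c f -> bnd n' k c f.
Proof.
move=> nn c0 fc s sk; rewrite (le_trans (fc s sk))// ler_wpM2l//.
by rewrite ler_prod// => w _; rewrite dnorm_ge0 dnorm_mono.
Qed.

Lemma bnd_slice n k m c f u : bnd n (k + m) c f -> size u = k ->
  bnd n m (c * \prod_(w <- u) dnorm n w) (slice u f).
Proof. by move=> fc uk s sm; rewrite -mulrA -big_cat /= fc// size_cat uk sm. Qed.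

Lemma bnd_symz n k c f : bnd n k c f -> bnd n k c (symz f).
Proof.
move=> fc s sk; rewrite (symz_perm f sk) normrM.
rewrite (@ger0_norm _ (k`!%:R)^-1) ?invr_ge0 ?ler0n// ler_pdivrMl ?ltr0n ?fact_gt0//.
rewrite (le_trans (ler_norm_sum _ _ _))//.
rewrite (@le_trans _ _ (\sum_(g : 'S_k) c * \prod_(w <- s) dnorm n w))//.
  apply: ler_sum => g _; rewrite (le_trans (fc _ _)) ?size_map_ord//.
  by rewrite (perm_big s)//; exact: perm_map_ord.
by rewrite sumr_const cardT -cardE card_Sn mulr_natl.
Qed.

Lemma etens_bnd n k (t : seq Phi) : size t = k -> {in t, forall x, step n x} ->
  bnd n k (\prod_(x <- t) nrm n x) (etens t).
Proof.
move=> <- ts s sk; rewrite /etens sk eqxx.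
elim: t s ts sk => [|x t IH] [|w s]//= ts; first by rewrite !big_nil normr1 mulr1.
move=> [sk]; rewrite !big_cons normrM mulrACA /= ler_pM//.
  by rewrite mulrC; apply: dnormP; apply: ts; exact: mem_head.
by apply: IH => // y yt; apply: ts; rewrite in_cons yt orbT.
Qed.

Lemma alg_tens_bnd n k g : alg_tens n k g -> exists2 c, 0 <= c & bnd n k c g.
Proof.
move=> [N [a [t [tn ->]]]].
exists (\sum_j `|a j| * \prod_(x <- t j) nrm n x).
  apply: sumr_ge0 => j _; rewrite mulr_ge0// big_seq prodr_ge0// => x xt.
  by have [_ /(_ x xt)] := tn j; exact: nrm_ge0.
move=> s sk; rewrite fct_sumE mulr_suml (le_trans (ler_norm_sum _ _ _))//.
apply: ler_sum => j _; rewrite normrM -mulrA ler_wpM2l//.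
by have [tk ts] := tn j; exact: (etens_bnd tk ts).
Qed.

Lemma inj_tens_bnd n k f : inj_tens n k f -> exists2 c, 0 <= c & bnd n k c f.
Proof.
move=> [_ /(_ 1 ltr01)[g /alg_tens_bnd[c c0 gc] fg]].
exists (1 + c); first by rewrite addr_ge0.
move=> s sk; rewrite -(subrK (g s) (f s)) (le_trans (ler_normD _ _))// mulrDl.
by rewrite lerD ?fg// gc.
Qed.

Lemma etens_slice (t : seq Phi) k u v : size u = k -> (k <= size t)%N ->
  etens t (u ++ v) = etens (take k t) u * etens (drop k t) v.
Proof.
move=> uk kt; rewrite /etens size_cat uk size_take_min (minn_idPl kt) eqxx size_drop.
have -> : ((k + size v)%N == size t) = (size v == (size t - k)%N) by lia.
case: ifP => // _; rewrite ?mulr0//.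
by rewrite -{1}(cat_take_drop k t) zip_cat ?big_cat// size_take_min (minn_idPl kt).
Qed.

Lemma alg_etens n k (t : seq Phi) : size t = k -> {in t, forall x, step n x} ->
  alg_tens n k (etens t).
Proof.
move=> tk ts; exists 1%N, (fun=> 1), (fun=> t); split=> //.
by rewrite big_ord1 scale1r.
Qed.

Lemma lin_set_sum (V : lmodType C) (A : set V) I (r : seq I) (P : pred I) (F : I -> V)
   (a : I -> C) :
  lin_set A -> (forall i, P i -> A (F i)) -> A (\sum_(i <- r | P i) a i *: F i).
Proof.
by move=> [A0 AD] AF; elim/big_rec: _ => // i x Pi Ax; apply: AD => //; exact: AF.
Qed.

Lemma alg_tens_slice n k m u g : alg_tens n (k + m) g -> size u = k ->
  alg_tens n m (slice u g).
Proof.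
move=> [N [a [t [tn ->]]]] uk.
have -> : slice u (\sum_j a j *: etens (t j)) =
   \sum_j (a j * etens (take k (t j)) u) *: etens (drop k (t j)).
  apply/funext => v; rewrite /slice !fct_sumE; apply: eq_bigr => j _.
  rewrite /= !fctE /= (etens_slice _ uk) ?scalerA ?mulrA//.
  by have [-> _] := tn j; rewrite leq_addr.
apply: lin_set_sum; first exact: alg_tens_submod.
move=> j _; have [tk ts] := tn j; apply: alg_etens.
  by rewrite size_drop tk addKn.
by move=> x xt; apply: ts; exact: mem_drop xt.
Qed.

Lemma etens_multilin (t : seq Phi) : multilin (size t) (etens t).
Proof.
rewrite /etens; split=> [s /eqP/negbTE ->//|s1 a w w' s2].
rewrite !size_cat /=; case: ifP => [|_]; last by rewrite mulr0 addr0.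
elim: s1 t => [|w1 s1 IH] [|x t]//=.
  by rewrite !big_cons /= => _; rewrite mulrDl -mulrA.
rewrite !big_cons /= addSn eqSS => /IH ->; rewrite mulrDr; congr (_ + _).
by rewrite mulrCA.
Qed.

Lemma multilin_sum k I (r : seq I) (P : pred I) (F : I -> forms) (a : I -> C) :
  (forall i, P i -> multilin k (F i)) -> multilin k (\sum_(i <- r | P i) a i *: F i).
Proof.
move=> Fk; elim/big_rec: _ => [|i g Pi [g0 gl]].
  by split=> // *; rewrite mulr0 addr0.
have [f0 fl] := Fk _ Pi; split=> [s sk|s1 b w w' s2].
  by rewrite /= !fctE /= f0// g0// scaler0 addr0.
rewrite /= !fctE /= fl gl; rewrite /GRing.scale/=; ring.
Qed.

Lemma alg_tens_multilin n k g : alg_tens n k g -> multilin k g.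
Proof.
move=> [N [a [t [tn ->]]]]; apply: multilin_sum => j _.
by have [<- _] := tn j; exact: etens_multilin.
Qed.

Lemma inj_tens_multilin n k f : inj_tens n k f -> multilin k f.
Proof.
move=> [f0 fe]; split=> // s1 a w w' s2.
have [sk|sk] := eqVneq (size (s1 ++ w :: s2)) k; last first.
  rewrite !f0 ?mulr0 ?addr0//; move: sk; rewrite !size_cat /= => /eqP //.
apply/eqP; rewrite -subr_eq0; apply/eqP.
pose pr s := \prod_(w <- s) dnorm n w.
apply: (@vanish_small _ _ (pr (s1 ++ (a *: w + w') :: s2) +
   (`|a| * pr (s1 ++ w :: s2) + pr (s1 ++ w' :: s2)))) => e e0.
have [g /alg_tens_multilin[_ gl] fg] := fe e e0.
have sz w'' : size (s1 ++ w'' :: s2) = k by rewrite -sk !size_cat.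
rewrite (_ : f _ - _ = (f (s1 ++ (a *: w + w') :: s2) - g (s1 ++ (a *: w + w') :: s2))
  - (a * (f (s1 ++ w :: s2) - g (s1 ++ w :: s2)) +
  (f (s1 ++ w' :: s2) - g (s1 ++ w' :: s2)))); last by rewrite gl; ring.
rewrite (le_trans (ler_normB _ _))// [leRHS]mulrDr lerD ?fg//.
rewrite (le_trans (ler_normD _ _))// [leRHS]mulrDr lerD ?fg//.
by rewrite normrM mulrCA ler_wpM2l// fg.
Qed.

Lemma inj_tens_slice n k m u f : inj_tens n (k + m) f -> size u = k ->
  inj_tens n m (slice u f).
Proof.
move=> [f0 fe] uk; split=> [s sm|e e0].
  by apply: f0; rewrite size_cat uk => /addnI.
have p0 := prod_dnorm_ge0 n u; set p := \prod_(w <- u) _ in p0.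
have p1 : 0 < p + 1 by rewrite ltr_wpDl.
have [g ga fg] := fe (e / (p + 1)) ltac:(by rewrite divr_gt0).
exists (slice u g); first exact: alg_tens_slice ga uk.
move=> s sm; rewrite (le_trans (fg _ _)) ?size_cat ?uk ?sm// big_cat /= -/p mulrA.
rewrite ler_wpM2r ?prod_dnorm_ge0// -mulrA ler_piMr ?(ltW e0)// ler_pdivrMl// mulr1.
by rewrite lerDl.
Qed.

(** The step is complete in this sense because it is itself defined as a closure. *)
Lemma inj_tens_closed n k f : (forall s, size s <> k -> f s = 0) ->
  (forall e, 0 < e -> exists2 g, inj_tens n k g & bnd n k e (fun s => f s - g s)) ->
  inj_tens n k f.
Proof.
move=> f0 fe; split=> // e e0.
have e2 : 0 < e / 2 by rewrite divr_gt0.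
have [g [_ /(_ _ e2)[h ha gh]] fg] := fe _ e2; exists h => // s sk.
rewrite -(subrK (g s) (f s)) -addrA (le_trans (ler_normD _ _))//.
by rewrite [X in X * _]splitr mulrDl lerD ?fg// gh.
Qed.

End Tensors.

(** * Symmetric tensors *)

Section Sym.
Context (R : realType) (Phi : LBspace R).
Local Notation C := R[i].
Local Notation dual := (dual Phi).
Local Notation forms := (seq dual -> C^o).
Local Notation symt := (@symt R Phi).
Implicit Types (f g h : forms) (s u v : seq dual) (w : dual) (n k m : nat).

Lemma etens_ord k (t : seq Phi) s : size t = k -> size s = k ->
  etens t s = \prod_(i < k) (nth 0 s i) (nth 0 t i).
Proof.
move=> tk sk; rewrite /etens tk sk eqxx (big_nth (0, 0)) size_zip tk sk minnn big_mkord.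
by apply: eq_bigr => i _; rewrite nth_zip ?tk ?sk.
Qed.

Lemma symz_sum I (r : seq I) (P : pred I) (F : I -> forms) (a : I -> C) :
  symz (\sum_(i <- r | P i) a i *: F i) = \sum_(i <- r | P i) a i *: symz (F i).
Proof.
elim/big_rec2: _ => [|i x y Pi <-]; last exact: symz_linear.
by have := @symz_linear R Phi (-1) 0 0; rewrite scaler0 addr0 scaleN1r addNr.
Qed.

Lemma alg_tens_symz n k g : alg_tens n k g -> alg_tens n k (symz g).
Proof.
move=> [N [a [t [tn ->]]]]; rewrite symz_sum.
apply: lin_set_sum; first exact: alg_tens_submod.
move=> j _; have [tk ts] := tn j.
have -> : symz (etens (t j)) = \sum_(g : 'S_k)
    ((k`!%:R)^-1 : C) *: etens [seq nth 0 (t j) ((g^-1)%g i) | i : 'I_k].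
  apply/funext => s; rewrite fct_sumE.
  have [sk|sk] := eqVneq (size s) k; last first.
    rewrite big1 ?/symz ?big1 ?scaler0// => [g' _|g' _]; rewrite /etens ?size_map_ord ?tk.
    - by rewrite (negbTE sk).
    - by rewrite size_image card_ord /= !fctE (negbTE sk) scaler0.
  rewrite (symz_perm _ sk) mulr_sumr; apply: eq_bigr => g' _; congr (_ * _).
  have sz (V : Type) (F : 'I_k -> V) : size [seq F i | i : 'I_k] = k.
    by rewrite size_image card_ord.
  rewrite (etens_ord tk) ?sz// (etens_ord (sz _ _) sk).
  rewrite [RHS](reindex_inj (@perm_inj _ g')) /=; apply: eq_bigr => i _.
  rewrite (nth_map_ord (fun i => nth 0 s (g' i))).
  by rewrite /image_mem (nth_map i) ?size_enum_ord// nth_ord_enum permK.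
apply: lin_set_sum; first exact: alg_tens_submod.
move=> g' _; apply: alg_etens; first by rewrite size_image card_ord.
move=> x /mapP[i _ xE]; apply: ts.
by rewrite xE; apply: mem_nth; rewrite tk.
Qed.

Lemma symzB f g : symz (fun s => f s - g s) = (fun s => symz f s - symz g s).
Proof.
have -> : (fun s => f s - g s) = (-1) *: g + f.
  by apply/funext => s; rewrite /= !fctE /= scaleN1r addrC.
rewrite symz_linear; apply/funext => s; rewrite /= !fctE /= scaleN1r addrC//.
Qed.

Lemma inj_tens_symz n k f : inj_tens n k f -> inj_tens n k (symz f).
Proof.
move=> [f0 fe]; split=> [s sk|e e0].
  by rewrite /symz big1 ?scaler0// => g _; apply: f0; rewrite size_map_ord.
have [g ga fg] := fe e e0; exists (symz g); first exact: alg_tens_symz.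
by move=> s sk; have := bnd_symz fg sk; rewrite symzB.
Qed.

(** The step of index [n] of the symmetric power, as a predicate on forms: this
    avoids packing forms into [symt] before they are known to be symmetric tensors. *)
Definition stens n k f := inj_tens n k f /\ permsym f.

Lemma stensP n k (f : symt k) : step (c := symc Phi k) n f <-> stens n k f.
Proof.
split=> [[g gi <-]|[fi fs]]; last by exists (f : forms) => //; exact: symz_id.
by split; [exact: inj_tens_symz|exact: symz_permsym].
Qed.

Lemma symt_stens k (f : symt k) : exists n, stens n k f.
Proof.
have /asboolP[n [g gi gf]] := valP f; exists n; rewrite -gf.
by split; [exact: inj_tens_symz|exact: symz_permsym].
Qed.

Lemma symt_multilin k (f : symt k) : multilin k f.
Proof. by have [n [/inj_tens_multilin]] := symt_stens f. Qed.

Lemma symt_permsym k (f : symt k) : permsym f.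
Proof. by have [n []] := symt_stens f. Qed.

Lemma symt_off k (f : symt k) s : size s <> k -> f s = 0.
Proof. by have [f0 _] := symt_multilin f; exact: f0. Qed.

Lemma symtP k (f g : symt k) : (forall s, f s = g s) -> f = g.
Proof. by move=> fg; apply: val_inj; apply/funext. Qed.

Lemma symt_dot_ext k (f g : symt k) : (forall w, dot w f = dot w g) -> f = g.
Proof.
move=> fg; have H := multilin_diag0 (symt_multilin (f - g)) (symt_permsym (f - g)).
apply/eqP; rewrite -subr_eq0; apply/eqP/symtP => s; rewrite H// => w.
by have := fg w; rewrite /dot => E; rewrite /= !fctE /= E subrr.
Qed.

Lemma stens_sym n k f : stens n k f -> f \in @is_sym_tens R Phi k.
Proof. by move=> [fi fs]; apply/asboolP; exists n, f => //; exact: symz_id. Qed.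

Lemma to_symtE n k f : stens n k f -> (to_symt k f : forms) = f.
Proof. by move=> /stens_sym fs; rewrite /to_symt /= insubdK. Qed.

Lemma to_symtK k (f : symt k) : to_symt k f = f.
Proof. exact: valKd. Qed.

Lemma stens_lin n k : lin_set (stens n k).
Proof.
have [i0 iD] : lin_set (@inj_tens R Phi n k) by exact: inj_tens_submod.
split=> [|a f g [fi fs] [gi gs]]; first by split.
by split=> [|s s' ss']; [exact: iD|rewrite /= !fctE /= (fs _ _ ss') (gs _ _ ss')].
Qed.

Lemma stens_mono n n' k f : (n <= n')%N -> stens n k f -> stens n' k f.
Proof. by move=> nn [fi fs]; split=> //; exact: inj_tens_mono fi. Qed.

Lemma inj_norm_set_bnd n k c f s : 0 <= c -> bnd n k c f ->
  size s = k -> {in s, forall w, dnorm n w <= 1} -> `|f s| <= c.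
Proof.
move=> c0 fc sk s1; rewrite (le_trans (fc s sk))// ler_piMr//.
rewrite big_seq; apply: prodr_ile1 => w ws; rewrite dnorm_ge0 s1//.
Qed.

Lemma inj_norm_le n k c f : 0 <= c -> bnd n k c f -> inj_norm n k f <= c.
Proof.
move=> c0 fc; apply: csup_le.
  exists `|f (nseq k 0)|, (nseq k 0) => //; split; first by rewrite size_nseq.
  move=> w /nseqP[-> _]; apply: dnorm_le => x _ _.
  by rewrite normr0 ler01.
by move=> _ [s [sk s1] <-]; rewrite normr_ge0 (inj_norm_set_bnd c0 fc).
Qed.

Lemma inj_norm_ub n k f s : inj_tens n k f -> size s = k ->
  {in s, forall w, dnorm n w <= 1} -> `|f s| <= inj_norm n k f.
Proof.
move=> /inj_tens_bnd[c c0 fc] sk s1.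
apply: (@csup_ub _ _ c); last by exists s.
by move=> _ [s' [sk' s1'] <-]; rewrite normr_ge0 (inj_norm_set_bnd c0 fc).
Qed.

Lemma inj_norm_ge0 n k f : 0 <= inj_norm n k f.
Proof. by apply: csup_ge0 => _ [s _ <-]. Qed.

Lemma multilin_scale k f p s (c : dual -> C) : multilin k f ->
  f (p ++ [seq c w *: w | w <- s]) = \prod_(w <- s) c w * f (p ++ s).
Proof.
move=> [_ fl]; elim: s p => [|w s IH] p /=; first by rewrite big_nil mul1r.
have fz s1 s2 : f (s1 ++ 0 :: s2) = 0.
  have /eqP := fl s1 1 0 0 s2; rewrite scaler0 addr0 mul1r -subr_eq subrr eq_sym.
  by move/eqP.
rewrite -[c w *: w]addr0 fl fz addr0 -cat1s catA IH big_cons -catA /=.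
by rewrite mulrA.
Qed.

(** If some [w] vanishes on the step then so do the algebraic tensors, and [f] with
    them; otherwise [s] is rescaled into the unit ball. *)
Lemma bnd_inj_norm n k f : inj_tens n k f -> bnd n k (inj_norm n k f) f.
Proof.
move=> fi s sk; have fm := inj_tens_multilin fi.
have [/hasP[w ws /eqP w0]|/hasPn sn0] := boolP (has (fun w => dnorm n w == 0) s).
  suff -> : f s = 0 by rewrite normr0 mulr_ge0 ?inj_norm_ge0 ?prod_dnorm_ge0.
  have p0 : \prod_(w <- s) dnorm n w = 0.
    by apply/eqP; rewrite prodf_seq_eq0; apply/hasP; exists w; rewrite ?w0/=.
  apply: (@vanish_small _ _ 0) => e e0; have [_ /(_ e e0)[g ga fg]] := fi.
  have := fg s sk; rewrite p0 mulr0 normr_le0 subr_eq0 => /eqP ->.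
  have [c c0 /(_ s sk)] := alg_tens_bnd ga.
  by rewrite p0 mulr0.
have sE : s = [seq dnorm n w *: ((dnorm n w)^-1 *: w) | w <- s].
  by rewrite -[LHS]map_id; apply/eq_in_map => w /sn0 w0; rewrite scalerA divff ?scale1r.
pose s' := [seq (dnorm n w)^-1 *: w | w <- s].
have fs' : f s = \prod_(w <- s) dnorm n w * f s'.
  rewrite (multilin_scale [::] s (fun w => (dnorm n w)^-1) fm) /= mulrA -big_split /=.
  by rewrite big_seq big1 ?mul1r// => w /sn0 w0; rewrite divff.
rewrite fs' normrM (ger0_norm (prod_dnorm_ge0 _ _)) mulrC ler_wpM2r ?prod_dnorm_ge0//.
apply: inj_norm_ub => //; first by rewrite size_map.
move=> _ /mapP[w ws ->]; rewrite (le_trans (dnormZ _ _ _))//.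
by rewrite ger0_norm ?invr_ge0 ?dnorm_ge0// mulVf// sn0.
Qed.

Lemma inj_norm_mono n n' k f : (n <= n')%N -> inj_tens n k f ->
  inj_norm n' k f <= inj_norm n k f.
Proof.
move=> nn fi; apply: inj_norm_le; first exact: inj_norm_ge0.
by apply: (bnd_mono nn); [exact: inj_norm_ge0|exact: bnd_inj_norm].
Qed.

Definition ftens k f g : forms := fun s => f (take k s) * g (drop k s).

Lemma ftens_off k m f g : (forall s, size s <> k -> f s = 0) ->
  (forall s, size s <> m -> g s = 0) -> forall s, size s <> (k + m)%N -> ftens k f g s = 0.
Proof.
move=> f0 g0 s sz; rewrite /ftens; have [ks|sk] := leqP k (size s).
  by rewrite g0 ?mulr0// size_drop => H; apply: sz; rewrite -H subnKC.
by rewrite f0 ?mul0r// size_take_min (minn_idPr (ltnW sk)) => H; move: sk; rewrite H ltnn.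
Qed.

Lemma alg_ftens n k m f g : alg_tens n k f -> alg_tens n m g ->
  alg_tens n (k + m) (ftens k f g).
Proof.
move=> fa ga; have [f0 _] := alg_tens_multilin fa; have [g0 _] := alg_tens_multilin ga.
move: f0 g0; case: fa => [N [a [t [tn ->]]]]; case: ga => [M [b [r [rn ->]]]] f0 g0.
have -> : ftens k (\sum_j a j *: etens (t j)) (\sum_j b j *: etens (r j)) =
  \sum_i \sum_j (a i * b j) *: etens (t i ++ r j).
  apply/funext => s; have [sk|/eqP sk] := eqVneq (size s) (k + m)%N; last first.
    rewrite (ftens_off f0 g0)// fct_sumE big1// => i _; rewrite fct_sumE big1// => j _.
    rewrite /= !fctE /= /etens size_cat; have [-> _] := tn i; have [-> _] := rn j.
    by move/eqP/negbTE: sk => ->; rewrite scaler0.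
  rewrite /ftens !fct_sumE mulr_suml; apply: eq_bigr => i _.
  rewrite fct_sumE mulr_sumr; apply: eq_bigr => j _; rewrite /= !fctE /=.
  have [tk _] := tn i.
  rewrite -[in RHS](cat_take_drop k s) (etens_slice (k := k)) ?take_size_cat ?drop_size_cat//.
  - by rewrite /GRing.scale/=; ring.
  - by rewrite size_take_min sk (minn_idPl (leq_addr _ _)).
  - by rewrite size_cat tk leq_addr.
have Asub : lin_set (@alg_tens R Phi n (k + m)) by exact: alg_tens_submod.
have sumA I (r' : seq I) (F : I -> forms) : (forall i, alg_tens n (k + m) (F i)) ->
    alg_tens n (k + m) (\sum_(i <- r') F i).
  move=> FA; have := lin_set_sum r' (fun=> 1) Asub (fun i (_ : true) => FA i).
  by rewrite (eq_bigr F)// => i _; rewrite scale1r.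
apply: sumA => i; apply: lin_set_sum => // j _.
have [tk ts] := tn i; have [rk rs] := rn j.
apply: alg_etens; first by rewrite size_cat tk rk.
by move=> x; rewrite mem_cat => /orP[/ts|/rs].
Qed.

Lemma inj_ftens n k m f g : inj_tens n k f -> inj_tens n m g ->
  inj_tens n (k + m) (ftens k f g).
Proof.
move=> fi gi; have [[f0 fe] [g0 ge]] := (fi, gi).
have [c c0 fc] := inj_tens_bnd fi; have [d d0 gd] := inj_tens_bnd gi.
split=> [s|e e0]; first exact: ftens_off.
have cd1 : 0 < c + d + 1 by rewrite ltr_wpDl// addr_ge0.
have ecd : 0 < e + (c + d + 1) by rewrite addr_gt0.
pose e' := e / (e + (c + d + 1)).
have e'0 : 0 < e' by rewrite divr_gt0.
have e'1 : e' <= 1 by rewrite ler_pdivrMr// mul1r lerDl ltW.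
have e'e : e' * (c + d + 1) <= e.
  by rewrite mulrAC ler_pdivrMr// ler_wpM2l ?(ltW e0)// lerDr ltW.
have [f' f'a ff'] := fe _ e'0; have [g' g'a gg'] := ge _ e'0.
exists (ftens k f' g'); first exact: alg_ftens.
move=> s sk; rewrite /ftens.
have tk : size (take k s) = k by rewrite size_take_min sk (minn_idPl (leq_addr _ _)).
have dm : size (drop k s) = m by rewrite size_drop sk addKn.
set x := f _; set y := g _; set x' := f' _; set y' := g' _.
rewrite (_ : x * y - x' * y' = x * (y - y') + (x - x') * y - (x - x') * (y - y')); last by ring.
rewrite -(cat_take_drop k s) big_cat /=.
have := ff' _ tk; have := gg' _ dm; have := fc _ tk; have := gd _ dm.
rewrite -/x -/x' -/y -/y'; move: (prod_dnorm_ge0 n (take k s)) (prod_dnorm_ge0 n (drop k s)).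
set P := \prod_(w <- take _ _) _; set Q := \prod_(w <- drop _ _) _ => P0 Q0 yd xc yy xx.
rewrite (@le_trans _ _ (e' * (c + d + 1) * (P * Q)))//; last first.
  by rewrite ler_wpM2r// mulr_ge0.
rewrite (le_trans (ler_normB _ _))// (le_trans (lerD (ler_normD _ _) (lexx _)))//.
rewrite !normrM.
have -> : e' * (c + d + 1) * (P * Q) =
  (c * P) * (e' * Q) + (e' * P) * (d * Q) + (e' * P) * Q by ring.
rewrite !lerD// ?ler_pM//.
by rewrite (le_trans yy)// ler_piMl.
Qed.

End Sym.

(** * Slices of symmetric tensors *)

Section SliceMaps.
Context (R : realType) (Phi : LBspace R).
Local Notation C := R[i].
Local Notation dual := (dual Phi).
Local Notation forms := (seq dual -> C^o).
Local Notation symt := (@symt R Phi).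
Local Notation symHom := (@symHom R Phi).
Implicit Types (f g h : forms) (s u v : seq dual) (w : dual) (n k m : nat).

Lemma symt_lin_sum k (V : lmodType C) (T : symt k -> V) I (r : seq I) (P : pred I)
    (F : I -> symt k) (c : I -> C) : linear T ->
  T (\sum_(i <- r | P i) c i *: F i) = \sum_(i <- r | P i) c i *: T (F i).
Proof.
move=> Tl; elim/big_rec2: _ => [|i y x _ <-]; last exact: Tl.
by have := Tl (-1) 0 0; rewrite scaler0 addr0 scaleN1r addNr.
Qed.

Lemma alg_inj n k g : alg_tens n k g -> inj_tens n k g.
Proof.
move=> ga; have [g0 _] := alg_tens_multilin ga; split=> // e e0.
by exists g => // s _; rewrite subrr normr0 mulr_ge0 ?prod_dnorm_ge0// ltW.
Qed.

Lemma stens_symz_etens n k (t : seq Phi) :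
  size t = k -> {in t, forall x, step n x} -> stens n k (symz (etens t)).
Proof.
move=> tk ts; split; last exact: symz_permsym.
exact/alg_inj/alg_tens_symz/alg_etens.
Qed.

Lemma val_symt_sum k I (r : seq I) (c : I -> C) (F : I -> symt k) s :
  ((\sum_(j <- r) c j *: F j : symt k) : forms) s = \sum_(j <- r) c j * F j s.
Proof.
by elim/big_rec2: _ => [//|i y x _ <-]; rewrite /= !fctE.
Qed.

(** Replaces a symmetric tensor by the symmetrization of an algebraic one, which
    costs nothing as symmetrization is a contraction. *)
Lemma symt_approx n k f N (c : 'I_N -> C) (t : 'I_N -> seq Phi) e :
  stens n k f -> (forall j, size (t j) = k /\ {in t j, forall x, step n x}) ->
  0 <= e -> bnd n k e (fun s => f s - \sum_j c j * etens (t j) s) ->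
  exists h : symt k, [/\ to_symt k f =
      \sum_j c j *: to_symt k (symz (etens (t j))) + h,
    step (c := symc Phi k) n h & inj_norm n k h <= e].
Proof.
move=> fst tn e0 fe; have [fi fs] := fst.
have tst j : stens n k (symz (etens (t j))).
  by have [tk ts] := tn j; exact: stens_symz_etens.
pose h := to_symt k f - \sum_j c j *: to_symt k (symz (etens (t j))).
have hE : (h : forms) = symz (fun s => f s - \sum_j c j * etens (t j) s).
  have -> : (fun s => f s - \sum_j c j * etens (t j) s) =
      (fun s => f s - (\sum_j c j *: etens (t j)) s).
    by apply/funext => s; rewrite fct_sumE.
  rewrite symzB symz_sum (symz_id fs); apply/funext => s.
  rewrite fct_sumE /h /= !fctE (to_symtE fst); congr (_ - _).
  rewrite (val_symt_sum _ c (fun j => to_symt k (symz (etens (t j))))).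
  by apply: eq_bigr => j _; rewrite (to_symtE (tst j)).
exists h; split; first by rewrite addrC subrK.
- apply/stensP; have [S0 SD] := stens_lin Phi n k.
  rewrite (_ : (h : forms) = (-1) *: (\sum_j c j *: symz (etens (t j))) + f); last first.
    apply/funext => s; rewrite /h /= !fctE (to_symtE fst) fct_sumE /= scaleN1r addrC.
    congr (- _ + _).
    rewrite (val_symt_sum _ c (fun j => to_symt k (symz (etens (t j))))).
    by apply: eq_bigr => j _; rewrite (to_symtE (tst j)).
  by apply: SD => //; apply: lin_set_sum => [|j _]; [exact: stens_lin|exact: tst].
- by rewrite hE; apply: inj_norm_le => //; exact: bnd_symz.
Qed.

(** A linear functional [b] bounded on a step, applied to the last variables of a
    symmetric form, yields a symmetric form in the remaining ones; algebraic
    approximations are transported along with it. *)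
Section Functional.
Context (n k m : nat) (b : symt m -> C^o) (M : C) (f : forms).
Hypothesis bl : linear b.
Hypothesis M0 : 0 <= M.
Hypothesis bM : forall h : symt m, step (c := symc Phi m) n h ->
  `|b h| <= M * inj_norm n m h.
Hypothesis fst : stens n (k + m) f.

Definition slice_app : forms := fun u => b (to_symt m (slice u f)).

Lemma b0 : b 0 = 0.
Proof. by have := bl (-1) 0 0; rewrite scaler0 addr0 scaleN1r addNr. Qed.

Lemma slice_app_off u : size u <> k -> slice_app u = 0.
Proof.
move=> uk; rewrite /slice_app (_ : to_symt m _ = 0) ?b0//.
have [fs|fs] := boolP (slice u f \in @is_sym_tens R Phi m); last first.
  by rewrite /to_symt /insubd insubN.
apply: symtP => s; rewrite /to_symt /= insubdK//.
have [sm|sm] := eqVneq (size s) m.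
  rewrite /slice; have [[f0 _] _] := fst; apply: f0; rewrite size_cat sm => /eqP.
  by rewrite eqn_add2r => /eqP.
have := symt_off (to_symt m (slice u f)) (elimN eqP sm).
by rewrite /to_symt /= insubdK.
Qed.

Lemma slice_app_permsym : permsym slice_app.
Proof.
move=> u u' uu'; rewrite /slice_app; congr (b (to_symt _ _)); apply/funext => v.
by have [_ fs] := fst; apply: fs; rewrite perm_cat2r.
Qed.

Lemma slice_stens u : size u = k -> stens n m (slice u f).
Proof.
have [fi fs] := fst; move=> uk; split; first exact: inj_tens_slice fi uk.
exact: permsym_slice.
Qed.

Lemma slice_app_bnd c : 0 <= c -> bnd n (k + m) c f -> bnd n k (M * c) slice_app.
Proof.
move=> c0 fc u uk; have sst := slice_stens uk.
rewrite /slice_app (le_trans (bM _))//; first by apply/stensP; rewrite (to_symtE sst).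
rewrite -mulrA ler_wpM2l// (to_symtE sst); apply: inj_norm_le.
  by rewrite mulr_ge0 ?prod_dnorm_ge0.
exact: bnd_slice fc uk.
Qed.

(** On algebraic tensors [slice_app] is explicit, and the error is controlled by the bound
    of [b]. *)
Lemma slice_app_approx N (a : 'I_N -> C) (t : 'I_N -> seq Phi) e :
  (forall j, size (t j) = (k + m)%N /\ {in t j, forall x, step n x}) -> 0 <= e ->
  bnd n (k + m) e (fun s => f s - \sum_j a j * etens (t j) s) ->
  bnd n k (M * e) (fun u => slice_app u -
    \sum_j (a j * b (to_symt m (symz (etens (drop k (t j)))))) * etens (take k (t j)) u).
Proof.
move=> tn e0 fe u uk; have p0 := prod_dnorm_ge0 n u.
have dn j : size (drop k (t j)) = m /\ {in drop k (t j), forall x, step n x}.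
  have [tk ts] := tn j; rewrite size_drop tk addKn; split=> // x xt.
  by apply: ts; exact: mem_drop xt.
have key : bnd n m (e * \prod_(w <- u) dnorm n w) (fun v => slice u f v -
    \sum_j (a j * etens (take k (t j)) u) * etens (drop k (t j)) v).
  move=> v vm; rewrite -mulrA -big_cat /= /slice.
  rewrite (eq_bigr (fun j => a j * etens (t j) (u ++ v))) => [|j _].
    by apply: fe; rewrite size_cat uk vm.
  by have [tk _] := tn j; rewrite (etens_slice _ uk) ?tk ?leq_addr// mulrA.
have [h [hE hn he]] := symt_approx (slice_stens uk) dn (mulr_ge0 e0 p0) key.
rewrite /slice_app hE -[X in b (X + h)]scale1r bl scale1r symt_lin_sum//.
rewrite (eq_bigr (fun j => (a j * b (to_symt m (symz (etens (drop k (t j)))))) *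
   etens (take k (t j)) u)) => [|j _]; last by rewrite mulrAC.
by rewrite addrAC subrr add0r (le_trans (bM hn))// -mulrA ler_wpM2l.
Qed.

Lemma slice_app_stens : stens n k slice_app.
Proof.
split; last exact: slice_app_permsym.
apply: inj_tens_closed; first exact: slice_app_off.
move=> e e0; have M1 : 0 < M + 1 by rewrite ltr_wpDl.
have e1 : 0 < e / (M + 1) by rewrite divr_gt0.
have [[_ /(_ _ e1)[g [N [a [t [tn ->]]]] fg]] _] := fst.
have fg' : bnd n (k + m) (e / (M + 1)) (fun s => f s - \sum_j a j * etens (t j) s).
  by move=> s sk; have := fg s sk; rewrite fct_sumE.
exists (\sum_j (a j * b (to_symt m (symz (etens (drop k (t j)))))) *: etens (take k (t j))).
  apply/alg_inj; apply: lin_set_sum; first exact: alg_tens_submod.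
  move=> j _; have [tk ts] := tn j; apply: alg_etens.
    by rewrite size_take_min tk (minn_idPl (leq_addr _ _)).
  by move=> x xt; apply: ts; exact: mem_take xt.
have := slice_app_approx tn (ltW e1) fg'.
move=> H; apply: bnd_le (_ : bnd n k (M * (e / (M + 1))) _).
  by rewrite mulrCA ler_piMr ?(ltW e0)// ler_pdivrMr// mul1r lerDl.
by move=> s sk; rewrite fct_sumE; exact: H.
Qed.

End Functional.

(** Fubini: two bounded functionals may be applied in either order. Both sides are
    continuous in [f], and agree on algebraic tensors. *)
Lemma slice_app_swap n k m (a : symt k -> C^o) (b : symt m -> C^o) M M' f :
  linear a -> linear b -> 0 <= M -> 0 <= M' ->
  (forall h : symt k, step (c := symc Phi k) n h -> `|a h| <= M * inj_norm n k h) ->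
  (forall h : symt m, step (c := symc Phi m) n h -> `|b h| <= M' * inj_norm n m h) ->
  stens n (k + m) f ->
  a (to_symt k (slice_app b f)) = b (to_symt m (slice_app a f)).
Proof.
move=> al bl M0 M'0 aM bM fst.
have fst' : stens n (m + k) f by rewrite addnC.
apply/eqP; rewrite -subr_eq0; apply/eqP.
apply: (@vanish_small _ _ (M * M' + M' * M)) => e e0.
have [[_ /(_ _ e0)[g [N [c [t [tn ->]]]] fg]] fs] := fst.
have fg' : bnd n (k + m) e (fun s => f s - \sum_j c j * etens (t j) s).
  by move=> s sk; have := fg s sk; rewrite fct_sumE.
pose r j := drop k (t j) ++ take k (t j).
have tkk j : size (take k (t j)) = k.
  by have [tk _] := tn j; rewrite size_take_min tk (minn_idPl (leq_addr _ _)).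
have dkm j : size (drop k (t j)) = m by have [tk _] := tn j; rewrite size_drop tk addKn.
have tkin j : {in take k (t j), forall x, step n x}.
  by have [_ ts] := tn j => x xt; apply: ts; exact: mem_take xt.
have dkin j : {in drop k (t j), forall x, step n x}.
  by have [_ ts] := tn j => x xt; apply: ts; exact: mem_drop xt.
have rn j : size (r j) = (m + k)%N /\ {in r j, forall x, step n x}.
  split; first by rewrite size_cat tkk dkm.
  by move=> x; rewrite mem_cat => /orP[/dkin|/tkin].
have fg'' : bnd n (m + k) e (fun s => f s - \sum_j c j * etens (r j) s).
  move=> s sk; have := fg' (drop m s ++ take m s).
  have sm : size (take m s) = m by rewrite size_take_min sk (minn_idPl (leq_addr _ _)).
  have sd : size (drop m s) = k by rewrite size_drop sk addKn.
  rewrite size_cat sm sd => /(_ erefl).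
  rewrite (perm_big s); last by rewrite perm_catC cat_take_drop.
  rewrite (fs _ s); last by rewrite perm_catC cat_take_drop.
  rewrite (eq_bigr (fun j => c j * etens (r j) s))// => j _; congr (_ * _).
  have [tk _] := tn j; have [rk _] := rn j.
  rewrite (etens_slice _ sd) ?tk ?leq_addr// -[in RHS](cat_take_drop m s).
  rewrite (etens_slice (k := m)) ?rk ?leq_addr// /r take_size_cat// drop_size_cat//.
  by rewrite mulrC.
have A1 := slice_app_approx bl M'0 bM fst tn (ltW e0) fg'.
have A2 := slice_app_approx al M0 aM fst' rn (ltW e0) fg''.
have e1 : 0 <= M' * e by rewrite mulr_ge0// ltW.
have e2 : 0 <= M * e by rewrite mulr_ge0// ltW.
have [h1 [-> h1n h1e]] := symt_approx (slice_app_stens bl M'0 bM fst)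
  (fun j => conj (tkk j) (@tkin j)) e1 A1.
have rt j : take m (r j) = drop k (t j) by rewrite /r take_size_cat.
have rd j : drop m (r j) = take k (t j) by rewrite /r drop_size_cat.
have rm j : size (take m (r j)) = m /\ {in take m (r j), forall x, step n x}.
  by rewrite rt; split; [exact: dkm|exact: dkin].
have [h2 [-> h2n h2e]] := symt_approx (slice_app_stens al M0 aM fst') rm e2 A2.
rewrite -[X in a (X + _)]scale1r al scale1r -[X in b (X + _)]scale1r bl scale1r.
rewrite !symt_lin_sum// opprD addrACA.
rewrite [X in X + _](_ : _ = 0); last first.
  rewrite -sumrB big1// => j _; rewrite rt rd /GRing.scale/=; ring.
rewrite add0r (le_trans (ler_normB _ _))// mulrDr lerD//.
  by rewrite (le_trans (aM _ h1n))// mulrCA ler_wpM2l// mulrC.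
by rewrite (le_trans (bM _ h2n))// mulrCA ler_wpM2l// mulrC.
Qed.

End SliceMaps.

(** * Tensor products of bounded maps, extension of functionals *)

Section Otimes.
Context (R : realType) (Phi : LBspace R).
Local Notation C := R[i].
Local Notation dual := (dual Phi).
Local Notation forms := (seq dual -> C^o).
Local Notation symt := (@symt R Phi).
Implicit Types (f g h : forms) (s u v : seq dual) (w : dual) (n k m : nat).

Definition bddmap k j n m (M : C) (A : symt k -> symt j) :=
  0 <= M /\ forall h : symt k, step (c := symc Phi k) n h ->
    step (c := symc Phi j) m (A h) /\ inj_norm m j (A h) <= M * inj_norm n k h.

Lemma bddmap_eval k j n m M (A : symt k -> symt j) s : bddmap n m M A -> size s = j ->
  forall h : symt k, step (c := symc Phi k) n h ->
    `|A h s| <= M * \prod_(w <- s) dnorm m w * inj_norm n k h.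
Proof.
move=> [M0 AM] sj h hn; have [/stensP[Ai _] Ae] := AM h hn.
rewrite (le_trans (bnd_inj_norm Ai sj))// mulrAC ler_wpM2r// prod_dnorm_ge0//.
Qed.

(** [A (x) B] before symmetrization, in the form of the definition of [otimes]. *)
Definition tensor_app i1 j1 i2 j2 (A : symt i1 -> symt j1) (B : symt i2 -> symt j2) f :
  forms := fun s =>
  A (to_symt i1 (slice_app (fun z => B z (drop j1 s)) f)) (take j1 s).

Section TensorApp.
Context (i1 j1 i2 j2 n m : nat) (A : symt i1 -> symt j1) (B : symt i2 -> symt j2).
Context (MA MB : C) (f : forms).
Hypotheses (Al : linear A) (Bl : linear B).
Hypotheses (AM : bddmap n m MA A) (BM : bddmap n m MB B).
Hypothesis fst : stens n (i1 + i2) f.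

Let bs s (h : symt i2) : C^o := B h (drop j1 s).

Let bs_lin s : linear (bs s).
Proof. by move=> a x y; rewrite /bs Bl. Qed.

Lemma tensor_app_off s : size s <> (j1 + j2)%N -> tensor_app A B f s = 0.
Proof.
move=> sz; rewrite /tensor_app; have [js|sj] := leqP j1 (size s); last first.
  by rewrite symt_off// size_take_min (minn_idPr (ltnW sj)) => H; move: sj; rewrite H ltnn.
have -> : slice_app (fun z => B z (drop j1 s)) f = 0.
  apply/funext => u; rewrite /slice_app symt_off// size_drop => H.
  by apply: sz; rewrite -H subnKC.
have -> : to_symt i1 (0 : forms) = 0 :> symt i1.
  by apply: symtP => u; rewrite /to_symt /= insubdK//; apply: rpred0.
have -> : A 0 = 0 by have := Al (-1) 0 0; rewrite scaler0 addr0 scaleN1r addNr.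
by [].
Qed.

Section AtS.
Context (s : seq dual).
Hypothesis ss : size s = (j1 + j2)%N.

Let stk : size (take j1 s) = j1.
Proof. by rewrite size_take_min ss (minn_idPl (leq_addr _ _)). Qed.

Let sdr : size (drop j1 s) = j2.
Proof. by rewrite size_drop ss addKn. Qed.

Let bs_bnd := bddmap_eval BM sdr.

Let Q := MB * \prod_(w <- drop j1 s) dnorm m w.

Let Q0 : 0 <= Q.
Proof. by have [MB0 _] := BM; rewrite mulr_ge0 ?prod_dnorm_ge0. Qed.

Let sliceA := slice_app_stens (bs_lin s) Q0 bs_bnd fst.

Lemma tensor_app_bnd_at c : 0 <= c -> bnd n (i1 + i2) c f ->
  `|tensor_app A B f s| <= MA * MB * c * \prod_(w <- s) dnorm m w.
Proof.
move=> c0 fc; have [MA0 _] := AM.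
have fb := slice_app_bnd Q0 bs_bnd fst c0 fc; rewrite -/Q in fb.
rewrite /tensor_app (le_trans (bddmap_eval AM stk _))//.
  by apply/stensP; rewrite (to_symtE sliceA).
rewrite (to_symtE sliceA) -[in leRHS](cat_take_drop j1 s) big_cat /=.
rewrite (le_trans (ler_wpM2l _ (inj_norm_le (mulr_ge0 Q0 c0) fb)))//.
  by rewrite mulr_ge0 ?prod_dnorm_ge0.
rewrite le_eqVlt; apply/orP; left; apply/eqP; rewrite /Q; ring.
Qed.

Lemma tensor_app_approx_at N (a : 'I_N -> C) (t : 'I_N -> seq Phi) e :
  (forall j, size (t j) = (i1 + i2)%N /\ {in t j, forall x, step n x}) -> 0 <= e ->
  bnd n (i1 + i2) e (fun s => f s - \sum_j a j * etens (t j) s) ->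
  `|tensor_app A B f s - \sum_j a j *
    ftens j1 (A (to_symt i1 (symz (etens (take i1 (t j))))))
      (B (to_symt i2 (symz (etens (drop i1 (t j)))))) s| <=
  MA * MB * e * \prod_(w <- s) dnorm m w.
Proof.
move=> tn e0 fe; have [MA0 _] := AM.
have A1 := slice_app_approx (bs_lin s) Q0 bs_bnd fst tn e0 fe; rewrite -/Q in A1.
have tki j : size (take i1 (t j)) = i1 /\ {in take i1 (t j), forall x, step n x}.
  have [tk ts] := tn j; rewrite size_take_min tk (minn_idPl (leq_addr _ _)); split=> //.
  by move=> x xt; apply: ts; exact: mem_take xt.
have [h [hE hn he]] := symt_approx sliceA tki (mulr_ge0 Q0 e0) A1.
rewrite /tensor_app -/(bs s) hE.
rewrite -[X in A (X + h)]scale1r Al scale1r symt_lin_sum//.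
have -> : forall X Y : symt j1, (X + Y : symt j1) (take j1 s) = X (take j1 s) + Y (take j1 s) by [].
rewrite (val_symt_sum _ _ (fun j => A (to_symt i1 (symz (etens (take i1 (t j))))))).
rewrite (eq_bigr (fun j => a j *
    ftens j1 (A (to_symt i1 (symz (etens (take i1 (t j))))))
      (B (to_symt i2 (symz (etens (drop i1 (t j)))))) s)) => [|j _]; last first.
  by rewrite /ftens /bs; ring.
rewrite addrAC subrr add0r (le_trans (bddmap_eval AM stk hn))//.
rewrite -[in leRHS](cat_take_drop j1 s) big_cat /=.
rewrite (le_trans (ler_wpM2l _ he))//; first by rewrite mulr_ge0 ?prod_dnorm_ge0.
rewrite le_eqVlt; apply/orP; left; apply/eqP; rewrite /Q; ring.
Qed.

End AtS.

(** The image of an approximation of [f] by algebraic tensors approximates the image of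
    [f], and is a sum of tensor products of elements of the step. *)
Lemma tensor_app_inj : inj_tens m (j1 + j2) (tensor_app A B f).
Proof.
apply: inj_tens_closed; first exact: tensor_app_off.
have [[MA0 AS] [MB0 BS]] := (AM, BM).
move=> e e0; have M1 : 0 < MA * MB + 1 by rewrite ltr_wpDl// mulr_ge0.
have e1 : 0 < e / (MA * MB + 1) by rewrite divr_gt0.
have [[_ /(_ _ e1)[g [N [a [t [tn ->]]]] fg]] _] := fst.
have fg' : bnd n (i1 + i2) (e / (MA * MB + 1)) (fun s => f s - \sum_j a j * etens (t j) s).
  by move=> s sk; have := fg s sk; rewrite fct_sumE.
exists (\sum_j a j *: ftens j1 (A (to_symt i1 (symz (etens (take i1 (t j))))))
      (B (to_symt i2 (symz (etens (drop i1 (t j))))))).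
  apply: lin_set_sum; first exact: inj_tens_submod.
  move=> j _; have [tk ts] := tn j.
  have tt : stens n i1 (symz (etens (take i1 (t j)))).
    apply: stens_symz_etens; first by rewrite size_take_min tk (minn_idPl (leq_addr _ _)).
    by move=> x xt; apply: ts; exact: mem_take xt.
  have td : stens n i2 (symz (etens (drop i1 (t j)))).
    apply: stens_symz_etens; first by rewrite size_drop tk addKn.
    by move=> x xt; apply: ts; exact: mem_drop xt.
  have [|/stensP[A1 _] _] := AS (to_symt i1 (symz (etens (take i1 (t j))))).
    by apply/stensP; rewrite (to_symtE tt).
  have [|/stensP[B1 _] _] := BS (to_symt i2 (symz (etens (drop i1 (t j))))).
    by apply/stensP; rewrite (to_symtE td).
  exact: inj_ftens.
move=> s sk; rewrite fct_sumE.
rewrite (le_trans (tensor_app_approx_at sk tn (ltW e1) fg'))//.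
rewrite ler_wpM2r ?prod_dnorm_ge0// mulrCA ler_piMr ?(ltW e0)// ler_pdivrMr// mul1r.
by rewrite lerDl.
Qed.

Lemma tensor_app_bnd c : 0 <= c -> bnd n (i1 + i2) c f ->
  bnd m (j1 + j2) (MA * MB * c) (tensor_app A B f).
Proof. by move=> c0 fc s sk; exact: tensor_app_bnd_at. Qed.

End TensorApp.
End Otimes.

Section Factorization.
Context (R : realType) (Phi : LBspace R).
Local Notation C := R[i].
Local Notation dual := (dual Phi).
Local Notation forms := (seq dual -> C^o).
Local Notation symt := (@symt R Phi).
Implicit Types (f g h : forms) (s u v : seq dual) (w : dual) (n k m : nat).

Lemma union_norm_subproof (x : Phi) : exists n, step n x.
Proof. exact: lb_cover. Qed.

(** The common norm of all the steps: it is a norm on their union because the inclusions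
    of the steps are isometric. *)
Definition union_norm (x : Phi) : C := nrm (projT1 (cid (union_norm_subproof x))) x.

Lemma union_normE n x : step n x -> union_norm x = nrm n x.
Proof.
rewrite /union_norm; case: cid => /= m mx nx.
have [nm|mn] := leqP n m; first exact: nrm_mono.
by symmetry; apply: nrm_mono mx; exact: ltnW.
Qed.

Lemma step_lin n : lin_set (step (c := Phi) n).
Proof.
have [B [j [_ <- _]]] := lb_banach Phi n.
split=> [|a _ _ [x _ <-] [y _ <-]]; first by exists 0; rewrite ?linear0.
by exists (a *: x + y); rewrite ?linearP.
Qed.

Lemma nrm_triangle n (x y : Phi) : step n x -> step n y -> nrm n (x + y) <= nrm n x + nrm n y.
Proof.
have [B [j [_ <- jn]]] := lb_banach Phi n => -[a _ <-] [b _ <-].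
by rewrite -linearD !jn ler_normD.
Qed.

Lemma step_pair (x y : Phi) : exists n, step n x /\ step n y.
Proof.
have [[n nx] [m my]] := (lb_cover x, lb_cover y); exists (maxn n m).
split; first by apply: step_mono nx; exact: leq_maxl.
by apply: step_mono my; exact: leq_maxr.
Qed.

Lemma union_normD x y : union_norm (x + y) <= union_norm x + union_norm y.
Proof.
have [n [nx ny]] := step_pair x y.
have nxy : step n (x + y).
  by have [_ /(_ 1 x y nx ny)] := step_lin n; rewrite scale1r.
by rewrite !(@union_normE n)//; exact: nrm_triangle.
Qed.

Lemma union_normZ a x : union_norm (a *: x) = `|a| * union_norm x.
Proof.
have [n nx] := lb_cover x.
by rewrite !(@union_normE n) ?nrmZ//; exact: stepZ.
Qed.

Lemma union_norm_ge0 x : 0 <= union_norm x.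
Proof. by have [n nx] := lb_cover x; rewrite (union_normE nx) nrm_ge0. Qed.

(** Extension by Hahn-Banach for [dnorm n w] times the common norm of the steps, so that
    the extension has the same bound on all the steps at once. *)
Lemma dual_extend n w : exists w' : dual,
  (forall x, step n x -> w' x = w x) /\ forall m, dnorm m w' <= dnorm n w.
Proof.
pose p x := complex.Re (dnorm n w * union_norm x).
have ReM (a b : C) : 0 <= a -> complex.Re (a * b) = complex.Re a * complex.Re b.
  by move=> /ger0_real/RRe_real <-; case: b => b c /=; rewrite mul0r subr0.
have pE x : (p x)%:C%C = dnorm n w * union_norm x.
  by apply/RRe_real/ger0_real; rewrite mulr_ge0 ?dnorm_ge0 ?union_norm_ge0.
have pD x y : p (x + y) <= p x + p y.
  by rewrite -lecR rmorphD/= !pE -mulrDr ler_wpM2l ?dnorm_ge0 ?union_normD.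
have pZ a x : p (a *: x) = complex.Re `|a| * p x.
  by rewrite /p union_normZ mulrCA (ReM _ _ (normr_ge0 a)).
have wl a x y : step n x -> step n y -> (w (a *: x + y) : C) = a * w x + w y.
  by move=> _ _; exact (clin_linear w a x y).
have wp x : step n x -> `|w x : C| <= (p x)%:C%C.
  by move=> nx; rewrite pE (union_normE nx); exact: dnormP.
have [g [gl gw gp]] := hahn_banach pD pZ (step_lin n) wl wp.
have gc : (g : indlim Phi -> C^o) \in @cont_lin _ (indlim Phi) C^o.
  have gseml := gl.
  apply/asboolP; split; first exact: gl.
  pose q := sn_comp (@abs_seminorm C) (gl : linear (g : Phi -> C^o)).
  have qs : indlim_seminorms (q : seminorm Phi).
    move=> m; exists (dnorm n w) => x mx; rewrite /q /= /sn_comp_fun /=.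
    by rewrite (le_trans (gp x))// pE (union_normE mx).
  move=> x; have FF : Filter (nbhs (x : indlim Phi)) := nbhs_filter (x : indlim Phi).
  apply/(@cvgrPdist_lt _ _ _ _ (@fmap_filter _ _ _ (nbhs (x : indlim Phi)) FF)) => e e0.
  apply: (@filterS _ (nbhs (x : indlim Phi)) FF _ _ _ (lc_near (x : indlim Phi) qs e0)).
  move=> y /=; rewrite /sn_comp_fun /= => H; rewrite distrC.
  by rewrite (_ : g y - g x = g (y - x))// addrC -mulN1r -gl scaleN1r addrC.
exists (to_clin (g : indlim Phi -> C^o)); split=> [x nx|m].
  by rewrite to_clinE// gw.
apply: dnorm_le => x mx x1; rewrite to_clinE// (le_trans (gp x))// pE (union_normE mx).
by rewrite ler_piMr ?dnorm_ge0.
Qed.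

End Factorization.

(** * Boundedness of continuous maps on steps *)

Section Strict.
Context (R : realType).
Local Notation C := R[i].

Lemma seminorm_scale_le (E : lmodType C) (p : E -> C) :
  (forall x, 0 <= p x) -> (forall a x, p (a *: x) <= `|a| * p x) ->
  forall a x, p (a *: x) = `|a| * p x.
Proof.
move=> p0 pZ a x; apply/eqP; rewrite eq_le pZ /=; have [->|a0] := eqVneq a 0.
  by rewrite normr0 mul0r.
have := pZ a^-1 (a *: x); rewrite scalerA mulVf// scale1r normfV.
by rewrite ler_pdivlMl// normr_gt0.
Qed.

(** Witnessed by the distance to [L], the quotient seminorm. *)
Lemma quotient_seminorm (E : lmodType C) (p : seminorm E) (L : set E) : lin_set L ->
  exists d : seminorm E, [/\ forall x, d x <= p x, forall x, L x -> d x = 0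
    & forall x, d x = 0 -> forall e, 0 < e -> exists2 z, L z & p (x - z) < e].
Proof.
move=> [L0 LD].
have LB x y : L x -> L y -> L (x + y) by move=> Lx Ly; have := LD 1 x y Lx Ly; rewrite scale1r.
have LZ a x : L x -> L (a *: x) by move=> Lx; have := LD a x 0 Lx L0; rewrite addr0.
pose S x := [set complex.Re (p (x - z)) | z in L].
have pR x : (complex.Re (p x))%:C%C = p x by apply/RRe_real/ger0_real/sn_ge0.
have p0 x : 0 <= complex.Re (p x) by rewrite -ler0c pR sn_ge0.
have Sinf x : has_inf (S x).
  split; first by exists (complex.Re (p (x - 0))), 0.
  by exists 0 => _ [z _ <-].
pose d x : C := (inf (S x))%:C%C.
have d_le x z : L z -> d x <= p (x - z).
  move=> Lz; rewrite -pR lecR; apply: ge_inf; last by exists z.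
  by case: (Sinf x).
have d_ge0 x : 0 <= d x.
  rewrite ler0c; apply: lb_le_inf; first by case: (Sinf x).
  by move=> _ [z _ <-].
have d_adh x e : 0 < e -> exists2 z, L z & p (x - z) < d x + e.
  move=> e0; have eR : (complex.Re e)%:C%C = e by apply/RRe_real/gtr0_real.
  have e0' : 0 < complex.Re e by rewrite -ltcR eR.
  have [_ [z Lz <-] H] := inf_adherent e0' (Sinf x).
  by exists z => //; rewrite -pR -eR /d -rmorphD ltcR.
have dD x y : d (x + y) <= d x + d y.
  apply/ler_addgt0Pr => e e0; have e2 : 0 < e / 2 by rewrite divr_gt0.
  have [z Lz xz] := d_adh x _ e2; have [t Lt yt] := d_adh y _ e2.
  rewrite (le_trans (d_le _ _ (LB _ _ Lz Lt)))// opprD addrACA.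
  rewrite (le_trans (sn_triangle _ _ _))// [e]splitr addrACA lerD// ltW//.
have dZ a x : d (a *: x) = `|a| * d x.
  apply: seminorm_scale_le => // {}a {}x; apply/ler_addgt0Pr => e e0.
  have a1 : 0 < `|a| + 1 by rewrite ltr_wpDl.
  have [z Lz xz] := d_adh x _ (divr_gt0 e0 a1).
  rewrite (le_trans (d_le _ _ (LZ a _ Lz)))// -scalerBr sn_scale.
  rewrite (le_trans (ler_wpM2l _ (ltW xz)))// mulrDr lerD2l.
  by rewrite mulrCA ler_piMr ?(ltW e0)// ler_pdivrMr// mul1r lerDl.
exists (Seminorm dD dZ); split=> [x|x Lx|x dx e e0] /=.
- by have := d_le x 0 L0; rewrite subr0.
- by apply/eqP; rewrite eq_le d_ge0 andbT; have := d_le x x Lx; rewrite subrr sn0.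
- by have [z Lz H] := d_adh x e e0; exists z => //; rewrite /= in dx; rewrite dx add0r in H.
Qed.

Context (Phi : LBspace R).
Local Notation dual := (dual Phi).
Local Notation forms := (seq dual -> C^o).
Local Notation symt := (@symt R Phi).
Implicit Types (f g h : forms) (s u v : seq dual) (w : dual) (n k m : nat).

Lemma etens_restrict n (t : seq Phi) (phi : dual -> dual) s :
  (forall w x, step n x -> phi w x = w x) -> {in t, forall x, step n x} ->
  etens t (map phi s) = etens t s.
Proof.
move=> phiE ts; rewrite /etens size_map; case: ifP => // _.
elim: s t ts => [|w s IH] [|x t] ts //=; rewrite !big_cons /= phiE.
  by rewrite IH// => y yt; apply: ts; rewrite in_cons yt orbT.
by apply: ts; exact: mem_head.
Qed.

(** A form of the power of a step only sees the restrictions of its arguments to the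
    step, since this holds of algebraic tensors. *)
Lemma restrict_limit n m k f (phi : dual -> dual) s :
  (forall w x, step n x -> phi w x = w x) -> size s = k ->
  (forall e, 0 < e -> exists2 g, alg_tens n k g & bnd m k e (fun s => f s - g s)) ->
  f (map phi s) = f s.
Proof.
move=> phiE sk fe; apply/eqP; rewrite -subr_eq0; apply/eqP.
apply: (@vanish_small _ _ (\prod_(w <- map phi s) dnorm m w + \prod_(w <- s) dnorm m w)).
move=> e e0; have [g [N [a [t [tn gE]]]] fg] := fe e e0.
have gphi : g (map phi s) = g s.
  rewrite gE !fct_sumE; apply: eq_bigr => j _; rewrite /= !fctE; congr (_ * _).
  by have [_ ts] := tn j; apply: etens_restrict ts.
rewrite (_ : f _ - f s = (f (map phi s) - g (map phi s)) - (f s - g s)); last first.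
  by rewrite gphi; ring.
by rewrite (le_trans (ler_normB _ _))// mulrDr lerD ?fg// size_map.
Qed.

Lemma inj_tens_restrict n k f (phi : dual -> dual) s :
  (forall w x, step n x -> phi w x = w x) -> size s = k -> inj_tens n k f ->
  f (map phi s) = f s.
Proof. by move=> phiE sk [_ fe]; apply: (restrict_limit phiE sk fe). Qed.

Lemma extend_fun n : exists phi : dual -> dual,
  (forall w x, step n x -> phi w x = w x) /\
  forall w m, dnorm m (phi w) <= dnorm n w.
Proof.
have /choice[phi phiP] : forall w : dual, exists w' : dual,
    (forall x, step n x -> w' x = w x) /\ forall m, dnorm m w' <= dnorm n w.
  exact: dual_extend.
by exists phi; split=> w; [move=> x; have [H _] := phiP w; exact: H|have [_] := phiP w].
Qed.

(** Functionals on a step extend without increase of norm, so the larger step has no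
    fewer test functionals than the smaller one. *)
Lemma inj_norm_indep n m k f : (n <= m)%N -> inj_tens n k f ->
  inj_norm m k f = inj_norm n k f.
Proof.
move=> nm fi; apply/eqP; rewrite eq_le inj_norm_mono//=.
have [phi [phiE phiN]] := extend_fun n.
apply: inj_norm_le; first exact: inj_norm_ge0.
move=> s sk; rewrite -(inj_tens_restrict phiE sk fi).
rewrite (le_trans (bnd_inj_norm (inj_tens_mono nm fi) _)) ?size_map//.
rewrite ler_wpM2l ?inj_norm_ge0// big_map ler_prod// => w _.
by rewrite dnorm_ge0 phiN.
Qed.

Section SymtNorm.
Context (k : nat).

Definition symt_norm (f : symt k) : C :=
  inj_norm (projT1 (cid (symt_stens f))) k f.

Lemma symt_normE n (f : symt k) : stens n k f -> symt_norm f = inj_norm n k f.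
Proof.
move=> [fi _]; rewrite /symt_norm; case: cid => /= m [fi' _].
by have [nm|/ltnW mn] := leqP n m; [|symmetry]; exact: inj_norm_indep.
Qed.

Lemma symt_pair (f g : symt k) : exists n, stens n k f /\ stens n k g.
Proof.
have [[n fn] [m gm]] := (symt_stens f, symt_stens g); exists (maxn n m).
by split; [apply: stens_mono fn; exact: leq_maxl|apply: stens_mono gm; exact: leq_maxr].
Qed.

Lemma symt_norm_triangle (f g : symt k) : symt_norm (f + g) <= symt_norm f + symt_norm g.
Proof.
have [n [fn gn]] := symt_pair f g.
have fgn : stens n k (f + g : symt k).
  by have [_ /(_ 1 _ _ fn gn)] := stens_lin Phi n k; rewrite scale1r.
rewrite !(@symt_normE n)//; apply: inj_norm_le; first by rewrite addr_ge0 ?inj_norm_ge0.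
by apply: bndD; apply: bnd_inj_norm; [case: fn|case: gn].
Qed.

Lemma symt_norm_scale a (f : symt k) : symt_norm (a *: f) = `|a| * symt_norm f.
Proof.
apply: seminorm_scale_le => [g|b g]; first exact: inj_norm_ge0.
have [n gn] := symt_stens g.
have bn : stens n k (b *: g : symt k).
  by have [g0 gD] := stens_lin Phi n k; have := gD b _ _ gn g0; rewrite addr0.
rewrite !(@symt_normE n)//; apply: inj_norm_le; first by rewrite mulr_ge0 ?inj_norm_ge0.
by apply: bndZ; apply: bnd_inj_norm; case: gn.
Qed.

Definition symt_sn : seminorm (symt k) := Seminorm symt_norm_triangle symt_norm_scale.

Lemma symt_sn_indlim : indlim_seminorms (symt_sn : seminorm (symc Phi k)).
Proof. by move=> n; exists 1 => f /stensP fn; rewrite mul1r /= (symt_normE fn). Qed.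

(** A limit only sees the restrictions of functionals to the step, hence is bounded by the
    norms of these restrictions and not only by those on a larger step. *)
Lemma stens_closed n (f : symt k) :
  (forall e, 0 < e -> exists2 z : symt k, stens n k z & symt_sn (f - z) < e) ->
  stens n k f.
Proof.
move=> fe; split; last exact: symt_permsym.
have [m0 fm0] := symt_stens f; pose m := maxn m0 n.
have fm : stens m k f by apply: stens_mono fm0; exact: leq_maxl.
have near e : 0 < e -> exists2 z : symt k, stens n k z & bnd m k e (fun s => f s - z s).
  move=> e0; have [z zn ze] := fe e e0; exists z => //.
  have zm : stens m k z by apply: stens_mono zn; exact: leq_maxr.
  have fzm : stens m k (f - z : symt k).
    have [_ H] := stens_lin Phi m k; have := H (-1) _ _ zm fm.
    by rewrite scaleN1r addrC.
  apply: (bnd_le (ltW ze)); rewrite /= (symt_normE fzm).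
  by apply: bnd_inj_norm; case: fzm.
have [phi [phiE phiN]] := extend_fun n.
have fphi s : size s = k -> f (map phi s) = f s.
  move=> sk; apply: (@restrict_limit n m k f phi s phiE sk) => e e0.
  have e2 : 0 < e / 2 by rewrite divr_gt0.
  have [z [[_ /(_ _ e2)[g ga zg]] _] fz] := near _ e2.
  exists g => // s' s'k; rewrite -(subrK (z s') (f s')) -addrA (le_trans (ler_normD _ _))//.
  rewrite [X in X * _]splitr mulrDl lerD ?fz// (le_trans (zg _ s'k))//.
  rewrite ler_wpM2l ?(ltW e2)// ler_prod// => w _.
  by rewrite dnorm_ge0 dnorm_mono// leq_maxr.
apply: inj_tens_closed => [s|e e0]; first exact: symt_off.
have [z [zi zs] fz] := near e e0; exists z => // s sk.
rewrite -(fphi s sk) -(inj_tens_restrict phiE sk zi).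
rewrite (le_trans (fz _ _)) ?size_map// ler_wpM2l ?(ltW e0)// big_map ler_prod// => w _.
by rewrite dnorm_ge0 phiN.
Qed.

End SymtNorm.

Lemma nat_bounded_absurd (c : C) : (forall m, (m%:R : C) <= c) -> False.
Proof.
move=> cm; have c0 : 0 <= c := cm 0%N.
have cR : (complex.Re c)%:C%C = c by apply/RRe_real/ger0_real.
have r0 : 0 <= complex.Re c by rewrite -ler0c cR.
have := archi_boundP r0; rewrite ltNge => /negP; apply.
by rewrite -lecR cR rmorph_nat.
Qed.

(** A continuous map sends each step boundedly into a single step: otherwise a
    suitable series of distances to the steps is a continuous seminorm
    unbounded on the image of the unit ball. *)
Lemma clin_factor k j (T : clin (indlim (symc Phi k)) (indlim (symc Phi j))) n :
  exists m M, bddmap n m M (T : symt k -> symt j).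
Proof.
have [m Tm] : exists m, forall x : symt k, stens n k x -> stens m j (T x : symt j).
  apply: contrapT => noT.
  have /choice[x xP] : forall m, exists x : symt k,
      stens n k x /\ ~ stens m j (T x : symt j).
    move=> m; apply: contrapT => H; apply: noT; exists m => x xn.
    by apply: contrapT => nx; apply: H; exists x.
  pose L m := [set f : symt j | stens m j f].
  have Ll m : lin_set (L m) by have [L0 LD] := stens_lin Phi m j; split=> // a y z; exact: LD.
  have /choice[d dP] := fun m => quotient_seminorm (symt_sn j) (Ll m).
  have dpos m : 0 < d m (T (x m)).
    rewrite lt_neqAle sn_ge0 andbT eq_sym; apply/eqP => d0.
    have [_ _ /(_ _ d0) H] := dP m; have [_] := xP m; apply.
    exact: stens_closed.
  (* The weights make the m-th term at [T (x m)] at least m times the norm of [x m]. *)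
  pose c m : C := m%:R * (inj_norm n k (x m) + 1) / d m (T (x m)).
  have c0 m : 0 <= c m.
    by rewrite divr_ge0 ?sn_ge0// mulr_ge0 ?ler0n// addr_ge0 ?inj_norm_ge0.
  (* The sum is finite since [d m] vanishes on the step m. *)
  pose q (y : symt j) : C := \sum_(m < projT1 (cid (symt_stens y))) c m * d m y.
  have qE N (y : symt j) : stens N j y -> q y = \sum_(m < N) c m * d m y.
    have wid N1 N2 : (N1 <= N2)%N -> stens N1 j y ->
        \sum_(m < N1) c m * d m y = \sum_(m < N2) c m * d m y.
      move=> N12 yN; rewrite (big_ord_widen N2 (fun m => c m * d m y) N12) big_mkcond.
      apply: eq_bigr => m _; case: ltnP => // Nm.
      by have [_ dL _] := dP m; rewrite (dL y) ?mulr0//; exact: stens_mono yN.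
    rewrite /q; case: cid => /= N' yN' yN.
    by have [NN|/ltnW NN] := leqP N N'; [symmetry|]; exact: wid.
  have qD y z : q (y + z) <= q y + q z.
    have [N [yN zN]] := symt_pair y z.
    have yzN : stens N j (y + z : symt j).
      by have [_ /(_ 1 _ _ yN zN)] := stens_lin Phi N j; rewrite scale1r.
    rewrite !(@qE N)// -big_split; apply: ler_sum => m _.
    by rewrite /= -mulrDr ler_wpM2l ?c0// sn_triangle.
  have qZ a y : q (a *: y) = `|a| * q y.
    have [N yN] := symt_stens y.
    have ayN : stens N j (a *: y : symt j).
      by have [z0 zD] := stens_lin Phi N j; have := zD a _ _ yN z0; rewrite addr0.
    rewrite !(@qE N)// mulr_sumr; apply: eq_bigr => m _.
    by rewrite sn_scale mulrCA.
  pose qs : seminorm (symc Phi j) := Seminorm qD qZ.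
  have qi : indlim_seminorms qs.
    move=> N; exists (\sum_(m < N) c m) => y /stensP yN.
    rewrite /= (qE N)// mulr_suml; apply: ler_sum => m _; rewrite ler_wpM2l ?c0//.
    have [/(_ y) dle _ _] := dP m; rewrite (le_trans dle)//= (symt_normE yN)//.
  have [M TM] := clin_indlim_bound T qi n.
  apply: (@nat_bounded_absurd `|M|) => m.
  have [xn nTx] := xP m.
  have := TM (x m) (proj2 (stensP n (x m)) xn); rewrite /= => H.
  have x1 : 0 < inj_norm n k (x m) + 1 by rewrite ltr_wpDl ?inj_norm_ge0.
  have H1 : m%:R * (inj_norm n k (x m) + 1) <= q (T (x m)).
    have [N TN] := symt_stens (T (x m) : symt j).
    have mN : (m < N)%N.
      by rewrite ltnNge; apply/negP => Nm; apply: nTx; exact: stens_mono TN.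
    rewrite (qE N)// (bigD1 (Ordinal mN))//= /c divfK ?gt_eqF// lerDl.
    by apply: sumr_ge0 => i _; rewrite mulr_ge0 ?c0 ?sn_ge0.
  rewrite -(ler_pM2r x1) (le_trans H1)// (le_trans H)//.
  have MR : M * inj_norm n k (x m) = `|M| * inj_norm n k (x m).
    rewrite -[LHS]ger0_norm; first by rewrite normrM (ger0_norm (inj_norm_ge0 _ _ _)).
    by apply: le_trans H; rewrite (le_trans _ H1)// mulr_ge0 ?ler0n ?ltW.
  by rewrite MR ler_wpM2l// lerDl.
have [M TM] := clin_indlim_bound T (@symt_sn_indlim j) n.
exists m, `|M|; split=> // h hn; have hs := proj1 (stensP n h) hn.
split; first by apply/stensP; exact: Tm.
rewrite -(symt_normE (Tm h hs)).
have := TM h hn; rewrite /= => H; rewrite (le_trans H)//.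
rewrite -[leLHS]ger0_norm; first by rewrite normrM (ger0_norm (inj_norm_ge0 _ _ _)).
by rewrite (le_trans _ H)// inj_norm_ge0.
Qed.

End Strict.

(** * Operators between symmetric powers *)

Section Homs.
Context (R : realType) (Phi : LBspace R).
Local Notation C := R[i].
Local Notation dual := (dual Phi).
Local Notation forms := (seq dual -> C^o).
Local Notation symt := (@symt R Phi).
Local Notation symHom := (@symHom R Phi).
Implicit Types (s u v : seq dual) (w : dual) (n k m i j : nat).

Lemma ap_lin k i (A : symHom k i) : linear (ap A).
Proof. by move=> a x y; exact: (clin_linear A). Qed.

Lemma ap_factor k i (A : symHom k i) n : exists m M, bddmap n m M (ap A).
Proof. exact: clin_factor. Qed.

Lemma bddmap_mono k i n m m' M (A : symt k -> symt i) : (m <= m')%N ->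
  bddmap n m M A -> bddmap n m' M A.
Proof.
move=> mm [M0 AM]; split=> // h hn; have [/stensP Am Ae] := AM h hn.
split; first by apply/stensP; exact: stens_mono Am.
by rewrite (le_trans _ Ae)// inj_norm_mono//; case: Am.
Qed.

(** The criterion by which all the operators below are shown to be continuous. *)
Lemma to_homE k i (T : symt k -> symt i) : linear T ->
  (forall n, exists m M, bddmap n m M T) -> forall f, to_hom T f = T f.
Proof.
move=> Tl Tb f; rewrite /to_hom /ap to_clinE//.
apply: clin_indlim => // q Qq n; have [m [M [M0 TM]]] := Tb n.
have [N qN] := Qq m; exists (`|N| * M) => x nx; have [Tm Te] := TM x nx.
rewrite (le_trans (qN _ Tm))//= -mulrA (le_trans _ (ler_wpM2l (normr_ge0 N) Te))//.
have [N0|N0] := boolP (0 <= N); first by rewrite ger0_norm.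
have := le_trans (sn_ge0 q _) (qN _ Tm) => /= H.
rewrite -[leLHS]ger0_norm// normrM ler_wpM2l//.
by rewrite ger0_norm ?inj_norm_ge0.
Qed.

Lemma symHomP k i (A B : symHom k i) : (forall f, ap A f = ap B f) -> A = B.
Proof. by move=> AB; apply: val_inj; apply/funext. Qed.

Lemma ap0 k i f : ap (0 : symHom k i) f = 0. Proof. by []. Qed.

Lemma apD k i (A B : symHom k i) f : ap (A + B) f = ap A f + ap B f. Proof. by []. Qed.

Lemma apN k i (A : symHom k i) f : ap (- A) f = - ap A f. Proof. by []. Qed.

Lemma apZ k i c (A : symHom k i) f : ap (c *: A) f = c *: ap A f. Proof. by []. Qed.

Lemma ap_sum k i I (r : seq I) (P : pred I) (A : I -> symHom k i) f :
  ap (\sum_(x <- r | P x) A x) f = \sum_(x <- r | P x) ap (A x) f.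
Proof. by elim/big_rec2: _ => [//|x y z _ <-]; rewrite apD. Qed.

Lemma ap_f0 k i (A : symHom k i) : ap A 0 = 0.
Proof. by have := ap_lin A (-1) 0 0; rewrite scaler0 addr0 scaleN1r addNr. Qed.

Lemma ap_fD k i (A : symHom k i) x y : ap A (x + y) = ap A x + ap A y.
Proof. by have := ap_lin A 1 x y; rewrite !scale1r. Qed.

Lemma ap_fZ k i (A : symHom k i) c x : ap A (c *: x) = c *: ap A x.
Proof. by have := ap_lin A c x 0; rewrite !addr0 ap_f0 addr0. Qed.

Lemma ap_fsum k i (A : symHom k i) I (r : seq I) (P : pred I) (F : I -> symt k) :
  ap A (\sum_(x <- r | P x) F x) = \sum_(x <- r | P x) ap A (F x).
Proof. by elim/big_rec2: _ => [|x y z _ <-]; rewrite ?ap_f0 ?ap_fD. Qed.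

Lemma val_sum k I (r : seq I) (P : pred I) (F : I -> symt k) s :
  (\sum_(x <- r | P x) F x : symt k) s = \sum_(x <- r | P x) F x s.
Proof. by elim/big_rec2: _ => [//|x y z _ <-]. Qed.

Lemma val_lin k c (f g : symt k) s : (c *: f + g : symt k) s = c * f s + g s.
Proof. by []. Qed.

Lemma dot_sum k w I (r : seq I) (P : pred I) (F : I -> symt k) :
  dot w (\sum_(x <- r | P x) F x) = \sum_(x <- r | P x) dot w (F x).
Proof. exact: val_sum. Qed.

Lemma dotZ k w c (f : symt k) : dot w (c *: f) = c * dot w f. Proof. by []. Qed.

Lemma dotD k w (f g : symt k) : dot w (f + g) = dot w f + dot w g. Proof. by []. Qed.

Lemma dot_degree1 w (f : symt 1) : dot w f = f [:: w]. Proof. by []. Qed.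

Lemma symHom_dotP k i (A B : symHom k i) :
  (forall w f, dot w (ap A f) = dot w (ap B f)) -> A = B.
Proof. by move=> AB; apply: symHomP => f; apply: symt_dot_ext => w; exact: AB. Qed.

Lemma hom_compE k j i (A : symHom j i) (B : symHom k j) f :
  ap (hom_comp A B) f = ap A (ap B f).
Proof.
apply: to_homE => [a x y|n]; first by rewrite !ap_lin.
have [m [M [M0 BM]]] := ap_factor B n; have [p [N [N0 AN]]] := ap_factor A m.
exists p, (N * M); split=> [|h hn]; first exact: mulr_ge0.
have [Bm Be] := BM h hn; have [Ap Ae] := AN _ Bm; split=> //.
by rewrite (le_trans Ae)// -mulrA ler_wpM2l.
Qed.

Lemma id_homE k f : ap (id_hom Phi k) f = f.
Proof.
by apply: to_homE => // n; exists n, 1; split=> // h hn; rewrite mul1r.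
Qed.

Lemma hom_cast_id k i (A : symHom k i) : hom_cast k i A = A.
Proof.
apply: symHomP => f; rewrite /hom_cast.
have -> : (fun f => to_symt i (ap A (to_symt k (symt_fun f)))) = ap A.
  by apply/funext => g; rewrite !to_symtK.
by apply: to_homE; [exact: ap_lin|exact: ap_factor].
Qed.

Lemma hom_castE k i k' i' (A : symHom k i) (f : symt k') : k = k' -> i = i' ->
  (ap (hom_cast k' i' A) f : forms) = ap A (to_symt k f).
Proof. by move=> ek ei; subst k' i'; rewrite hom_cast_id to_symtK. Qed.

Lemma stens_cast n k k' (f : forms) : k = k' -> stens n k f -> stens n k' f.
Proof. by move->. Qed.

Section Odot.
Context (i1 j1 i2 j2 : nat) (A : symHom i1 j1) (B : symHom i2 j2).

Lemma tensor_app_stens_bnd n : exists m M, 0 <= M /\ forall f, stens n (i1 + i2) f ->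
  inj_tens m (j1 + j2) (tensor_app (ap A) (ap B) f) /\
  forall c, 0 <= c -> bnd n (i1 + i2) c f ->
    bnd m (j1 + j2) (M * c) (tensor_app (ap A) (ap B) f).
Proof.
have [m1 [MA AM]] := ap_factor A n; have [m2 [MB BM]] := ap_factor B n.
have AM' := bddmap_mono (leq_maxl m1 m2) AM; have BM' := bddmap_mono (leq_maxr m1 m2) BM.
exists (maxn m1 m2), (MA * MB); split.
  by case: AM => MA0 _; case: BM => MB0 _; exact: mulr_ge0.
move=> f fst; split; first exact: (tensor_app_inj (ap_lin A) (ap_lin B) AM' BM').
by move=> c; exact: (tensor_app_bnd (ap_lin B) AM' BM').
Qed.

Lemma tensor_app_lin a (f g : symt (i1 + i2)) :
  tensor_app (ap A) (ap B) (a *: f + g : symt _) =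
  a *: tensor_app (ap A) (ap B) f + tensor_app (ap A) (ap B) g.
Proof.
apply/funext => s.
change (tensor_app (ap A) (ap B) (a *: f + g : symt _) s =
  a * tensor_app (ap A) (ap B) f s + tensor_app (ap A) (ap B) g s).
rewrite /tensor_app; have [n [fst gst]] := symt_pair f g.
have fgst : stens n (i1 + i2) (a *: f + g : symt _).
  by have [_ H] := stens_lin Phi n (i1 + i2); exact: H.
have [m [M BM]] := ap_factor B n; have M0 : 0 <= M by case: BM.
have bl : linear ((fun z => ap B z (drop j1 s)) : symt i2 -> C^o).
  by move=> c x y; rewrite ap_lin.
have [sj|sj] := eqVneq (size (drop j1 s)) j2; last first.
  have off (h : symt (i1 + i2)) : slice_app (fun z => ap B z (drop j1 s)) h = 0.
    by apply/funext => u; rewrite /slice_app symt_off//; exact/eqP.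
  rewrite !off (_ : to_symt i1 (0 : forms) = 0 :> symt i1); last first.
    by apply: symtP => u; rewrite /to_symt /= insubdK//; apply: rpred0.
  by rewrite ap_f0 (_ : (0 : symt j1) (take j1 s) = 0)// mulr0 addr0.
have BMs := bddmap_eval BM sj.
have Q0 : 0 <= M * \prod_(w <- drop j1 s) dnorm m w by rewrite mulr_ge0// prod_dnorm_ge0.
have Sf := slice_app_stens bl Q0 BMs fst.
have Sg := slice_app_stens bl Q0 BMs gst.
have Sfg := slice_app_stens bl Q0 BMs fgst.
have -> : to_symt i1 (slice_app (fun z => ap B z (drop j1 s)) (a *: f + g : symt _)) =
  a *: to_symt i1 (slice_app (fun z => ap B z (drop j1 s)) f) +
  to_symt i1 (slice_app (fun z => ap B z (drop j1 s)) g).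
  apply: symtP => u; rewrite val_lin (to_symtE Sf) (to_symtE Sg) (to_symtE Sfg).
  have [ui|ui] := eqVneq (size u) i1; last first.
    rewrite (slice_app_off bl fst) ?(slice_app_off bl gst) ?(slice_app_off bl fgst)//; try exact/eqP.
    by rewrite mulr0 addr0.
  rewrite /slice_app -[_ * _]/(_ *: (_ : C^o)) -bl; congr (ap B _ _); apply: symtP => v.
  rewrite val_lin (to_symtE (slice_stens fst ui)) (to_symtE (slice_stens gst ui))
     (to_symtE (slice_stens fgst ui)); by [].
by rewrite ap_lin.
Qed.

Lemma odotE f : (ap (odot A B) f : forms) = symz (tensor_app (ap A) (ap B) f).
Proof.
have symst n (h : symt (i1 + i2)) : stens n (i1 + i2) h -> exists m,
    stens m (j1 + j2) (symz (tensor_app (ap A) (ap B) h)).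
  move=> hn; have [m [M [_ /(_ _ hn)[ti _]]]] := tensor_app_stens_bnd n.
  by exists m; split; [exact: inj_tens_symz|exact: symz_permsym].
have val (h : symt (i1 + i2)) :
    (to_symt (j1 + j2) (symz (tensor_app (ap A) (ap B) h)) : forms) =
    symz (tensor_app (ap A) (ap B) h).
  have [n hn] := symt_stens h; have [m H] := symst n h hn; exact: (to_symtE H).
rewrite /odot (_ : (fun f => _) = (fun f => to_symt (j1 + j2)
  (symz (tensor_app (ap A) (ap B) (symt_fun f)))))//.
rewrite to_homE ?val// => [a x y|n].
  by apply: symtP => s; rewrite val_lin !val tensor_app_lin symz_linear.
have [m [M [M0 tb]]] := tensor_app_stens_bnd n; exists m, M; split=> // h hn.
have hs := proj1 (stensP n h) hn; have [ti tc] := tb _ hs.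
split.
  apply/stensP; rewrite val; split; [exact: inj_tens_symz|exact: symz_permsym].
rewrite val; apply: inj_norm_le; first by rewrite mulr_ge0 ?inj_norm_ge0.
by apply/bnd_symz/tc; [exact: inj_norm_ge0|apply: bnd_inj_norm; case: hs].
Qed.

End Odot.

Lemma symz_nseq (f : forms) k w : symz f (nseq k w) = f (nseq k w).
Proof.
rewrite (@symz_perm _ _ f k) ?size_nseq//.
rewrite (eq_bigr (fun=> f (nseq k w))) => [|g _].
  by rewrite sumr_const cardT -cardE card_Sn -[f _ *+ _]mulr_natl mulrA mulVf ?mul1r.
congr (f _); apply: (@eq_from_nth _ 0); rewrite size_map_ord ?size_nseq// => i ik.
by rewrite (nth_map_ord (fun x => nth 0 (nseq k w) (g x)) (Ordinal ik)) !nth_nseq ltn_ord ik.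
Qed.

End Homs.

(** * Formal series tested on exponentials *)

Section Scalars.
Context (R : realType) (Phi : LBspace R).
Local Notation C := R[i].
Local Notation dual := (dual Phi).
Local Notation forms := (seq dual -> C^o).
Local Notation symt := (@symt R Phi).
Local Notation symHom := (@symHom R Phi).
Implicit Types (s u v : seq dual) (w : dual) (n k m i j : nat).

Lemma scalE z s : (scal Phi z : forms) s = if s is [::] then z else 0.
Proof.
suff st : stens 0 0 (fun s : seq dual => if s is [::] then z else 0) by rewrite (to_symtE st).
split; last first.
  by move=> [|w s'] [|w' s''] // /perm_size.
apply: alg_inj; exists 1%N, (fun=> z), (fun=> [::]); split=> //.
rewrite big_ord1; apply/funext => -[|w s'] /=.
  by rewrite !fctE /etens /= big_nil /GRing.scale /= mulr1.
by rewrite !fctE /etens /= scaler0.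
Qed.

Lemma valD k (f g : symt k) s : (f + g : symt k) s = f s + g s. Proof. by []. Qed.
Lemma valZ k z (f : symt k) s : (z *: f : symt k) s = z * f s. Proof. by []. Qed.
Lemma valN k (f : symt k) s : (- f : symt k) s = - f s. Proof. by []. Qed.

Lemma symt0P (f g : symt 0) : f [::] = g [::] -> f = g.
Proof. by move=> fg; apply: symt_dot_ext => w; exact: fg. Qed.

(** The functionals on a symmetric power for which slices are defined. *)
Definition bounded_functional k (b : symt k -> C^o) := linear b /\
  forall n, exists2 M, 0 <= M &
    forall h : symt k, step (c := symc Phi k) n h -> `|b h| <= M * inj_norm n k h.

(** A bounded functional is an operator with values in the power 0: scalars are
    tensors of degree 0 of any step. *)
Lemma fun_homE k (b : symt k -> C^o) : bounded_functional b -> forall f,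
  ap (to_hom (fun f => scal Phi (b f)) : symHom k 0) f = scal Phi (b f).
Proof.
move=> [bl bb] f; apply: to_homE => [a x y|n].
  by apply: symt0P; rewrite val_lin !scalE bl.
have [M M0 bM] := bb n; exists 0%N, M; split=> // h hn; split.
  apply/stensP; split; last exact: symt_permsym.
  apply: alg_inj; exists 1%N, (fun=> b h), (fun=> [::]); split=> //.
  rewrite big_ord1; apply/funext => -[|w s'] /=.
    by rewrite !fctE scalE /etens /= big_nil /GRing.scale /= mulr1.
  by rewrite !fctE scalE /etens /= scaler0.
apply: (le_trans _ (bM h hn)); apply: inj_norm_le => // -[|//] _.
by rewrite scalE big_nil mulr1.
Qed.

Lemma eval_functional k i (A : symHom k i) s : size s = i ->
  bounded_functional (fun h => ap A h s).
Proof.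
move=> si; split=> [a x y|n]; first by rewrite ap_lin.
have [m [M AM]] := ap_factor A n; exists (M * \prod_(w <- s) dnorm m w).
  by rewrite mulr_ge0 ?prod_dnorm_ge0//; case: AM.
exact: (bddmap_eval AM si).
Qed.

Lemma dot_functional k w : bounded_functional (@dot R Phi w k : symt k -> C^o).
Proof.
have := eval_functional (id_hom Phi k) (size_nseq k w).
by rewrite (_ : (fun h => _) = @dot R Phi w k)//; apply/funext => h; rewrite id_homE.
Qed.

(** The functional [b] is applied to the last variables: this is [1 (x) b] on tensors. *)
Definition partial_app m (b : symHom m 0) (f : forms) : forms :=
  slice_app (fun h => (ap b h [::] : C^o)) f.

Lemma partial_app_stens n k m (b : symHom m 0) f : stens n (k + m) f ->
  stens n k (partial_app b f).
Proof.
move=> fst; have [bl /(_ n)[M M0 bM]] := eval_functional b (erefl (size [::])).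
exact: (slice_app_stens bl M0 bM fst).
Qed.

Lemma partial_app_swap n k m (a : symHom k 0) (b : symHom m 0) f : stens n (k + m) f ->
  ap a (to_symt k (partial_app b f)) [::] = ap b (to_symt m (partial_app a f)) [::].
Proof.
move=> fst; have [bl /(_ n)[M M0 bM]] := eval_functional b (erefl (size [::])).
have [al /(_ n)[M' M'0 aM]] := eval_functional a (erefl (size [::])).
exact: (slice_app_swap al bl M'0 M0 aM bM fst).
Qed.

(** A copy of the type of series carrying the structure of a vector space. *)
Definition ser i : Type := series Phi i.

Section Ser.
Context (i : nat).
Implicit Types (a b c : ser i).

Lemma serP a b : (forall k, a k = b k) -> a = b.
Proof. exact: boolp.functional_extensionality_dep. Qed.

HB.instance Definition _ := gen_eqMixin (ser i).
HB.instance Definition _ := gen_choiceMixin (ser i).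

Let add a b : ser i := fun k => a k + b k.
Let opp a : ser i := fun k => - a k.

Let addA : associative add. Proof. by move=> a b c; apply: serP => k; exact: addrA. Qed.
Let addC : commutative add. Proof. by move=> a b; apply: serP => k; exact: addrC. Qed.
Let add0 : left_id (fun=> 0) add. Proof. by move=> a; apply: serP => k; exact: add0r. Qed.
Let addN : left_inverse (fun=> 0) opp add.
Proof. by move=> a; apply: serP => k; exact: addNr. Qed.

HB.instance Definition _ := GRing.isZmodule.Build (ser i) addA addC add0 addN.

Let scale (z : C) a : ser i := fun k => z *: a k.
Let scaleA x y a : scale x (scale y a) = scale (x * y) a.
Proof. by apply: serP => k; exact: scalerA. Qed.
Let scale1 : left_id 1 scale. Proof. by move=> a; apply: serP => k; exact: scale1r. Qed.
Let scaleDr : right_distributive scale +%R.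
Proof. by move=> z a b; apply: serP => k; exact: scalerDr. Qed.
Let scaleDl a : {morph scale^~ a : x y / x + y}.
Proof. by move=> x y; apply: serP => k; exact: scalerDl. Qed.

HB.instance Definition _ := GRing.Zmodule_isLmodule.Build C (ser i)
  scaleA scale1 scaleDr scaleDl.

Lemma ser0E k : (0 : ser i) k = 0. Proof. by []. Qed.
Lemma serDE a b k : (a + b) k = a k + b k. Proof. by []. Qed.
Lemma serNE a k : (- a) k = - a k. Proof. by []. Qed.
Lemma serZE z a k : (z *: a) k = z *: a k. Proof. by []. Qed.
Lemma ser_sumE I (r : seq I) (P : pred I) (F : I -> ser i) k :
  (\sum_(x <- r | P x) F x) k = \sum_(x <- r | P x) F x k.
Proof. by elim/big_rec2: _ => [//|x y z _ <-]. Qed.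

End Ser.

(** The scalar series are isolated in order to carry the structure of an algebra. *)
Definition sser : Type := ser 0.
HB.instance Definition _ := GRing.Lmodule.on sser.

Definition coef (a : sser) k (f : symt k) : C := ap (a k) f [::].

Lemma sserP (a b : sser) : (forall k f, coef a (k := k) f = coef b f) -> a = b.
Proof. by move=> ab; apply: serP => k; apply: symHomP => f; apply: symt0P; exact: ab. Qed.

Lemma coef_add (a b : sser) k (f : symt k) : coef (a + b) f = coef a f + coef b f.
Proof. rewrite /coef serDE apD; exact: valD. Qed.
Lemma coef_scale z (a : sser) k (f : symt k) : coef (z *: a) f = z * coef a f.
Proof. rewrite /coef serZE apZ; exact: valZ. Qed.
Lemma coef_opp (a : sser) k (f : symt k) : coef (- a) f = - coef a f.
Proof. rewrite /coef serNE apN; exact: valN. Qed.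
Lemma coef_zero k (f : symt k) : coef (0 : sser) f = 0.
Proof. by rewrite /coef ser0E ap0. Qed.
Lemma coef_lin (a : sser) k c (f g : symt k) :
  coef a (c *: f + g) = c * coef a f + coef a g.
Proof. by rewrite /coef ap_lin. Qed.

Lemma hom_cast_odot k l (A : symHom l 0) (B : symHom (k - l) 0) (f : symt k) :
  (l <= k)%N ->
  ap (hom_cast k 0 (odot A B)) f [::] = ap A (to_symt l (partial_app B f)) [::].
Proof.
move=> lk; rewrite (hom_castE _ _ (subnKC lk))// odotE.
rewrite -[[::]]/(nseq 0 0) symz_nseq /tensor_app /=.
have [n fst] := symt_stens f.
by rewrite (to_symtE (stens_cast (esym (subnKC lk)) fst)).
Qed.

(** The coefficients of a product without the symmetrization, which disappears in
    degree 0. *)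
Lemma coef_mulE (a b : sser) k (f : symt k) : coef (series_mul a b) f =
  \sum_(l < k.+1) coef a (to_symt l (partial_app (b (k - l)%N) f)).
Proof.
rewrite /coef /series_mul ap_sum val_sum; apply: eq_bigr => l _.
by apply: hom_cast_odot; rewrite -ltnS.
Qed.

(** The functionals that exponentials determine. They are closed under the operations of
    the algebra of series, which all act on finitely many coefficients. *)
Definition finite_functional (T : sser -> C) := exists N (g : forall l, symt l),
  forall a, T a = \sum_(l < N) coef a (g l).

Lemma ff_coef k (f : symt k) : finite_functional (fun a => coef a f).
Proof.
exists k.+1, (fun l => if l == k then to_symt l f else 0) => a.
rewrite big_ord_recr /= eqxx to_symtK big1 ?add0r// => l _.
by rewrite ifN ?/coef ?ap_f0// neq_ltn ltn_ord.
Qed.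

Lemma ff_widen T N (g : forall l, symt l) :
  (forall a, T a = \sum_(l < N) coef a (g l)) -> forall N', (N <= N')%N ->
  exists g' : forall l, symt l, forall a, T a = \sum_(l < N') coef a (g' l).
Proof.
move=> Tg N' NN; exists (fun l => if (l < N)%N then g l else 0) => a.
rewrite Tg (big_ord_widen N' (fun l => coef a (g l)) NN) big_mkcond.
by apply: eq_bigr => l _; case: ifP => //; rewrite /coef ap_f0.
Qed.

Lemma ff_lin c T T' : finite_functional T -> finite_functional T' ->
  finite_functional (fun a => c * T a + T' a).
Proof.
move=> [N [g Tg]] [N' [g' Tg']].
have [h Th] := ff_widen Tg (leq_maxl N N'); have [h' Th'] := ff_widen Tg' (leq_maxr N N').
exists (maxn N N'), (fun l => c *: h l + h' l) => a.
rewrite Th Th' mulr_sumr -big_split; apply: eq_bigr => l _.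
by rewrite coef_lin.
Qed.

Lemma ff0 : finite_functional (fun=> 0).
Proof. by exists 0%N, (fun=> 0) => a; rewrite big_ord0. Qed.

Lemma ff_ext T T' : (forall a, T a = T' a) -> finite_functional T -> finite_functional T'.
Proof. by move=> TT [N [g Tg]]; exists N, g => a; rewrite -TT. Qed.

Lemma ffZ c T : finite_functional T -> finite_functional (fun a => c * T a).
Proof. by move=> fT; apply: ff_ext (ff_lin c fT ff0) => a; rewrite addr0. Qed.

Lemma ff_sum I (r : seq I) (T : I -> sser -> C) : (forall x, finite_functional (T x)) ->
  finite_functional (fun a => \sum_(x <- r) T x a).
Proof.
move=> Tx; elim: r => [|x r IH].
  by apply: ff_ext ff0 => a; rewrite big_nil.
by apply: ff_ext (ff_lin 1 (Tx x) IH) => a; rewrite big_cons mul1r.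
Qed.

Definition finite_map (S : sser -> sser) := forall k (f : symt k),
  finite_functional (fun a => coef (S a) f).

Lemma ff_comp T S : finite_functional T -> finite_map S ->
  finite_functional (fun a => T (S a)).
Proof.
move=> [N [g Tg]] Sf; apply: (@ff_ext (fun a => \sum_(l < N) coef (S a) (g l))) => //.
by apply: ff_sum => l; exact: Sf.
Qed.

Lemma fm_comp S S' : finite_map S -> finite_map S' -> finite_map (fun a => S (S' a)).
Proof. by move=> Sf S'f k f; exact: ff_comp (Sf k f) S'f. Qed.

Lemma fm_id : finite_map id. Proof. exact: ff_coef. Qed.

Lemma fm_lin c S S' : finite_map S -> finite_map S' ->
  finite_map (fun a => c *: S a + S' a).
Proof.
move=> Sf S'f k f; apply: ff_ext (ff_lin c (Sf k f) (S'f k f)) => a.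
by rewrite coef_add coef_scale.
Qed.

(** The exponential of [w], that is the series [xi |-> exp<w, xi>]. It is locked, like the
    operations on series below, for conversion should not unfold the packed operators. *)
Fact sexp_key : unit. Proof. exact: tt. Qed.
Definition sexp : dual -> sser := locked_with sexp_key (fun w k =>
  (k`!%:R)^-1 *: to_hom (fun f => scal Phi (dot w f))).

Lemma coef_sexp w k (f : symt k) : coef (sexp w) f = (k`!%:R)^-1 * dot w f.
Proof.
rewrite /coef /sexp locked_withE apZ (fun_homE (dot_functional k w)) valZ.
by rewrite scalE.
Qed.

Lemma dot_scale (z : C) w k (f : symt k) : dot (z *: w) f = z ^+ k * dot w f.
Proof.
have := multilin_scale [::] (nseq k w) (fun=> z) (symt_multilin f).
rewrite /= map_nseq => E; rewrite /dot E; congr (_ * _).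
by rewrite big_nseq iter_mulr_1.
Qed.

Lemma fact_neq0 k : (k`!%:R : C) != 0.
Proof. by rewrite pnatr_eq0 -lt0n fact_gt0. Qed.

(** Rescaling [w] separates the homogeneous parts. *)
Lemma sum_dot_eq0 N (g : forall l, symt l) :
  (forall w, \sum_(l < N) dot w (g l) = 0) -> forall l, (l < N)%N -> g l = 0.
Proof.
move=> g0 l lN; apply: symt_dot_ext => w; rewrite dot0.
pose c l := dot w (g l).
apply: (@poly_fun_eq0 R N c) => // z; rewrite -[RHS](g0 (z *: w)).
by apply: eq_bigr => j _; rewrite dot_scale mulrC.
Qed.

(** Exponentials detect finite functionals: on [e^w] such a functional is a polynomial in [w],
    whose homogeneous parts are symmetric tensors on the diagonal. *)
Lemma ff_sexp_eq0 T : finite_functional T -> (forall w, T (sexp w) = 0) ->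
  forall a, T a = 0.
Proof.
move=> [N [g Tg]] T0 a; rewrite Tg big1// => l _.
have H w : \sum_(l < N) dot w ((l`!%:R)^-1 *: g l : symt l) = 0.
  by rewrite -[RHS](T0 w) Tg; apply: eq_bigr => j _; rewrite coef_sexp.
have := sum_dot_eq0 (g := fun l => (l`!%:R)^-1 *: g l) H (ltn_ord l).
move=> /eqP; rewrite scaler_eq0 invr_eq0 (negbTE (fact_neq0 _)) /= => /eqP ->.
by rewrite /coef ap_f0.
Qed.

Lemma fm_sexp_eq S S' : finite_map S -> finite_map S' ->
  (forall w, S (sexp w) = S' (sexp w)) -> forall a, S a = S' a.
Proof.
move=> Sf S'f SS a; apply: sserP => k f; apply/eqP; rewrite -subr_eq0; apply/eqP.
have T0 : finite_functional (fun a => coef (S a) f - coef (S' a) f).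
  by apply: ff_ext (ff_lin (-1) (S'f k f) (Sf k f)) => b; rewrite mulN1r addrC.
by apply: (ff_sexp_eq0 T0) => w; rewrite SS subrr.
Qed.

End Scalars.

(** * The ring of scalar series *)

Section Ring.
Context (R : realType) (Phi : LBspace R).
Local Notation C := R[i].
Local Notation dual := (dual Phi).
Local Notation forms := (seq dual -> C^o).
Local Notation symt := (@symt R Phi).
Local Notation symHom := (@symHom R Phi).
Local Notation sser := (sser Phi).
Local Notation sexp := (@sexp R Phi).
Implicit Types (s u v : seq dual) (w : dual) (n k m i j : nat).

Fact smul_key : unit. Proof. exact: tt. Qed.

Definition smul : sser -> sser -> sser := locked_with smul_key (@series_mul R Phi).

Lemma smul_unlock (a b : sser) : smul a b = series_mul a b.
Proof. by rewrite /smul locked_withE. Qed.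

Lemma coef_smul (a b : sser) k (f : symt k) : coef (smul a b) f =
  \sum_(l < k.+1) coef a (to_symt l (partial_app (b (k - l)%N) f)).
Proof. by rewrite smul_unlock coef_mulE. Qed.

(** Commutativity is the Fubini property of slices. *)
Lemma smulC : commutative smul.
Proof.
move=> a b; apply: sserP => k f; rewrite !coef_smul (reindex_inj rev_ord_inj) /=.
apply: eq_bigr => l _; have lk : (l <= k)%N by rewrite -ltnS.
rewrite subSS subKn//.
have [n fst] := symt_stens f.
by apply: (@partial_app_swap _ _ n); rewrite subnK.
Qed.

Lemma coef_to_symtD (a : sser) k (f g h : forms) n : stens n k f -> stens n k g ->
  stens n k h -> (forall s, h s = f s + g s) ->
  coef a (to_symt k h) = coef a (to_symt k f) + coef a (to_symt k g).
Proof.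
move=> fst gst hst hE; rewrite -[X in _ = X + _]mul1r -coef_lin; congr (coef a _).
by apply: symtP => s; rewrite val_lin mul1r !(to_symtE (n := n))// hE.
Qed.

Lemma smulDl : left_distributive smul +%R.
Proof.
move=> a b c; apply: sserP => k f; rewrite coef_add !coef_smul -big_split.
by apply: eq_bigr => l _; rewrite coef_add.
Qed.

Lemma smulZl z (a b : sser) : smul (z *: a) b = z *: smul a b.
Proof.
apply: sserP => k f; rewrite coef_scale !coef_smul mulr_sumr.
by apply: eq_bigr => l _; rewrite coef_scale.
Qed.

Lemma slice0 (f : forms) : slice [::] f = f. Proof. by []. Qed.

Lemma coef_one k (f : symt k) :
  coef (series_one Phi : sser) f = if k is 0%N then f [::] else 0.
Proof. by rewrite /coef; case: k f => [|k] f //=; rewrite id_homE. Qed.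

Lemma smul1 : left_id (series_one Phi : sser) smul.
Proof.
move=> b; apply: sserP => k f; rewrite coef_smul big_ord_recl coef_one /= big1 ?addr0.
  have [n fst] := symt_stens f.
  have pst : stens n 0 (partial_app (b (k - 0)%N) f) by apply: partial_app_stens; rewrite subn0.
  rewrite (to_symtE pst) /partial_app /slice_app slice0.
  by rewrite subn0 to_symtK.
by move=> l _; rewrite coef_one.
Qed.

Lemma fm_mulr (b : sser) : finite_map (fun a => smul a b).
Proof.
move=> k f; apply: (@ff_ext _ _ (fun a => \sum_(l < k.+1)
  coef a (to_symt l (partial_app (b (k - l)%N) f)))).
  by move=> a; rewrite coef_smul.
by apply: ff_sum => l; exact: ff_coef.
Qed.

Lemma fm_mull (a : sser) : finite_map (smul a).
Proof. by move=> k f; apply: ff_ext (fm_mulr a f) => b; rewrite smulC. Qed.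

Lemma coef_sexp_to_symt n k w (f : forms) : stens n k f ->
  coef (sexp w) (to_symt k f) = (k`!%:R)^-1 * f (nseq k w).
Proof. by move=> fst; rewrite coef_sexp /dot (to_symtE fst). Qed.

Lemma sexpD w w' : smul (sexp w) (sexp w') = sexp (w + w').
Proof.
apply: sserP => k f.
rewrite coef_smul [RHS]coef_sexp [in RHS]/dot.
have := multilin_binom [::] w w' 1 k (symt_multilin f) (symt_permsym f).
rewrite scale1r /= => ->; rewrite mulr_sumr; apply: eq_bigr => l _.
have lk : (l <= k)%N by rewrite -ltnS.
have [n fst] := symt_stens f.
have fst' : stens n (l + (k - l)) f by rewrite subnKC.
rewrite (coef_sexp_to_symt _ (partial_app_stens _ fst')) /partial_app /slice_app.
have sst := slice_stens fst' (size_nseq l w).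
have := coef_sexp_to_symt w' sst; rewrite /coef => ->.
rewrite /slice expr1n mulr1 !mulrA; congr (_ * _).
rewrite -(bin_fact lk) !natrM; field.
by rewrite !fact_neq0 pnatr_eq0 -lt0n bin_gt0 lk.
Qed.

(** Both sides are finite maps in each argument, so it suffices to compare them on
    exponentials, where associativity is that of addition. *)
Lemma smulA : associative smul.
Proof.
move=> a b c; move: a; apply: fm_sexp_eq => [||w].
- exact: fm_mulr.
- exact: fm_comp (fm_mulr _) (fm_mulr _).
move: b; apply: fm_sexp_eq => [||w'].
- exact: fm_comp (fm_mull _) (fm_mulr _).
- exact: fm_comp (fm_mulr _) (fm_mull _).
move: c; apply: fm_sexp_eq => [||w''].
- exact: fm_comp (fm_mull _) (fm_mull _).
- exact: fm_mull.
by rewrite !sexpD addrA.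
Qed.

Lemma sone_neq0 : (series_one Phi : sser) != 0.
Proof.
apply/eqP => H; have := coef_one (scal Phi 1); rewrite H coef_zero scalE.
by move=> /esym/eqP; rewrite oner_eq0.
Qed.

HB.instance Definition _ := GRing.Zmodule_isComNzRing.Build sser
  smulA smulC smul1 smulDl sone_neq0.

Lemma smulE (a b : sser) : series_mul a b = a * b. Proof. by rewrite -smul_unlock. Qed.
Lemma soneE : series_one Phi = 1 :> sser. Proof. by []. Qed.

Lemma coef_mul (a b : sser) k (f : symt k) : coef (a * b) f =
  \sum_(l < k.+1) coef a (to_symt l (partial_app (b (k - l)%N) f)).
Proof. exact: coef_smul. Qed.

Lemma sserZl z (a b : sser) : (z *: a) * b = z *: (a * b).
Proof. exact: smulZl. Qed.

Lemma sserZr z (a b : sser) : a * (z *: b) = z *: (a * b).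
Proof. by rewrite mulrC sserZl mulrC. Qed.

Lemma sexpM w w' : sexp w * sexp w' = sexp (w + w').
Proof. exact: sexpD. Qed.

Definition eq_below (N : nat) i (a b : ser Phi i) := forall k, (k < N)%N -> a k = b k.

Lemma eq_below_mul N (a a' b b' : sser) : eq_below N a a' -> eq_below N b b' ->
  eq_below N (a * b) (a' * b').
Proof.
move=> aa bb k kN; rewrite -!smulE /series_mul; apply: eq_bigr => l _.
have lk : (l <= k)%N by rewrite -ltnS.
rewrite aa ?bb//; first exact: leq_ltn_trans (leq_subr _ _) kN.
exact: leq_ltn_trans lk kN.
Qed.

Lemma coef_partial0 l k (a b : sser) (f : symt k) : b (k - l)%N = 0 ->
  coef a (to_symt l (partial_app (b (k - l)%N) f)) = 0.
Proof.
move=> ->; rewrite (_ : to_symt l _ = 0) ?/coef ?ap_f0//.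
have -> : partial_app (0 : symHom (k - l) 0) f = 0 by apply/funext => u.
by apply: symtP => s; rewrite /to_symt /= insubdK//; apply: rpred0.
Qed.

Lemma order_mul n m (a b : sser) : eq_below n a 0 -> eq_below m b 0 ->
  eq_below (n + m) (a * b) 0.
Proof.
move=> a0 b0 k knm; apply: symHomP => f; apply: symt0P.
rewrite -/(coef (a * b) f) coef_mul big1// => l _.
have [ln|nl] := ltnP l n; first by rewrite /coef a0.
apply: coef_partial0; apply: b0; rewrite ltn_subLR; last by rewrite -ltnS.
by rewrite (leq_trans knm)// leq_add2r.
Qed.

Lemma order_exp n (a : sser) : a 0%N = 0 -> eq_below n (a ^+ n) 0.
Proof.
move=> a0; elim: n => [|n IH]; first by move=> k.
rewrite exprS -add1n; apply: order_mul => // k.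
by rewrite ltnS leqn0 => /eqP ->.
Qed.

Lemma series_expE (a : sser) k :
  (series_exp a) k = \sum_(n < k.+1) (n`!%:R)^-1 *: (a ^+ n) k.
Proof.
rewrite /series_exp; apply: eq_bigr => n _; congr (_ *: _).
suff -> : iter n (series_mul a) (series_one Phi) = a ^+ n :> sser by [].
by elim: (nat_of_ord n) => [|j IH] //=; rewrite exprS -IH smulE.
Qed.

End Ring.

(** * Derivations by vector fields *)

Section Derivation.
Context (R : realType) (Phi : LBspace R).
Local Notation C := R[i].
Local Notation dual := (dual Phi).
Local Notation forms := (seq dual -> C^o).
Local Notation symt := (@symt R Phi).
Local Notation symHom := (@symHom R Phi).
Local Notation sser := (sser Phi).
Local Notation ser := (ser Phi).
Local Notation sexp := (@sexp R Phi).
Implicit Types (s u v : seq dual) (w : dual) (n k m i j : nat).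

Fact sdot_key : unit. Proof. exact: tt. Qed.
Definition sdot : dual -> ser 1 -> sser := locked_with sdot_key (@series_dot R Phi).

Lemma sdotE w (b : ser 1) : series_dot w b = sdot w b.
Proof. by rewrite /sdot locked_withE. Qed.

Lemma coef_sdot w (b : ser 1) k (f : symt k) : coef (sdot w b) f = dot w (ap (b k) f).
Proof.
rewrite -sdotE /coef /series_dot fun_homE ?scalE//.
exact: (eval_functional (b k) (size_nseq 1 w)).
Qed.

Lemma sdotD w (b b' : ser 1) : sdot w (b + b') = sdot w b + sdot w b'.
Proof. by apply: sserP => k f; rewrite coef_add !coef_sdot serDE apD dotD. Qed.

Lemma sdotZ w z (b : ser 1) : sdot w (z *: b) = z *: sdot w b.
Proof. by apply: sserP => k f; rewrite coef_scale !coef_sdot serZE apZ dotZ. Qed.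

Lemma sdotDl w w' (b : ser 1) : sdot (w + w') b = sdot w b + sdot w' b.
Proof.
apply: sserP => k f; rewrite coef_add !coef_sdot !dot_degree1.
have [_ /(_ [::] 1 w w' [::])] := symt_multilin (ap (b k) f).
by rewrite scale1r mul1r.
Qed.

(** The pairings with [w] reduce Phi-valued series to scalar ones. *)
Lemma serP1 (b b' : ser 1) : (forall w, sdot w b = sdot w b') -> b = b'.
Proof.
move=> bb; apply: serP => k; apply: symHom_dotP => w f.
by rewrite -!coef_sdot bb.
Qed.

(** The operator [1_(l-1) . b] through which [D_b] acts on the coefficients of degree [l]. *)
Definition theta (b : ser 1) k l : symHom k l :=
  hom_cast k l (odot (id_hom Phi l.-1) (b (k - l).+1)).

Lemma dot_theta (b : ser 1) k l w (f : symt k) : (0 < l <= k)%N ->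
  dot w (ap (theta b k l) f) =
  dot w (ap (b (k - l).+1) (to_symt (k - l).+1 (slice (nseq l.-1 w) f))).
Proof.
move=> /andP[l0 lk].
have ek : (l.-1 + (k - l).+1)%N = k by rewrite addnS -addSn prednK// subnKC.
have el : (l.-1 + 1)%N = l by rewrite addn1 prednK.
rewrite {1}/dot /theta (hom_castE _ _ ek el) odotE symz_nseq /tensor_app.
have -> : nseq l w = nseq l.-1 w ++ [:: w].
  by rewrite -{1}el nseqD.
rewrite take_size_cat ?size_nseq// drop_size_cat ?size_nseq//.
have [n fst] := symt_stens f; have fst' := stens_cast (esym ek) fst.
rewrite (to_symtE fst').
have [bl /(_ n)[M M0 bM]] := eval_functional (b (k - l).+1) (erefl (size [:: w])).
have sst := slice_app_stens bl M0 bM fst'.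
by rewrite id_homE (to_symtE sst).
Qed.

Fact sderiv_key : unit. Proof. exact: tt. Qed.
Definition sderiv : forall i, ser 1 -> ser i -> ser i :=
  locked_with sderiv_key (@series_deriv R Phi).

Lemma sderivE i (b : ser 1) (a : ser i) : series_deriv b a = sderiv b a.
Proof. by rewrite /sderiv locked_withE. Qed.

Lemma ap_sderiv i (b : ser 1) (a : ser i) k (f : symt k) : ap (sderiv b a k) f =
  \sum_(i <= l < k.+1) l%:R *: ap (a l) (ap (theta b k l) f).
Proof.
rewrite -sderivE /series_deriv ap_sum; apply: eq_bigr => l _.
by rewrite apZ hom_compE.
Qed.

(** [D_b] on scalar series, where it is a derivation. *)
Definition sD (b : ser 1) (a : sser) : sser := sderiv b a.

Lemma coef_sD (b : ser 1) (a : sser) k (f : symt k) : coef (sD b a) f =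
  \sum_(l < k.+1) l%:R * coef a (ap (theta b k l) f).
Proof. by rewrite /coef ap_sderiv val_sum big_mkord. Qed.

Lemma sderiv_lin i (b : ser 1) c (a a' : ser i) :
  sderiv b (c *: a + a') = c *: sderiv b a + sderiv b a'.
Proof.
apply: serP => k; apply: symHomP => f; rewrite serDE serZE apD apZ !ap_sderiv.
rewrite scaler_sumr -big_split; apply: eq_bigr => l _.
by rewrite serDE serZE apD apZ scalerDr !scalerA mulrC.
Qed.

Lemma sdot_sderiv w (b b' : ser 1) : sdot w (sderiv b b') = sD b (sdot w b').
Proof.
apply: sserP => k f; rewrite coef_sdot coef_sD ap_sderiv dot_sum.
rewrite -[RHS](big_mkord xpredT (fun l => l%:R * coef (sdot w b') (ap (theta b k l) f))).
rewrite [RHS]big_ltn// mul0r add0r.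
by apply: eq_bigr => l _; rewrite dotZ coef_sdot.
Qed.

Lemma fm_sD (b : ser 1) : finite_map (sD b).
Proof.
move=> k f; apply: (@ff_ext _ _ (fun a => \sum_(l < k.+1) l%:R * coef a (ap (theta b k l) f))).
  by move=> a; rewrite coef_sD.
by apply: ff_sum => l; apply: ffZ; exact: ff_coef.
Qed.

Lemma coef_castm (a : sser) m m' (f : forms) : m = m' ->
  coef a (to_symt m f) = coef a (to_symt m' f).
Proof. by move->. Qed.

Lemma sD_sexp (b : ser 1) w : b 0%N = 0 ->
  sD b (sexp w) = sexp w * sdot w b.
Proof.
move=> b0; apply: sserP => k f; rewrite coef_sD coef_mul.
rewrite big_ord_recl mul0r add0r [RHS]big_ord_recr /=.
rewrite [X in _ + X]coef_partial0 ?addr0; last first.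
  by rewrite subnn; apply: symHomP => g; apply: symt0P; rewrite -/(coef (sdot w b) g) coef_sdot b0.
apply: eq_bigr => l _; rewrite /bump leq0n add1n coef_sexp.
have lk : (0 < l.+1 <= k)%N by rewrite ltn_ord.
rewrite (dot_theta _ _ _ lk) /=.
have [n fst] := symt_stens f.
have fst' : stens n (l + (k - l)) f by rewrite subnKC// ltnW// ltn_ord.
rewrite (coef_sexp_to_symt _ (partial_app_stens _ fst')).
rewrite /partial_app /slice_app -/(coef (sdot w b) _) coef_sdot.
rewrite mulrA factS natrM invfM mulrA mulfV ?mul1r ?pnatr_eq0//.
by rewrite subnSK.
Qed.

Lemma sD_lin (b : ser 1) c (a a' : sser) : sD b (c *: a + a') = c *: sD b a + sD b a'.
Proof. exact: sderiv_lin. Qed.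

Lemma sDD (b : ser 1) (a a' : sser) : sD b (a + a') = sD b a + sD b a'.
Proof. by have := sD_lin b 1 a a'; rewrite !scale1r. Qed.

(** Both sides are bilinear, so exponentials decide:
    [D_b e^(w + w') = e^(w + w') <w + w', b>]. *)
Lemma sDM (b : ser 1) (a a' : sser) : b 0%N = 0 ->
  sD b (a * a') = sD b a * a' + a * sD b a'.
Proof.
move=> b0.
have mr (x : sser) : finite_map (fun a => a * x) by exact: fm_mulr.
have ml (x : sser) : finite_map (fun a => x * a) by exact: fm_mull.
have fD (S S' : sser -> sser) : finite_map S -> finite_map S' -> finite_map (fun a => S a + S' a).
  by move=> Sf S'f k f; apply: ff_ext (fm_lin 1 Sf S'f (k := k) f) => x; rewrite scale1r.
move: a; apply: fm_sexp_eq => [||w].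
- exact: fm_comp (fm_sD b) (mr _).
- by apply: fD (mr _); exact: fm_comp (mr _) (fm_sD b).
move: a'; apply: fm_sexp_eq => [||w'].
- exact: fm_comp (fm_sD b) (ml _).
- by apply: fD (ml _) _; exact: fm_comp (ml _) (fm_sD b).
rewrite sexpM !sD_sexp// sdotDl -sexpM.
ring.
Qed.

Lemma sD1 (b : ser 1) : b 0%N = 0 -> sD b 1 = 0.
Proof.
move=> b0; have /eqP := sDM 1 1 b0; rewrite !mulr1 mul1r.
by rewrite -subr_eq subrr eq_sym => /eqP.
Qed.

Lemma sderiv_order i (b : ser 1) (a : ser i) n : b 1%N = 0 ->
  eq_below n a 0 -> eq_below n.+1 (sderiv b a) 0.
Proof.
move=> b1 a0 k kn; apply: symHomP => f; rewrite ap_sderiv ap0.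
rewrite big_nat_cond big1// => l /andP[/andP[_ lk] _].
have [->|l0] := posnP l; first by rewrite scale0r.
have [ln|nl] := ltnP l n; first by rewrite a0// ap0 scaler0.
have ekl : k = l.
  by apply/eqP; rewrite eqn_leq -[(l <= k)%N]ltnS lk andbT -ltnS (leq_trans kn).
subst k; rewrite (_ : ap (theta b l l) f = 0) ?ap_f0 ?scaler0//.
apply: symt_dot_ext => w; rewrite dot_theta ?l0 ?leqnn//.
by rewrite dot0 subnn b1 ap0 dot0.
Qed.

End Derivation.

(** * Exponentials of vector fields *)

Section Triangle.

Lemma sum_triangle (V : nmodType) (F : nat -> nat -> V) N :
  (forall n m, (N <= n + m)%N -> F n m = 0) ->
  \sum_(n < N) \sum_(m < N) F n m = \sum_(j < N) \sum_(n < j.+1) F n (j - n)%N.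
Proof.
move=> F0.
have -> : \sum_(j < N) \sum_(n < j.+1) F n (j - n)%N =
    \sum_(j < N) \sum_(n < N) if (n < j.+1)%N then F n (j - n)%N else 0.
  apply: eq_bigr => j _.
  by rewrite (big_ord_widen N (fun n => F n (j - n)%N) (ltn_ord j)) big_mkcond.
rewrite [RHS]exchange_big; apply: eq_bigr => n _ /=.
transitivity (\sum_(0 <= m < N) F n m); first by rewrite big_mkord.
transitivity (\sum_(0 <= j < N) if (n < j.+1)%N then F n (j - n)%N else 0); last first.
  by rewrite big_mkord.
have nN : (n <= N)%N by exact: ltnW (ltn_ord n).
rewrite [RHS](big_cat_nat (n := n))//= [X in _ = X + _]big_nat_cond.
rewrite [X in _ = X + _]big1 ?add0r => [|j /andP[/andP[_ jn] _]]; last first.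
  by rewrite ltnS leqNgt jn.
rewrite -{2}[nat_of_ord n]add0n big_addn.
rewrite (big_cat_nat (n := (N - n)%N)) ?leq_subr//=.
rewrite [X in _ + X]big_nat_cond [X in _ + X]big1 ?addr0 => [|m /andP[/andP[Nm _] _]].
  by apply: eq_bigr => m _; rewrite ltnS leq_addl addnK.
by apply: F0; rewrite -leq_subLR.
Qed.

End Triangle.

Section LocalExp.
Context (R : realType) (Phi : LBspace R).
Local Notation C := R[i].
Local Notation dual := (dual Phi).
Local Notation forms := (seq dual -> C^o).
Local Notation symt := (@symt R Phi).
Local Notation symHom := (@symHom R Phi).
Local Notation sser := (sser Phi).
Local Notation ser := (ser Phi).
Local Notation sexp := (@sexp R Phi).
Implicit Types (s u v : seq dual) (w : dual) (n k m i j : nat).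

(** Such operators have an exponential, computed by finite sums in each degree. *)
Definition raising i (S : ser i -> ser i) :=
  (forall c a a', S (c *: a + a') = c *: S a + S a') /\
  (forall n a, eq_below n a 0 -> eq_below n.+1 (S a) 0).

Definition lexp i (S : ser i -> ser i) (t : C) (a : ser i) : ser i := fun k =>
  \sum_(n < k.+1) (t ^+ n / n`!%:R) *: (iter n S a) k.

Section Raising.
Context (i : nat) (S : ser i -> ser i).
Hypothesis Sr : raising S.

Lemma raising0 : S 0 = 0.
Proof. by have [Sl _] := Sr; have := Sl (-1) 0 0; rewrite scaler0 addr0 scaleN1r addNr. Qed.

Lemma iter_lin n c a a' : iter n S (c *: a + a') = c *: iter n S a + iter n S a'.
Proof. by have [Sl _] := Sr; elim: n => //= n ->. Qed.

Lemma iter0 n : iter n S 0 = 0.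
Proof. by elim: n => //= n ->; exact: raising0. Qed.

Lemma iterZ n c a : iter n S (c *: a) = c *: iter n S a.
Proof. by have := iter_lin n c a 0; rewrite !addr0 iter0 addr0. Qed.

Lemma iterB n a a' : iter n S (a - a') = iter n S a - iter n S a'.
Proof. by have := iter_lin n (-1) a' a; rewrite !scaleN1r addrC [- _ + _]addrC. Qed.

Lemma iter_sum n I (r : seq I) (F : I -> ser i) :
  iter n S (\sum_(x <- r) F x) = \sum_(x <- r) iter n S (F x).
Proof.
elim: r => [|x r IH]; first by rewrite !big_nil iter0.
by rewrite !big_cons -IH; have := iter_lin n 1 (F x) (\sum_(j <- r) F j); rewrite !scale1r.
Qed.

Lemma iter_order n m a : eq_below m a 0 -> eq_below (n + m) (iter n S a) 0.
Proof. by have [_ So] := Sr => am; elim: n => //= n IH; apply: So. Qed.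

Lemma iter_order0 n a : eq_below n (iter n S a) 0.
Proof. by rewrite -{1}[n]addn0; apply: iter_order => k. Qed.

Lemma iter_below n N a a' : eq_below N a a' -> eq_below N (iter n S a) (iter n S a').
Proof.
move=> aa k kN; apply/eqP; rewrite -subr_eq0 -serNE -serDE -iterB; apply/eqP.
apply: (@iter_order n N) => [j jN|]; last by rewrite ltn_addl.
by rewrite serDE serNE aa// subrr.
Qed.

Lemma lexp_widen t a k N : (k < N)%N ->
  lexp S t a k = \sum_(n < N) (t ^+ n / n`!%:R) *: (iter n S a) k.
Proof.
move=> kN; rewrite /lexp.
rewrite (big_ord_widen N (fun n => (t ^+ n / n`!%:R) *: (iter n S a) k) kN) big_mkcond.
apply: eq_bigr => n _; case: ltnP => // kn.
by rewrite (iter_order0 a kn) ser0E scaler0.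
Qed.

Lemma lexp_trunc t a N :
  eq_below N (lexp S t a) (\sum_(n < N) (t ^+ n / n`!%:R) *: iter n S a).
Proof.
move=> k kN; rewrite (lexp_widen _ _ kN) ser_sumE.
by apply: eq_bigr => n _; rewrite serZE.
Qed.

Lemma lexp_below t N a a' : eq_below N a a' -> eq_below N (lexp S t a) (lexp S t a').
Proof.
move=> aa k kN; rewrite /lexp; apply: eq_bigr => n _; congr (_ *: _).
exact: (iter_below _ aa).
Qed.

Lemma lexp_lin t c a a' : lexp S t (c *: a + a') = c *: lexp S t a + lexp S t a'.
Proof.
apply: serP => k; rewrite serDE serZE /lexp scaler_sumr -big_split; apply: eq_bigr => n _.
by rewrite iter_lin serDE serZE scalerDr !scalerA mulrC.
Qed.

Lemma exp_binom (s t : C) j : (s + t) ^+ j / j`!%:R =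
  \sum_(n < j.+1) (s ^+ n / n`!%:R) * (t ^+ (j - n) / (j - n)`!%:R).
Proof.
rewrite addrC exprDn mulr_suml; apply: eq_bigr => n _.
have nj : (n <= j)%N by rewrite -ltnS.
rewrite -mulr_natr -(bin_fact nj) !natrM; field.
by rewrite !fact_neq0 pnatr_eq0 -lt0n bin_gt0 nj.
Qed.

Lemma lexp_add (s t : C) a : lexp S s (lexp S t a) = lexp S (s + t) a.
Proof.
apply: serP => k; rewrite {1}/lexp.
transitivity (\sum_(n < k.+1) \sum_(m < k.+1)
   ((s ^+ n / n`!%:R) * (t ^+ m / m`!%:R)) *: iter (n + m) S a k).
  apply: eq_bigr => n _; rewrite (iter_below n (lexp_trunc t a (N := k.+1)))//.
  rewrite iter_sum ser_sumE scaler_sumr; apply: eq_bigr => m _.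
  by rewrite iterZ serZE scalerA iterD.
rewrite (@sum_triangle _ (fun n m => ((s ^+ n / n`!%:R) * (t ^+ m / m`!%:R)) *: iter (n + m) S a k)).
  rewrite /lexp; apply: eq_bigr => j _; rewrite exp_binom scaler_suml.
  by apply: eq_bigr => n _; rewrite subnKC// -ltnS.
by move=> n m km; rewrite (iter_order0 a km) ser0E scaler0.
Qed.

Lemma lexp0 a : lexp S 0 a = a.
Proof.
apply: serP => k; rewrite /lexp big_ord_recl /= expr0 fact0 divr1 scale1r.
by rewrite big1 ?addr0// => n _; rewrite /bump leq0n add1n exprS mul0r mul0r scale0r.
Qed.

End Raising.

Section Flow.
Context (al : sser) (be : ser 1).
Hypotheses (al0 : al 0%N = 0) (be0 : be 0%N = 0) (be1 : be 1%N = 0).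

(** The first-order operator of the vector field [be] with potential [al]: the generator of
    [a |-> a(B_t) A_t]. *)
Definition sL (a : sser) : sser := sD be a + al * a.

Lemma raising_sderiv i : raising (sderiv be : ser i -> ser i).
Proof. by split=> [c a a'|n a]; [exact: sderiv_lin|exact: sderiv_order]. Qed.

Lemma raising_sD : raising (sD be : ser 0 -> ser 0).
Proof. exact: raising_sderiv. Qed.

Lemma raising_sL : raising (sL : ser 0 -> ser 0).
Proof.
split=> [c a a'|n a an].
  rewrite /sL sD_lin mulrDr sserZr scalerDr addrACA//.
move=> k kn; rewrite /sL serDE ser0E.
have [_ /(_ _ _ an k kn) ->] := raising_sD.
have al1 : eq_below 1 al 0 by move=> j; rewrite ltnS leqn0 => /eqP ->.
by have /(_ k kn) -> := order_mul al1 an; rewrite ser0E addr0.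
Qed.

Lemma sL_leibniz n (a b : sser) : iter n sL (a * b) =
  \sum_(j < n.+1) 'C(n, j)%:R *: (iter (n - j) sL a * iter j (sD be) b) :> sser.
Proof.
have sLM x y : sL (x * y) = sL x * y + x * sD be y :> sser.
  rewrite /sL sDM//; ring.
have [sLl _] := raising_sL.
have sLsum I (r : seq I) (F : I -> sser) (c : I -> C) :
    sL (\sum_(x <- r) c x *: F x) = \sum_(x <- r) c x *: sL (F x) :> sser.
  elim: r => [|x r IH]; first by rewrite !big_nil; exact: (raising0 raising_sL).
  by rewrite !big_cons -IH; exact: sLl.
elim: n => [|n IH]; first by rewrite big_ord1 bin0 scale1r.
rewrite iterS IH sLsum.
under eq_bigr => j _ do rewrite sLM scalerDr.
rewrite big_split /= [RHS]big_ord_recl bin0 scale1r subn0 /=.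
rewrite [X in X + _ = _]big_ord_recl bin0 scale1r subn0 /= -addrA; congr (_ + _).
rewrite [X in _ = X](_ : _ = \sum_(j < n.+1)
   ('C(n, j.+1)%:R *: (iter (n - j) sL a * iter j.+1 (sD be) b) +
    'C(n, j)%:R *: (iter (n - j) sL a * iter j.+1 (sD be) b))); last first.
  by apply: eq_bigr => j _; rewrite /bump leq0n add1n subSS binS natrD scalerDl.
rewrite big_split /=; congr (_ + _).
rewrite [RHS]big_ord_recr /= bin_small// scale0r addr0; apply: eq_bigr => j _.
by rewrite /bump leq0n add1n -(subnSK (ltn_ord j)).
Qed.

(** The Leibniz rule exponentiates: [L (a b) = L a * b + a * D_be b]. *)
Lemma lexp_mul t (a b : sser) :
  lexp sL t (a * b) = (lexp sL t a : sser) * (lexp (sD be) t b : sser) :> sser.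
Proof.
apply: serP => k.
pose SA : sser := \sum_(n < k.+1) (t ^+ n / n`!%:R) *: (iter n sL a : sser).
pose SB : sser := \sum_(n < k.+1) (t ^+ n / n`!%:R) *: (iter n (sD be) b : sser).
have EA : eq_below k.+1 (lexp sL t a) SA by exact: (lexp_trunc raising_sL t a (N := k.+1)).
have EB : eq_below k.+1 (lexp (sD be) t b) SB by exact: (lexp_trunc raising_sD t b (N := k.+1)).
rewrite (eq_below_mul EA EB)// /SA mulr_suml ser_sumE.
transitivity (\sum_(n < k.+1) \sum_(m < k.+1)
   ((t ^+ n / n`!%:R) * (t ^+ m / m`!%:R)) *:
   ((iter n sL a : sser) * (iter m (sD be) b : sser)) k); last first.
  apply: eq_bigr => n _; rewrite /SB mulr_sumr ser_sumE; apply: eq_bigr => m _.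
  by rewrite sserZl sserZr scalerA serZE.
rewrite (@sum_triangle _ (fun n m => ((t ^+ n / n`!%:R) * (t ^+ m / m`!%:R)) *:
   ((iter n sL a : sser) * (iter m (sD be) b : sser)) k)); last first.
  move=> n m km.
  have /(_ k km) -> := order_mul (iter_order0 raising_sL (n := n) a)
    (iter_order0 raising_sD (n := m) b).
  by rewrite ser0E scaler0.
rewrite /lexp; apply: eq_bigr => j _; rewrite sL_leibniz ser_sumE scaler_sumr.
rewrite (reindex_inj rev_ord_inj) /=; apply: eq_bigr => n _.
have nj : (n <= j)%N by rewrite -ltnS.
rewrite subSS subKn// serZE scalerA; congr (_ *: _).
rewrite -{1}(subnKC nj) exprD bin_sub// -(bin_fact nj) !natrM; field.
by rewrite !fact_neq0 pnatr_eq0 -lt0n bin_gt0 nj.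
Qed.

End Flow.
End LocalExp.

(** * Composition and the flow *)

Section Composition.
Context (R : realType) (Phi : LBspace R).
Local Notation C := R[i].
Local Notation dual := (dual Phi).
Local Notation forms := (seq dual -> C^o).
Local Notation symt := (@symt R Phi).
Local Notation symHom := (@symHom R Phi).
Local Notation sser := (sser Phi).
Local Notation ser := (ser Phi).
Local Notation sexp := (@sexp R Phi).
Implicit Types (s u v : seq dual) (w : dual) (n k m l : nat).

Lemma sum_tuple_cons (V : nmodType) (T : finType) l (P : pred (l.+1.-tuple T))
    (F : l.+1.-tuple T -> V) :
  \sum_(t | P t) F t = \sum_(i : T) \sum_(t : l.-tuple T | P [tuple of i :: t])
     F [tuple of i :: t].
Proof.
rewrite pair_big_dep /= (reindex (fun p : T * l.-tuple T => [tuple of p.1 :: p.2])) /=.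
  by apply: eq_bigl => -[i t].
exists (fun t : l.+1.-tuple T => (thead t, [tuple of behead t])) => [[i t]|t] _ /=.
  by congr (_, _); apply: val_inj.
by rewrite -tuple_eta.
Qed.

Lemma coef_partial_sum (a : sser) k m n (f : forms) I (r : seq I) (P : pred I)
    (b : I -> symHom m 0) : stens n (k + m) f ->
  coef a (to_symt k (partial_app (\sum_(x <- r | P x) b x) f)) =
  \sum_(x <- r | P x) coef a (to_symt k (partial_app (b x) f)).
Proof.
move=> fst; elim/big_rec2: _ => [|x y z _ <-].
  rewrite (_ : to_symt k _ = 0) ?/coef ?ap_f0//.
  have -> : partial_app (0 : symHom m 0) f = 0 by apply/funext => u.
  by apply: symtP => s; rewrite /to_symt /= insubdK//; apply: rpred0.
apply: (coef_to_symtD a (n := n)); do ?exact: partial_app_stens.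
by move=> s; rewrite /partial_app /slice_app apD valD.
Qed.

Definition psi_tuples K l k (t : l.-tuple 'I_K) :=
  [forall j, 0 < tnth t j]%N && (sumn [seq val j | j <- t] == k).

(** The part of degree [k] of [xi |-> B(xi)^l]; [K] bounds the entries of the tuples, and any
    [K] greater than [k] gives the same operator. *)
Definition psi (B : ser 1) K k l : symHom k l :=
  \sum_(t : l.-tuple 'I_K | psi_tuples k t) hom_cast k l (odots B [seq val j | j <- t]).

Lemma psi_tuples_cons K l k (i : 'I_K) (t : l.-tuple 'I_K) :
  psi_tuples k [tuple of i :: t] = [&& (0 < i)%N, (i <= k)%N & psi_tuples (k - i) t].
Proof.
rewrite /psi_tuples.
have allE m (t' : m.-tuple 'I_K) : [forall j, 0 < tnth t' j]%N = all (fun x : 'I_K => 0 < x)%N t'.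
  by apply/forallP/all_tnthP.
rewrite !allE /= -andbA; case: (0 < i)%N => //=.
case: (all _ t) => /=; last by rewrite andbF.
have [ik|ki] := leqP i k; last by apply/negbTE; rewrite neq_ltn (leq_trans ki) ?orbT ?leq_addr.
by rewrite -[in LHS](subnKC ik) eqn_add2l.
Qed.

Definition dotH w k i (A : symHom k i) : symHom k 0 :=
  to_hom (fun f => scal Phi (dot w (ap A f))).

Lemma dotHE w k i (A : symHom k i) f : ap (dotH w A) f [::] = dot w (ap A f).
Proof. by rewrite /dotH (fun_homE (eval_functional A (size_nseq i w))) scalE. Qed.

Lemma dotH_sum w k i I (r : seq I) (P : pred I) (A : I -> symHom k i) :
  dotH w (\sum_(x <- r | P x) A x) = \sum_(x <- r | P x) dotH w (A x).
Proof.
apply: symHomP => f; apply: symt0P; rewrite dotHE !ap_sum dot_sum val_sum.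
by apply: eq_bigr => x _; rewrite dotHE.
Qed.

Lemma size_val_tuple K l (t : l.-tuple 'I_K) : size [seq val j | j <- t] = l.
Proof. by rewrite size_map size_tuple. Qed.

Lemma dot_odot1 (B : ser 1) w i k l m l' (O : symHom m l') (f : symt k) :
  (i + m)%N = k -> l' = l ->
  dot w (ap (hom_cast k l.+1 (odot (B i) O)) f) =
  coef (sdot w B) (to_symt i (partial_app (dotH w (hom_cast (k - i) l O)) f)).
Proof.
move=> ek el; subst l' k.
rewrite {1}/dot (hom_castE _ _ erefl)//.
rewrite to_symtK odotE.
rewrite -[nseq l.+1 w]/(nseq (1 + l) w) symz_nseq /tensor_app coef_sdot /= drop0 take0 dot_degree1.
congr (ap (B i) (to_symt i _) [:: w]).
rewrite /partial_app /slice_app; apply/funext => u; rewrite dotHE.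
have cast q (h : forms) : q = m ->
    ap O (to_symt m h) (nseq l w) = dot w (ap (hom_cast q l O) (to_symt q h)).
  by move=> qm; subst q; rewrite hom_cast_id.
by rewrite -cast ?addKn.
Qed.

(** Pairing the tensor power [B(xi)^l] with [w^l] gives the power of the scalar series
    [<w, B>]: this is how composition is reduced to the algebra of scalar series. *)
Lemma dot_psi (B : ser 1) w K l k (f : symt k) : B 0%N = 0 -> (k < K)%N ->
  dot w (ap (psi B K k l) f) = coef (sdot w B ^+ l) f.
Proof.
move=> B0; elim: l k f => [|l IH] k f kK.
  rewrite expr0 -soneE coef_one /psi ap_sum dot_sum.
  case: k f kK => [|k] f kK.
    rewrite (bigD1 [tuple])/=; last by rewrite /psi_tuples; apply/andP; split=> //; apply/forallP => -[].
    rewrite big1 ?addr0 => [|t /andP[_ /negP[]]]; last by rewrite [t]tuple0.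
    by rewrite hom_cast_id id_homE.
  rewrite big1// => t; rewrite /psi_tuples [t]tuple0 /= => /andP[_].
  by [].
rewrite /psi sum_tuple_cons ap_sum dot_sum exprS coef_mul.
have [n fst] := symt_stens f.
pose G i := coef (sdot w B) (to_symt i (partial_app ((sdot w B ^+ l) (k - i)%N) f)).
rewrite -[RHS]/(\sum_(i < k.+1) G i).
rewrite (big_ord_widen K G kK) [RHS]big_mkcond /=; apply: eq_bigr => i _.
rewrite (eq_bigl (fun t : l.-tuple 'I_K => [&& (0 < i)%N, (i <= k)%N & psi_tuples (k - i) t])); last first.
  by move=> t; exact: psi_tuples_cons.
rewrite ltnS; case: (leqP i k) => ik; last by rewrite big1 ?ap0 ?dot0// => t; rewrite /= andbF.
have [i0|i0] := posnP i.
  rewrite big1 ?ap0 ?dot0 => [|t //].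
  by rewrite /G i0 coef_sdot B0 ap0 dot0.
rewrite (eq_bigl (psi_tuples (k - i)))//.
rewrite ap_sum dot_sum /G.
have -> : (sdot w B ^+ l) (k - i)%N = dotH w (psi B K (k - i) l).
  apply: symHomP => g; apply: symt0P; rewrite dotHE IH// (leq_ltn_trans _ kK)// leq_subr//.
rewrite /psi dotH_sum (@coef_partial_sum _ _ _ n); last by rewrite subnKC.
apply: eq_bigr => t /andP[_ /eqP ts].
by apply: dot_odot1; rewrite ?size_val_tuple// ts subnKC.
Qed.

Lemma ap_series_comp i (A : ser i) (B : ser 1) k (f : symt k) :
  ap (series_comp A B k) f = \sum_(l < k.+1) ap (A l) (ap (psi B k.+1 k l) f).
Proof.
case: k f => [|k] f.
  rewrite big_ord1 /=; congr (ap (A 0%N) _); rewrite /psi ap_sum.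
  rewrite (bigD1 [tuple])/=; last by rewrite /psi_tuples; apply/andP; split=> //; apply/forallP => -[].
  rewrite big1 ?addr0 => [|t /andP[_ /negP[]]]; last by rewrite [t]tuple0.
  by rewrite hom_cast_id id_homE.
rewrite /series_comp /series_comp_coef ap_sum.
rewrite -[RHS](big_mkord xpredT (fun l => ap (A l) (ap (psi B k.+2 k.+1 l) f))).
rewrite [RHS]big_ltn// [X in _ = X + _](_ : _ = 0) ?add0r; last first.
  rewrite /psi ap_sum big1 ?ap_f0// => t; rewrite /psi_tuples [t]tuple0 /= => /andP[_].
  by [].
by apply: eq_bigr => l _; rewrite hom_compE.
Qed.

Fact scomp_key : unit. Proof. exact: tt. Qed.
Definition scomp : forall i, ser i -> ser 1 -> ser i :=
  locked_with scomp_key (@series_comp R Phi).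

Lemma scompE i (A : ser i) (B : ser 1) : series_comp A B = scomp A B.
Proof. by rewrite /scomp locked_withE. Qed.

Lemma ap_scomp i (A : ser i) (B : ser 1) k (f : symt k) :
  ap (scomp A B k) f = \sum_(l < k.+1) ap (A l) (ap (psi B k.+1 k l) f).
Proof. by rewrite -scompE ap_series_comp. Qed.

Definition scomp0 (a : sser) (B : ser 1) : sser := scomp a B.

Lemma coef_scomp (a : sser) (B : ser 1) k (f : symt k) :
  coef (scomp0 a B) f = \sum_(l < k.+1) coef a (ap (psi B k.+1 k l) f).
Proof. by rewrite /coef ap_scomp val_sum. Qed.

Lemma fm_scomp (B : ser 1) : finite_map (scomp0 ^~ B).
Proof.
move=> k f; apply: (@ff_ext _ _ (fun a => \sum_(l < k.+1) coef a (ap (psi B k.+1 k l) f))).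
  by move=> a; rewrite coef_scomp.
by apply: ff_sum => l; exact: ff_coef.
Qed.

Lemma sdot_scomp w (A B : ser 1) : sdot w (scomp A B) = scomp0 (sdot w A) B.
Proof.
apply: sserP => k f; rewrite coef_sdot coef_scomp ap_scomp dot_sum.
by apply: eq_bigr => l _; rewrite coef_sdot.
Qed.

Fact sEXP_key : unit. Proof. exact: tt. Qed.
Definition sEXP : sser -> sser := locked_with sEXP_key (@series_exp R Phi).

Lemma sEXPE (a : sser) : series_exp a = sEXP a.
Proof. by rewrite /sEXP locked_withE. Qed.

Lemma coef_sEXP (a : sser) k (f : symt k) :
  coef (sEXP a) f = \sum_(n < k.+1) (n`!%:R)^-1 * coef (a ^+ n) f.
Proof.
rewrite -sEXPE /coef series_expE ap_sum val_sum; apply: eq_bigr => n _.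
by rewrite apZ valZ.
Qed.

Lemma scomp_sexp w (B : ser 1) : B 0%N = 0 -> scomp0 (sexp w) B = sEXP (sdot w B).
Proof.
move=> B0; apply: sserP => k f; rewrite coef_scomp coef_sEXP.
by apply: eq_bigr => l _; rewrite coef_sexp dot_psi.
Qed.

Definition sid : ser 1 := fun k => if k is 1%N then id_hom Phi 1 else 0.

Lemma coef_sdot_sid w k (f : symt k) : coef (sdot w sid) f = if k == 1%N then dot w f else 0.
Proof.
by rewrite coef_sdot /sid; case: k f => [|[|k]] f; rewrite ?ap0 ?dot0 ?id_homE.
Qed.

Lemma coef_sdot_sid_exp w n k (f : symt k) :
  coef (sdot w sid ^+ n) f = if k == n then dot w f else 0.
Proof.
elim: n k f => [|n IH] k f.
  by rewrite expr0 -soneE coef_one; case: k f => [|k] f.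
rewrite exprS coef_mul; case: k f => [|k] f.
  by rewrite big_ord1 coef_sdot_sid.
rewrite big_ord_recl coef_sdot_sid add0r big_ord_recl big1 ?addr0 => [|l _]; last first.
  by rewrite coef_sdot_sid.
rewrite coef_sdot_sid /= eqSS /bump /= add1n subSS subn0.
have [m fst] := symt_stens f; have fst' : stens m (1 + k) f by rewrite add1n.
have sst : stens m k (slice [:: w] f) := slice_stens fst' (erefl (size [:: w])).
rewrite /dot (to_symtE (partial_app_stens _ fst')) /partial_app /slice_app.
rewrite -/(coef (sdot w sid ^+ n) _) IH.
by case: ifP => // _; rewrite /dot (to_symtE sst).
Qed.

Lemma sexp_sEXP w : sexp w = sEXP (sdot w sid).
Proof.
apply: sserP => k f; rewrite coef_sexp coef_sEXP (bigD1 ord_max)//= big1 ?addr0 => [|n nk].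
  by rewrite coef_sdot_sid_exp eqxx.
rewrite coef_sdot_sid_exp ifN ?mulr0//.
by move: nk; apply: contra => /eqP kn; apply/eqP/val_inj.
Qed.

Section FlowLaw.
Context (al : sser) (be : ser 1).
Hypotheses (al0 : al 0%N = 0) (be0 : be 0%N = 0) (be1 : be 1%N = 0).

(** The flow of the vector field: [A_t = exp(t L) 1] and [B_t = exp(t D_be) xi]. *)
Definition flowA (t : C) : sser := lexp (sL al be : ser 0 -> ser 0) t (1 : sser).
Definition flowB (t : C) : ser 1 := lexp (sderiv be) t sid.

Let rD i := @raising_sderiv R Phi be be1 i.
Let rL := raising_sL al0 be1.
Let r0 := raising_sD be1.

Lemma sdot_lexp w t (B : ser 1) : sdot w (lexp (sderiv be) t B) = lexp (sD be) t (sdot w B) :> sser.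
Proof.
have it n : sdot w (iter n (sderiv be) B) = iter n (sD be) (sdot w B).
  by elim: n => //= n <-; rewrite sdot_sderiv.
apply: sserP => k f; rewrite coef_sdot /coef /lexp !ap_sum dot_sum val_sum.
apply: eq_bigr => n _; rewrite !apZ dotZ valZ; congr (_ * _).
by rewrite -it -coef_sdot.
Qed.

Lemma lexp_sD1 t : lexp (sD be) t (1 : sser) = 1 :> sser.
Proof.
apply: serP => k; rewrite /lexp big_ord_recl /= expr0 fact0 divr1 scale1r big1 ?addr0// => n _.
rewrite /bump leq0n add1n -?iterS iterSr sD1//.
by rewrite (iter0 r0) ser0E scaler0.
Qed.

Lemma lexp_sDM t (a b : sser) :
  lexp (sD be) t (a * b) = (lexp (sD be) t a : sser) * (lexp (sD be) t b : sser) :> sser.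
Proof.
have E : sL 0 be = sD be by apply/funext => x; rewrite /sL mul0r addr0.
by have := @lexp_mul R Phi 0 be (erefl _) be0 be1 t a b; rewrite E.
Qed.

Lemma lexp_sDX t (a : sser) n : lexp (sD be) t (a ^+ n : sser) = (lexp (sD be) t a : sser) ^+ n.
Proof. by elim: n => [|n IH]; rewrite ?expr0 ?lexp_sD1// !exprS lexp_sDM IH. Qed.

(** The exponential of a derivation is multiplicative, and commutes with the finite sums
    that define the exponential series in each degree. *)
Lemma lexp_sD_sEXP t (u : sser) : u 0%N = 0 ->
  lexp (sD be) t (sEXP u) = sEXP (lexp (sD be) t u) :> sser.
Proof.
move=> u0; apply: serP => k.
pose U : sser := \sum_(n < k.+1) (n`!%:R)^-1 *: (u ^+ n).
have EU : eq_below k.+1 (sEXP u) U.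
  move=> j jk; rewrite -sEXPE series_expE /U ser_sumE.
  rewrite (big_ord_widen k.+1 (fun n => (n`!%:R)^-1 *: (u ^+ n) j) jk) big_mkcond.
  apply: eq_bigr => n _; case: ltnP => // jn; rewrite serZE.
  by rewrite (order_exp u0 jn) ser0E scaler0.
rewrite (lexp_below r0 t EU)// -[RHS]/((sEXP _ : sser) k) -sEXPE series_expE /U.
have lexp_sum : lexp (sD be) t (\sum_(n < k.+1) (n`!%:R)^-1 *: (u ^+ n) : sser) =
    \sum_(n < k.+1) (n`!%:R)^-1 *: lexp (sD be) t (u ^+ n : sser).
  elim/big_rec2: _ => [|n x y _ <-]; last exact: (lexp_lin r0).
  have := lexp_lin r0 t (-1) 0 0; rewrite scaler0 addr0 => ->.
  by rewrite scaleN1r addNr.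
rewrite lexp_sum ser_sumE; apply: eq_bigr => n _.
by rewrite serZE lexp_sDX.
Qed.

(** The image of [e^w] under the flow, as [e^w = exp<w, xi>] and [exp(t L)] is multiplicative
    up to the potential. *)
Lemma lexp_sL_sexp t w :
  lexp (sL al be : ser 0 -> ser 0) t (sexp w) = sEXP (sdot w (flowB t)) * flowA t :> sser.
Proof.
have s0 : sdot w sid 0%N = 0.
  by apply: symHomP => f; apply: symt0P; rewrite -/(coef (sdot w sid) f) coef_sdot_sid.
have := lexp_mul al0 be0 be1 t (1 : sser) (sexp w); rewrite mul1r => ->.
by rewrite mulrC sexp_sEXP lexp_sD_sEXP// -sdot_lexp.
Qed.

Lemma flowB0 t : flowB t 0%N = 0.
Proof. by rewrite /flowB /lexp big_ord1 /= scaler0. Qed.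

Lemma flowB1 t : flowB t 1%N = id_hom Phi 1.
Proof.
rewrite /flowB /lexp big_ord_recl /= expr0 fact0 divr1 scale1r big_ord1 /=.
have [_ /(_ 1%N sid) H] := rD 1.
rewrite (H _ 1%N) ?ser0E ?scaler0 ?addr0//.
by move=> j; rewrite ltnS leqn0 => /eqP ->.
Qed.

Lemma flowA0 t : flowA t 0%N = id_hom Phi 0.
Proof. by rewrite /flowA /lexp big_ord1 /= expr0 fact0 divr1 scale1r. Qed.

Lemma fm_lexp t : finite_map (lexp (sL al be : ser 0 -> ser 0) t : sser -> sser).
Proof.
have fit n : finite_map (iter n (sL al be)).
  elim: n => [|n IH]; first exact: fm_id.
  have fL : finite_map (sL al be).
    have mf : finite_map (fun a => al * a) by exact: fm_mull.
    move=> k f; apply: ff_ext (fm_lin 1 (fm_sD be) mf (k := k) f) => x.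
    by rewrite scale1r.
  exact: (fm_comp fL IH).
move=> k f; apply: (@ff_ext _ _ (fun a => \sum_(n < k.+1)
   (t ^+ n / n`!%:R) * coef (iter n (sL al be) a) f)).
  move=> a; rewrite [in RHS]/coef /lexp ap_sum val_sum; apply: eq_bigr => n _.
  by rewrite apZ valZ.
by apply: ff_sum => n; apply: ffZ; exact: fit.
Qed.

(** Lie series: substitution along the flow is the exponential of the vector field. On
    exponentials this is the previous formula. *)
Lemma scomp_flow t (a : sser) : scomp0 a (flowB t) * flowA t =
  lexp (sL al be : ser 0 -> ser 0) t a.
Proof.
have mf : finite_map (fun a => a * flowA t) by exact: fm_mulr.
move: a; apply: fm_sexp_eq => [||w].
- exact: fm_comp mf (fm_scomp (flowB t)).
- exact: fm_lexp.
by rewrite scomp_sexp ?flowB0// lexp_sL_sexp.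
Qed.

(** With the Lie series, the group law of the flow is [exp(s L) exp(t L) = exp((s + t) L)]. *)
Lemma flowA_add (s t : C) : flowA (s + t) = scomp0 (flowA s) (flowB t) * flowA t.
Proof. by rewrite scomp_flow /flowA lexp_add// addrC. Qed.

End FlowLaw.

Lemma flowB_add (be : ser 1) (s t : C) : be 0%N = 0 -> be 1%N = 0 ->
  flowB be (s + t) = scomp (flowB be s) (flowB be t).
Proof.
move=> be0 be1; apply: serP1 => w; rewrite sdot_scomp.
have := scomp_flow (al := 0) (erefl _) be0 be1 t (sdot w (flowB be s)).
have E : sL 0 be = sD be by apply/funext => x; rewrite /sL mul0r addr0.
have -> : flowA 0 be t = 1 by rewrite /flowA E; exact: lexp_sD1.
rewrite mulr1 => ->; rewrite E -sdot_lexp; congr (sdot w _).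
rewrite /flowB (lexp_add (@raising_sderiv R Phi be be1 1)) addrC//.
Qed.

End Composition.

(** * Operators on polynomials lowering the degree *)

Section Operators.
Context (R : realType) (Phi : LBspace R).
Local Notation C := R[i].
Local Notation dual := (dual Phi).
Local Notation forms := (seq dual -> C^o).
Local Notation symt := (@symt R Phi).
Local Notation symHom := (@symHom R Phi).
Local Notation polyt := (polyt Phi).
Local Notation Op := (Op Phi).
Local Notation VPhi := (VPhi Phi).
Implicit Types (s u v : seq dual) (w : dual) (n k m l e : nat) (p q : polyt).

Lemma polytP p q : (forall w, p w = q w) -> p = q.
Proof. by move=> pq; apply: val_inj; apply/funext. Qed.

Lemma pvalD p q w : (p + q : polyt) w = p w + q w. Proof. by []. Qed.
Lemma pvalZ c p w : (c *: p : polyt) w = c * p w. Proof. by []. Qed.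
Lemma pval_sum I (r : seq I) (P : pred I) (F : I -> polyt) w :
  (\sum_(x <- r | P x) F x) w = \sum_(x <- r | P x) F x w.
Proof. by elim/big_rec2: _ => [//|x y z _ <-]; rewrite pvalD. Qed.

Lemma monoE k (f : symt k) w : mono f w = dot w f. Proof. by []. Qed.

Lemma mono_lin k c (f g : symt k) : mono (c *: f + g) = c *: mono f + mono g.
Proof. by apply: polytP => w; rewrite pvalD pvalZ !monoE dotD dotZ. Qed.

Lemma mono0 k : mono (0 : symt k) = 0.
Proof. by apply: polytP => w; rewrite monoE dot0. Qed.

Lemma monoD k (f g : symt k) : mono (f + g) = mono f + mono g.
Proof. by have := mono_lin 1 f g; rewrite !scale1r. Qed.

Lemma monoZ k c (f : symt k) : mono (c *: f) = c *: mono f.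
Proof. by have := mono_lin c f 0; rewrite !addr0 mono0 addr0. Qed.

Lemma poly_decomp p : exists K (f : forall k, symt k), p = \sum_(k < K) mono (f k).
Proof.
have /asboolP[K [f pE]] := valP p; exists K.+1, f; apply: polytP => w.
by rewrite pval_sum -[LHS]/(val p w) pE.
Qed.

Lemma poly_decomp2 p q : exists K (f g : forall k, symt k),
  p = \sum_(k < K) mono (f k) /\ q = \sum_(k < K) mono (g k).
Proof.
have [K [f ->]] := poly_decomp p; have [L [g ->]] := poly_decomp q.
have wid N M (h : forall k, symt k) : (N <= M)%N -> \sum_(k < N) mono (h k) =
    \sum_(k < M) mono (if (k < N)%N then h k else 0).
  move=> NM; rewrite (big_ord_widen M (fun k => mono (h k)) NM) big_mkcond.
  by apply: eq_bigr => k _; case: ifP => //; rewrite mono0.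
exists (maxn K L), (fun k => if (k < K)%N then f k else 0),
  (fun k => if (k < L)%N then g k else 0).
by split; apply: wid; [exact: leq_maxl|exact: leq_maxr].
Qed.

Definition plinear (T : polyt -> polyt) := forall c p q, T (c *: p + q) = c *: T p + T q.

Lemma plinear0 T : plinear T -> T 0 = 0.
Proof. by move=> Tl; have := Tl (-1) 0 0; rewrite scaler0 addr0 scaleN1r addNr. Qed.

Lemma plinearD T p q : plinear T -> T (p + q) = T p + T q.
Proof. by move=> Tl; have := Tl 1 p q; rewrite !scale1r. Qed.

Lemma plinearZ T c p : plinear T -> T (c *: p) = c *: T p.
Proof. by move=> Tl; have := Tl c p 0; rewrite !addr0 plinear0// addr0. Qed.

Lemma plinear_sum T I (r : seq I) (P : pred I) (F : I -> polyt) : plinear T ->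
  T (\sum_(x <- r | P x) F x) = \sum_(x <- r | P x) T (F x).
Proof.
move=> Tl; elim/big_rec2: _ => [|x y z _ <-]; first exact: plinear0.
exact: plinearD.
Qed.

Lemma plinear_ext T S : plinear T -> plinear S ->
  (forall k (f : symt k), T (mono f) = S (mono f)) -> forall p, T p = S p.
Proof.
move=> Tl Sl TS p; have [K [f ->]] := poly_decomp p.
by rewrite !plinear_sum//; apply: eq_bigr => k _.
Qed.

Lemma op_plinear (P : Op) : plinear P.
Proof. by move=> c p q; exact: (clin_linear P). Qed.

Lemma OpP (P Q : Op) : (forall p, P p = Q p) -> P = Q.
Proof. by move=> PQ; apply: val_inj; apply/funext. Qed.

(** Finite sums of maps [f |-> mono (h f)] with [h] lowering the degree by at least [e]. Being
    inductive, the notion passes easily to sums and compositions. *)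
Inductive lowform k e : (symt k -> polyt) -> Prop :=
| lowform0 : lowform e (fun=> 0)
| lowformS i (h : symHom k i) F : (i + e <= k)%N -> lowform e F ->
    lowform e (fun f => mono (ap h f) + F f).

(** The operators with finite columns and all entries at least [e] above the diagonal:
    the case [e = 0] contains [M(Phi)], the case [e = 1] is [V(Phi)]. *)
Definition lowers e (T : polyt -> polyt) := plinear T /\
  forall k, exists2 F, @lowform k e F & forall f, T (mono f) = F f.

Lemma lowform_ext k e F G : (forall f, F f = G f) -> @lowform k e F -> lowform e G.
Proof. by move=> /funext ->. Qed.

Lemma lowform_add k e F G : @lowform k e F -> lowform e G ->
  lowform e (fun f => F f + G f).
Proof.
move=> lF lG; elim: lF => [|i h F' ik _ IH].
  by apply: lowform_ext lG => f; rewrite add0r.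
by apply: lowform_ext (lowformS h ik IH) => f; rewrite addrA.
Qed.

Lemma lowform_scale k e c F : @lowform k e F -> lowform e (fun f => c *: F f).
Proof.
elim=> [|i h F' ik _ IH].
  by apply: lowform_ext (lowform0 k e) => f; rewrite scaler0.
by apply: lowform_ext (lowformS (c *: h) ik IH) => f; rewrite apZ monoZ scalerDr.
Qed.

Lemma lowform_sum k e I (r : seq I) (P : pred I) (F : I -> symt k -> polyt) :
  (forall x, P x -> lowform e (F x)) -> lowform e (fun f => \sum_(x <- r | P x) F x f).
Proof.
move=> lF; elim: r => [|x r IH].
  by apply: lowform_ext (lowform0 k e) => f; rewrite big_nil.
case Px: (P x).
  by apply: lowform_ext (lowform_add (lF x Px) IH) => f; rewrite big_cons Px.
by apply: lowform_ext IH => f; rewrite big_cons Px.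
Qed.

Lemma lowform1 k e i (h : symHom k i) : (i + e <= k)%N -> lowform e (fun f => mono (ap h f)).
Proof. by move=> ik; apply: lowform_ext (lowformS h ik (lowform0 k e)) => f; rewrite addr0. Qed.

Lemma lowform_pre k e e' i (h : symHom k i) F : (i + e' <= k)%N -> @lowform i e F ->
  lowform (e + e') (fun f => F (ap h f)).
Proof.
move=> ik; elim=> [|j h' F' ji _ IH]; first exact: lowform0.
have jk : (j + (e + e') <= k)%N by rewrite addnA (leq_trans _ ik)// leq_add2r.
by apply: lowform_ext (lowformS (hom_comp h' h) jk IH) => f; rewrite hom_compE.
Qed.

Lemma lowform_app k e e' T F : lowers e T -> @lowform k e' F ->
  lowform (e + e') (fun f => T (F f)).
Proof.
move=> [Tl TF]; elim=> [|i h F' ik _ IH].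
  by apply: lowform_ext (lowform0 k _) => f; rewrite plinear0.
have [G lG TG] := TF i.
by apply: lowform_ext (lowform_add (lowform_pre h ik lG) IH) => f; rewrite plinearD// TG.
Qed.

Lemma lowers_comp e e' T S : lowers e T -> lowers e' S -> lowers (e + e') (fun p => T (S p)).
Proof.
move=> lT [Sl SF]; have [Tl _] := lT; split=> [c p q|k]; first by rewrite Sl Tl.
have [F lF SFE] := SF k; exists (fun f => T (F f)); first exact: lowform_app.
by move=> f; rewrite SFE.
Qed.

Lemma lowers_lin e c T S : lowers e T -> lowers e S -> lowers e (fun p => c *: T p + S p).
Proof.
move=> [Tl TF] [Sl SF]; split=> [d p q|k].
  by rewrite Tl Sl !scalerDr !scalerA addrACA [c * d]mulrC.
have [F lF FE] := TF k; have [G lG GE] := SF k.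
exists (fun f => c *: F f + G f); first by apply: lowform_add => //; exact: lowform_scale.
by move=> f; rewrite FE GE.
Qed.

Lemma lowers_zero e : lowers e (fun=> 0).
Proof.
split=> [c p q|k]; first by rewrite scaler0 addr0.
by exists (fun=> 0) => //; exact: lowform0.
Qed.

Lemma lowers_id : lowers 0 id.
Proof.
split=> // k; exists (fun f => mono f) => //.
have := lowform1 (e := 0) (id_hom Phi k); rewrite addn0 => /(_ (leqnn k)).
by apply: lowform_ext => f; rewrite id_homE.
Qed.

Lemma lowers_ext e T S : (forall p, T p = S p) -> lowers e T -> lowers e S.
Proof. by move=> /funext ->. Qed.

Lemma lowers_iter e n T : lowers e T -> lowers (n * e) (iter n T).
Proof.
move=> lT; elim: n => [|n IH]; first exact: lowers_id.
exact: lowers_comp lT IH.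
Qed.

Lemma lowform_mono k e e' F : (e' <= e)%N -> @lowform k e F -> lowform e' F.
Proof.
move=> ee; elim=> [|i h F' ik _ IH]; first exact: lowform0.
by apply: lowformS => //; rewrite (leq_trans _ ik)// leq_add2l.
Qed.

Lemma lowers_mono e e' T : (e' <= e)%N -> lowers e T -> lowers e' T.
Proof.
move=> ee [Tl TF]; split=> // k; have [F lF FE] := TF k; exists F => //.
exact: lowform_mono lF.
Qed.

Lemma lowform_vanish k e F : (k < e)%N -> @lowform k e F -> forall f, F f = 0.
Proof.
move=> ke; case=> // i h F' ik _ f.
by have := leq_trans (leq_addl i e) ik; rewrite leqNgt ke.
Qed.

Lemma lowers_vanish e T k (f : symt k) : (k < e)%N -> lowers e T -> T (mono f) = 0.
Proof. by move=> ke [_ /(_ k)[F lF ->]]; exact: lowform_vanish lF _. Qed.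

(** Locally finite sums are truncated in order to be computed. *)
Lemma fsbig_nat_trunc (F : nat -> polyt) (A : set nat) N : (forall n, (N <= n)%N -> F n = 0) ->
  \sum_(n \in A) F n = \sum_(n < N | (n : nat) \in A) F n.
Proof.
move=> F0.
have fin : finite_set (A `&` `I_N).
  by apply: finite_setIr; exact: finite_II.
rewrite -(fsbig_widen (A `&` `I_N) A) /=; last 2 first.
  by move=> n [].
  by move=> n [/= An nI]; apply: F0; rewrite leqNgt; apply/negP => nN; apply: nI.
transitivity (\sum_(n \in `I_N) if n \in A then F n else 0).
  rewrite -[RHS](fsbig_widen (A `&` `I_N) `I_N) /=; last 2 first.
    by move=> n [].
    move=> n [/= nN nA]; rewrite ifN//; apply/negP => /set_mem An; exact: nA.
  by apply: eq_fsbigr => n /set_mem[An _]; rewrite mem_set.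
by rewrite -fsbig_ord [RHS]big_mkcond.
Qed.

Definition locsum (A : set nat) (c : nat -> C) (T : nat -> polyt -> polyt) p :=
  \sum_(n \in A) c n *: T n p.

Definition locfinite (T : nat -> polyt -> polyt) := forall n, plinear (T n) /\
  forall k (f : symt k), (k < n)%N -> T n (mono f) = 0.

Lemma lowers_locfinite T : (forall n, lowers n (T n)) -> locfinite T.
Proof.
move=> Tn n; have [Tl _] := Tn n; split=> // k f kn.
exact: lowers_vanish kn (Tn n).
Qed.

Lemma locsum_trunc A c T K (f : forall k, symt k) N : locfinite T ->
  (K <= N)%N -> locsum A c T (\sum_(k < K) mono (f k)) =
  \sum_(n < N | (n : nat) \in A) c n *: T n (\sum_(k < K) mono (f k)).
Proof.
move=> Tn KN; apply: fsbig_nat_trunc => n Nn.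
have [Tl _] := Tn n; rewrite plinear_sum// big1 ?scaler0// => k _.
by have [_ T0] := Tn n; apply: T0; rewrite (leq_trans (ltn_ord k))// (leq_trans KN).
Qed.

Lemma mono_as_sum k (f : symt k) : exists g : forall j, symt j,
  mono f = \sum_(j < k.+1) mono (g j).
Proof.
exists (fun j => if j == k then to_symt j f else 0).
rewrite big_ord_recr /= eqxx to_symtK big1 ?add0r// => j _.
by rewrite ifN ?mono0// neq_ltn ltn_ord.
Qed.

Lemma locsum_mono A c T k (f : symt k) N : locfinite T -> (k < N)%N ->
  locsum A c T (mono f) = \sum_(n < N | (n : nat) \in A) c n *: T n (mono f).
Proof. by move=> Tn kN; have [g ->] := mono_as_sum f; exact: locsum_trunc. Qed.

Lemma lowers_locsum A c T e : locfinite T ->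
  (forall n, n \in A -> lowers e (T n)) -> lowers e (locsum A c T).
Proof.
move=> Tn Te; split=> [d p q|k].
  have [K [f [g [-> ->]]]] := poly_decomp2 p q.
  have E : d *: \sum_(k < K) mono (f k) + \sum_(k < K) mono (g k) =
      \sum_(k < K) mono (d *: f k + g k).
    by rewrite scaler_sumr -big_split; apply: eq_bigr => k _; rewrite mono_lin.
  rewrite E (locsum_trunc _ _ (fun k => d *: f k + g k) Tn (leqnn K)) -E.
  rewrite !(locsum_trunc _ _ _ Tn (leqnn K)) [X in _ = X + _]scaler_sumr -[RHS]big_split /=.
  apply: eq_bigr => n _; have [Tl _] := Tn n.
  by rewrite Tl scalerDr !scalerA [c n * d]mulrC.
exists (fun f => \sum_(n < k.+1 | (n : nat) \in A) c n *: T n (mono f)).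
  apply: lowform_sum => n nA; apply: lowform_scale.
  by have [_ /(_ k)[F lF /funext FE]] := Te n nA; rewrite FE.
by move=> f; exact: locsum_mono.
Qed.

Lemma poly_seminorm_mono (q : seminorm polyt) : poly_seminorms q <->
  forall k n, exists M, forall f : symt k, step (c := symc Phi k) n f ->
    q (mono f) <= M * inj_norm n k f.
Proof.
have ml k : linear (@mono R Phi k) by move=> c f g; exact: mono_lin.
split=> [qc k|qb k].
  exact: (@indlim_seminorm_of_continuous _ (symc Phi k) (sn_comp q (ml k)) (qc k)).
apply: (@lc_seminorm_continuous _ _ (@indlim_seminorms _ (symc Phi k)) (sn_comp q (ml k))).
exact: qb.
Qed.

(** By the universal property of the direct sum and of the inductive limits, a triangular
    operator is continuous as soon as its entries are. *)
Lemma lowers_continuous T : lowers 0 T -> (T : PPhi Phi -> PPhi Phi) \in @cont_lin _ (PPhi Phi) (PPhi Phi).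
Proof.
move=> [Tl TF]; have Tl' : linear T by [].
apply: (@lc_clin _ _ _ (@poly_seminorms R Phi) (@poly_seminorms R Phi) T Tl') => q qp.
exists (sn_comp q Tl'); last by move=> x; exact: lexx.
apply/poly_seminorm_mono => k n; have [F lF FE] := TF k.
suff [M FM] : exists M, forall f : symt k, step (c := symc Phi k) n f ->
    q (F f) <= M * inj_norm n k f.
  by exists M => f fn; rewrite /= /sn_comp_fun FE; exact: FM.
elim: lF {FE} => [|i h F' _ _ [M FM]].
  by exists 0 => f _; rewrite sn0 mul0r.
have [m [N [N0 hN]]] := ap_factor h n.
have [L qL] := proj1 (poly_seminorm_mono q) qp i m.
exists (`|L| * N + M) => f fn; have [hm he] := hN f fn.
rewrite (le_trans (sn_triangle _ _ _))// mulrDl lerD ?FM//.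
have H := qL _ hm; rewrite -mulrA (le_trans _ (ler_wpM2l (normr_ge0 L) he))//.
rewrite (le_trans H)// -[leLHS]ger0_norm; last exact: le_trans (sn_ge0 _ _) H.
by rewrite normrM ler_wpM2l// ger0_norm// inj_norm_ge0.
Qed.

Lemma to_opE T p : lowers 0 T -> to_op T p = T p.
Proof. by move=> lT; rewrite /to_op /op_ap to_clinE//; exact: lowers_continuous. Qed.

Lemma lowform_matrix k e F : @lowform k e F -> exists m : forall i, symHom k i,
  (forall i, (k < i + e)%N -> m i = 0) /\ forall f, F f = \sum_(i < k.+1) mono (ap (m i) f).
Proof.
elim=> [|i h F' ik _ [m [m0 mE]]].
  by exists (fun=> 0); split=> // f; rewrite big1// => i _; rewrite mono0.
exists (fun j => (if j == i then hom_cast k j h else 0) + m j); split=> [j kj|f].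
  rewrite m0// addr0; case: eqVneq => // ji; subst j.
  by move: kj; rewrite ltnNge ik.
have ik' : (i < k.+1)%N by rewrite ltnS (leq_trans (leq_addr e i) ik).
rewrite mE; under [RHS]eq_bigr => j _ do rewrite apD monoD.
rewrite big_split /=; congr (_ + _).
rewrite (bigD1 (Ordinal ik'))//= eqxx hom_cast_id big1 ?addr0// => j ji.
by rewrite ifN ?mono0//; move: ji; apply: contra => /eqP ji; apply/eqP/val_inj.
Qed.

Lemma lowers_matrix e T : lowers e T -> exists m : forall i k, symHom k i,
  (forall i k, (k < i + e)%N -> m i k = 0) /\
  forall k (f : symt k), T (mono f) = \sum_(i < k.+1) mono (ap (m i k) f).
Proof.
move=> [_ TF].
have H k : {m : forall i, symHom k i | (forall i, (k < i + e)%N -> m i = 0) /\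
    forall f, T (mono f) = \sum_(i < k.+1) mono (ap (m i) f)}.
  apply: cid; have [F lF FE] := TF k; have [m [m0 mE]] := lowform_matrix lF.
  by exists m; split=> // f; rewrite FE mE.
exists (fun i k => projT1 (cid (ex_intro _ (sval (H k)) (svalP (H k)))) i).
by split=> [i k|k f]; case: cid => m [m0 mE] /=; [exact: m0|exact: mE].
Qed.

Lemma matrix_lowers e (T : polyt -> polyt) (m : forall i k, symHom k i) : plinear T ->
  (forall i k, (i <= k)%N -> (k < i + e)%N -> m i k = 0) ->
  (forall k (f : symt k), T (mono f) = \sum_(i < k.+1) mono (ap (m i k) f)) -> lowers e T.
Proof.
move=> Tl m0 mE; split=> // k.
exists (fun f => \sum_(i < k.+1 | (i + e <= k)%N) mono (ap (m i k) f)).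
  by apply: lowform_sum => i ik; exact: lowform1.
move=> f; rewrite mE [RHS]big_mkcond; apply: eq_bigr => i _; case: leqP => // ki.
by rewrite m0 ?mono0// -ltnS.
Qed.

(** The vanishing of the diagonal entries is what makes the degree drop. *)
Lemma V_lowers (V : VPhi) : lowers 1 V.
Proof.
have /asboolP[m [[m0 mE] m1]] := valP (V : Vt Phi).
apply: (@matrix_lowers 1 _ m); first exact: op_plinear.
  by move=> i k ik; rewrite addn1 ltnS => ki; rewrite (@anti_leq i k) ?m1// ik ki.
move=> k f; apply: polytP => w; rewrite pval_sum -[LHS]/(Vt_op V (mono f) w) mE.
by apply: eq_bigr.
Qed.

Lemma lowers_in_V (P : Op) : lowers 1 P -> P \in @in_V R Phi.
Proof.
move=> lP; have [m [m0 mE]] := lowers_matrix lP; apply/asboolP; exists m; split; [split|].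
- by move=> i k ki; apply: m0; rewrite addn1 ltnS ltnW.
- by move=> k f w; rewrite mE pval_sum.
- by move=> k; apply: m0; rewrite addn1.
Qed.

Lemma to_VE T p : lowers 1 T -> (to_V (to_op T) : Op) p = T p.
Proof.
move=> lT; have lT0 := lowers_mono (leq0n 1) lT.
rewrite /to_V /V_op insubdK ?to_opE//; apply: lowers_in_V.
by apply: lowers_ext lT => q; rewrite to_opE.
Qed.

Lemma VP (V W : VPhi) : (forall p, V p = W p) -> V = W.
Proof. by move=> VW; apply: val_inj; apply: OpP => p; exact: VW. Qed.

Lemma VP_mono (V W : VPhi) : (forall k (f : symt k) w, V (mono f) w = W (mono f) w) -> V = W.
Proof.
move=> VW; apply: VP; apply: plinear_ext => [||k f]; do ?exact: op_plinear.
by apply: polytP => w; exact: VW.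
Qed.

End Operators.

(** * Polynomial curves *)

Section Quotients.
Context (R : realType) (E : tvsType R[i]).
Local Notation C := R[i].

Lemma tvs_cvgD (X : Type) (F : set_system X) (f g : X -> E) a b : Filter F ->
  f @ F --> a -> g @ F --> b -> (fun x => f x + g x) @ F --> a + b.
Proof.
move=> FF fa gb A nA; have H := @cvg_pair _ _ _ F (nbhs a) (nbhs b) FF (nbhs_filter a) (nbhs_filter b) f g fa gb.
exact: (H _ (@add_continuous E (a, b) A nA)).
Qed.

Lemma tvs_cvgZ (X : Type) (F : set_system X) (f : X -> C) (g : X -> E) (a : C) b : Filter F ->
  f @ F --> (a : C^o) -> g @ F --> b -> (fun x => f x *: g x) @ F --> a *: b.
Proof.
move=> FF fa gb A nA.
have H := @cvg_pair _ _ _ F (nbhs (a : C^o)) (nbhs b) FF (nbhs_filter (a : C^o)) (nbhs_filter b)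
  f g fa gb.
exact: (H _ (@scale_continuous _ E ((a : C^o), b) A nA)).
Qed.

Lemma poly_curve_cvg (X : Type) (F : set_system X) (phi : X -> C) : Filter F ->
  phi @ F --> (0 : C^o) -> forall N (u : nat -> E),
  (fun x => \sum_(i < N.+1) phi x ^+ i *: u i) @ F --> u 0%N.
Proof.
move=> FF phi0; elim=> [|N IH] u.
  rewrite (_ : (fun x => _) = (fun=> u 0%N)); first exact: cvg_cst.
  by apply/funext => x; rewrite big_ord1 expr0 scale1r.
rewrite (_ : (fun x => _) = (fun x => u 0%N + phi x *: \sum_(i < N.+1) phi x ^+ i *: u i.+1)).
  have u0 : (fun=> u 0%N) @ F --> u 0%N by exact: cvg_cst.
  have := tvs_cvgD FF u0 (tvs_cvgZ FF phi0 (IH (fun i => u i.+1))).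
  by rewrite scale0r addr0.
apply/funext => x; rewrite big_ord_recl expr0 scale1r; congr (_ + _).
rewrite scaler_sumr; apply: eq_bigr => i _.
by rewrite scalerA -exprS.
Qed.

(** Stated for a parameter [phi] in order to serve real and complex curves at once. *)
Lemma poly_quotient_cvg (X : Type) (F : set_system X) (phi : X -> C) : Filter F ->
  phi @ F --> (0 : C^o) -> (\forall x \near F, phi x != 0) -> forall N (u : nat -> E),
  (fun x => (phi x)^-1 *: (\sum_(i < N.+2) phi x ^+ i *: u i - u 0%N)) @ F --> u 1%N.
Proof.
move=> FF phi0 phin0 N u.
have H : (fun x => \sum_(i < N.+1) phi x ^+ i *: u i.+1) @ F --> u 1%N.
  exact: (@poly_curve_cvg _ _ _ FF phi0 N (fun i => u i.+1)).
apply: (cvg_trans _ H).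
apply: near_eq_cvg; apply: filterS phin0 => x phix.
rewrite [in RHS]big_ord_recl expr0 scale1r addrAC subrr add0r scaler_sumr.
by apply: eq_bigr => i _; rewrite /= /bump leq0n add1n exprS !scalerA mulrA mulVf// mul1r.
Qed.

End Quotients.

Section Derive.
Context (R : realType).
Local Notation C := R[i].

Lemma derive1_poly N (c : nat -> C) :
  derive1 ((fun h : C => \sum_(i < N.+2) h ^+ i * c i) : C -> C^o) 0 = c 1%N.
Proof.
rewrite /derive1; apply: cvg_lim; first exact: (@norm_hausdorff _ (C^o : normedModType C)).
have FF : Filter (0 : C^o)^' by exact: dnbhs_filter.
have := @poly_quotient_cvg R C^o C (0 : C^o)^' id FF _ _ N c.
have id0 : id @ (0 : C^o)^' --> (0 : C^o) by exact: nbhs_dnbhs.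
have n0 : \forall x \near (0 : C^o)^', x != 0 by exact: (@nbhs_dnbhs_neq (C^o : topologicalType) 0).
move=> /(_ id0 n0) H; apply: (cvg_trans _ H).
apply: near_eq_cvg; apply: nearW => h /=; rewrite addr0; congr (_ *: (_ - _)).
by rewrite big_ord_recl expr0 mul1r big1 ?addr0// => i _; rewrite exprS !mul0r.
Qed.

End Derive.

(** * Gradients *)

Section Gradient.
Context (R : realType) (Phi : LBspace R).
Local Notation C := R[i].
Local Notation dual := (dual Phi).
Local Notation forms := (seq dual -> C^o).
Local Notation symt := (@symt R Phi).
Local Notation symHom := (@symHom R Phi).
Local Notation polyt := (polyt Phi).
Local Notation sser := (sser Phi).
Local Notation ser := (ser Phi).
Local Notation sexp := (@sexp R Phi).
Implicit Types (s u v : seq dual) (w : dual) (n k m l e : nat) (p q : polyt).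

Lemma dir_derivs N (g : forall j, symt j) (p : dual -> C^o) :
  (forall w, p w = \sum_(j < N) dot w (g j)) -> forall s w,
  foldr (@dir_deriv R Phi) p s w =
    \sum_(j < N) (j ^_ (size s))%:R * g j (s ++ nseq (j - size s) w).
Proof.
move=> pE; elim=> [|x s IH] w /=.
  by rewrite pE; apply: eq_bigr => j _; rewrite ffactn0 mul1r subn0.
set k := size s in IH *.
pose c i : C := \sum_(j < N) (j ^_ k)%:R * ('C(j - k, i)%:R *
  g j (s ++ nseq i x ++ nseq (j - k - i) w)).
have H (h : C) : foldr (@dir_deriv R Phi) p s (w + h *: x) = \sum_(i < N.+2) h ^+ i * c i.
  rewrite IH; under [RHS]eq_bigr => i _ do rewrite mulr_sumr.
  rewrite exchange_big; apply: eq_bigr => j _.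
  rewrite addrC (multilin_binom _ _ _ _ _ (symt_multilin (g j)) (symt_permsym (g j))).
  rewrite mulr_sumr.
  have jN : ((j - k).+1 <= N.+2)%N.
    by rewrite ltnS (leq_trans (leq_subr _ _))// ltnW// ltnS ltnW.
  rewrite (big_ord_widen N.+2 (fun i => (j ^_ k)%:R * ('C(j - k, i)%:R * h ^+ i *
    g j (s ++ nseq i x ++ nseq (j - k - i) w))) jN) big_mkcond.
  apply: eq_bigr => i _; case: ltnP => ij; first by ring.
  by rewrite bin_small// mul0r !mulr0.
rewrite /dir_deriv (_ : (fun h : C => _) = (fun h : C => \sum_(i < N.+2) h ^+ i * c i)); last first.
  exact/funext.
rewrite derive1_poly /c; apply: eq_bigr => j _.
rewrite bin1 mulrA -natrM -ffactnSr; congr (_ * _).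
have -> : (j - k - 1)%N = (j - k.+1)%N by rewrite -subnDA addn1.
apply: symt_permsym; rewrite /= -cat1s perm_sym -(cat1s x (s ++ _)).
by rewrite perm_catCA.
Qed.

(** The gradient as given by Taylor expansion; [grad] itself is a choice among the
    tensors with the right values. *)
Definition grad_poly N (g : forall j, symt j) k w : symt k :=
  \sum_(j < N) (j ^_ k)%:R *: to_symt k (slice (nseq (j - k) w) (g j)).

Lemma grad_polyE N (g : forall j, symt j) k (p : dual -> C^o) w :
  (forall w, p w = \sum_(j < N) dot w (g j)) -> grad k p w = grad_poly N g k w.
Proof.
move=> pE.
have val s : size s = k ->
    foldr (@dir_deriv R Phi) p s w = grad_poly N g k w s.
  move=> sk; rewrite (dir_derivs pE) /grad_poly val_sum; apply: eq_bigr => j _.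
  rewrite sk valZ; have [kj|jk] := leqP k j; last by rewrite ffact_small// !mul0r.
  congr (_ * _); have [n gn] := symt_stens (g j).
  have gn' : stens n (j - k + k) (g j) by rewrite subnK.
  rewrite (to_symtE (slice_stens gn' (size_nseq _ _))) /slice.
  by apply: symt_permsym; rewrite perm_catC.
rewrite /grad; apply: xget_unique => // g' g'E; apply: symtP => s.
have [sk|/eqP sk] := eqVneq (size s) k; last by rewrite !symt_off.
by rewrite -g'E// val.
Qed.

Section Nabla.
Context (c : dual -> sser).
Hypothesis cH : forall j l, (l < j)%N -> exists i (h : symHom j i), (i < j)%N /\
  forall w (f : symt j), dot w (ap h f) = coef (c w) (to_symt (j - l) (slice (nseq l w) f)).

Definition nabla_term k p : polyt := to_poly (fun w => coef (c w) (grad k p w)).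

Lemma coef_fsum (a : sser) k I (r : seq I) (P : pred I) (F : I -> symt k) :
  coef a (\sum_(x <- r | P x) F x) = \sum_(x <- r | P x) coef a (F x).
Proof. by rewrite /coef ap_fsum val_sum. Qed.

Lemma coef_fZ (a : sser) k z (f : symt k) : coef a (z *: f) = z * coef a f.
Proof. by rewrite /coef ap_fZ valZ. Qed.

Lemma nabla_termE N (g : forall j, symt j) k w : (0 < k)%N ->
  nabla_term k (\sum_(j < N) mono (g j)) w =
  \sum_(j < N) (j ^_ k)%:R * coef (c w) (to_symt k (slice (nseq (j - k) w) (g j))).
Proof.
move=> k0; have pE w' : (\sum_(j < N) mono (g j)) w' = \sum_(j < N) dot w' (g j).
  by rewrite pval_sum.
have fE w' : coef (c w') (grad k (\sum_(j < N) mono (g j)) w') =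
    \sum_(j < N) (j ^_ k)%:R * coef (c w') (to_symt k (slice (nseq (j - k) w') (g j))).
  rewrite (grad_polyE _ _ pE) /grad_poly coef_fsum; apply: eq_bigr => j _.
  exact: coef_fZ.
rewrite -fE /nabla_term /to_poly -[LHS]/(val (insubd _ _) w) insubdK//.
rewrite (_ : (fun w' => _) = (fun w' => \sum_(j < N) (j ^_ k)%:R *
   coef (c w') (to_symt k (slice (nseq (j - k) w') (g j))))); last exact/funext.
have key j : exists q : polyt, forall w',
    q w' = (j ^_ k)%:R * coef (c w') (to_symt k (slice (nseq (j - k) w') (g j))).
  have [kj|jk] := leqP k j; last first.
    by exists 0 => w'; rewrite ffact_small// mul0r.
  have lj : (j - k < j)%N by rewrite ltn_subrL k0 (leq_trans k0 kj).
  have [i [h [_ hE]]] := cH lj; exists ((j ^_ k)%:R *: mono (ap h (g j))) => w'.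
  by rewrite pvalZ monoE hE (coef_castm _ _ (subKn kj)).
have /choice[q qE] := key.
have -> : (fun w' => \sum_(j < N) (j ^_ k)%:R *
   coef (c w') (to_symt k (slice (nseq (j - k) w') (g j)))) = val (\sum_(j < N) q j).
  apply/funext => w'; rewrite -[RHS]/((\sum_(j < N) q j) w') pval_sum.
  by apply: eq_bigr => j _; rewrite qE.
exact: valP.
Qed.

Lemma nabla_term_lowers k : (0 < k)%N -> lowers 1 (nabla_term k).
Proof.
move=> k0; split=> [z p q|j].
  have [K [f [g [-> ->]]]] := poly_decomp2 p q.
  have E : z *: \sum_(k < K) mono (f k) + \sum_(k < K) mono (g k) =
      \sum_(k < K) mono (z *: f k + g k).
    by rewrite scaler_sumr -big_split; apply: eq_bigr => i _; rewrite mono_lin.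
  apply: polytP => w; rewrite E (nabla_termE _ (fun k => z *: f k + g k))//.
  rewrite pvalD pvalZ !nabla_termE// mulr_sumr -big_split; apply: eq_bigr => j _ /=.
  have [kj|jk] := leqP k j; last by rewrite ffact_small// !mul0r mulr0 addr0.
  rewrite mulrCA -mulrDr; congr (_ * _); rewrite -coef_lin; congr (coef _ _).
  have [n [fn gn]] := symt_pair (f j) (g j).
  have fgn : stens n j (z *: f j + g j : symt j).
    by have [_ H] := stens_lin Phi n j; exact: (H z _ _ fn gn).
  have ek : (j : nat) = (j - k + k)%N by rewrite subnK.
  have sl h : stens n j h -> stens n k (slice (nseq (j - k) w) h).
    by move=> /(stens_cast ek) hn; apply: (slice_stens hn); rewrite size_nseq.
  apply: symtP => s; rewrite val_lin (to_symtE (sl _ fn)) (to_symtE (sl _ gn)).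
  by rewrite (to_symtE (sl _ fgn)).
have [kj|jk] := leqP k j; last first.
  exists (fun=> 0) => [|f]; first exact: lowform0.
  have [g ->] := mono_as_sum f; apply: polytP => w; rewrite nabla_termE// big1// => i _.
  by rewrite ffact_small ?mul0r// (leq_trans (ltn_ord i)).
have lj : (j - k < j)%N by rewrite ltn_subrL k0 (leq_trans k0 kj).
have [i [h [ij hE]]] := cH lj.
exists (fun f => (j ^_ k)%:R *: mono (ap h f)).
  by apply: lowform_scale; apply: lowform1; rewrite addn1.
move=> f; apply: polytP => w.
rewrite pvalZ monoE hE (coef_castm _ _ (subKn kj)).
pose g l : symt l := if l == j then to_symt l f else 0.
have -> : mono f = \sum_(l < j.+1) mono (g l).
  rewrite big_ord_recr /= /g eqxx to_symtK big1 ?add0r// => l _.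
  by rewrite ifN ?mono0// neq_ltn ltn_ord.
rewrite nabla_termE// big_ord_recr /= /g eqxx to_symtK big1 ?add0r// => l _.
rewrite ifN ?neq_ltn ?ltn_ord// (_ : to_symt k _ = 0) ?/coef ?ap_f0 ?mulr0//.
by apply: symtP => s; rewrite /to_symt /= insubdK//; apply: rpred0.
Qed.

Lemma nabla_term_mono k j (f : symt j) w : (0 < k)%N -> nabla_term k (mono f) w =
  (j ^_ k)%:R * coef (c w) (to_symt k (slice (nseq (j - k) w) f)).
Proof.
move=> k0; pose g l : symt l := if l == j then to_symt l f else 0.
have -> : mono f = \sum_(l < j.+1) mono (g l).
  rewrite big_ord_recr /= /g eqxx to_symtK big1 ?add0r// => l _.
  by rewrite ifN ?mono0// neq_ltn ltn_ord.
rewrite nabla_termE// big_ord_recr /= /g eqxx to_symtK big1 ?add0r// => l _.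
rewrite ifN ?neq_ltn ?ltn_ord// (_ : to_symt k _ = 0) ?/coef ?ap_f0 ?mulr0//.
by apply: symtP => s; rewrite /to_symt /= insubdK//; apply: rpred0.
Qed.

Definition nabla p : polyt := \sum_(k \in [set k | (1 <= k)%N]) nabla_term k p.

Let term k : polyt -> polyt := if (0 < k)%N then nabla_term k else fun=> 0.

Let term_locfinite : locfinite term.
Proof.
move=> k; rewrite /term; case: posnP => [_|k0].
  by split=> // z p q; rewrite scaler0 addr0.
split=> [|j f jk]; first by have [] := nabla_term_lowers k0.
by apply: polytP => w; rewrite nabla_term_mono// ffact_small// mul0r.
Qed.

Let nabla_locsum p : nabla p = locsum [set k | (1 <= k)%N] (fun=> 1) term p.
Proof.
by apply: eq_fsbigr => k /set_mem /= k0; rewrite scale1r /term k0.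
Qed.

Lemma nabla_lowers : lowers 1 nabla.
Proof.
apply: (lowers_ext (fun p => esym (nabla_locsum p))).
apply: lowers_locsum; first exact: term_locfinite.
by move=> k /set_mem /= k0; rewrite /term k0; exact: nabla_term_lowers.
Qed.

(** The sum of the gradients paired with [c w] is the product of [e^w] by [c w]: the gradient of
    order [k] of a monomial is its slice at copies of [w]. *)
Lemma nabla_mono k (f : symt k) w : c w 0%N = 0 ->
  nabla (mono f) w = k`!%:R * coef (sexp w * c w) f.
Proof.
move=> c0; rewrite nabla_locsum (locsum_mono _ _ _ term_locfinite (leqnn k.+1)).
rewrite pval_sum coef_mul mulr_sumr (reindex_inj rev_ord_inj) big_mkcond /=.
apply: eq_bigr => l _; have lk : (l <= k)%N by rewrite -ltnS.
rewrite subSS scale1r.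
have [n fst] := symt_stens f.
have fst' : stens n (l + (k - l)) f by rewrite subnKC.
rewrite (coef_sexp_to_symt _ (partial_app_stens _ fst')) /partial_app /slice_app.
rewrite -/(coef (c w) _); have [kl|kl] := posnP (k - l)%N.
  rewrite memNset; last by rewrite /= kl.
  by rewrite /coef kl c0 ap0 !mulr0.
rewrite mem_set// /term kl nabla_term_mono// subKn// mulrA; congr (_ * _).
rewrite -(ffact_fact (leq_subr l k)) subKn// natrM mulfK//.
Qed.

End Nabla.

Lemma alpha_entry (a : sser) j l : (l < j)%N -> exists i (h : symHom j i), (i < j)%N /\
  forall w (f : symt j), dot w (ap h f) = coef a (to_symt (j - l) (slice (nseq l w) f)).
Proof.
move=> lj; have ek := subnKC (ltnW lj).
exists l, (hom_cast j l (odot (id_hom Phi l) (a (j - l)%N))); split=> // w f.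
rewrite {1}/dot (hom_castE _ _ ek (addn0 l)) odotE symz_nseq /tensor_app.
rewrite take_oversize ?size_nseq// drop_oversize ?size_nseq//.
have [n fst] := symt_stens f; have fst' := stens_cast (esym ek) fst.
rewrite (to_symtE fst').
have sst := partial_app_stens (a (j - l)%N) fst'.
by rewrite -/(partial_app _ _) id_homE (to_symtE sst).
Qed.

Lemma beta_entry (b : ser 1) j l : b 1%N = 0 -> (l < j)%N ->
  exists i (h : symHom j i), (i < j)%N /\
  forall w (f : symt j), dot w (ap h f) =
    coef (sdot w b) (to_symt (j - l) (slice (nseq l w) f)).
Proof.
move=> b1 lj; have [lj1|] := ltnP l.+1 j.
  exists l.+1, (theta b j l.+1); split=> // w f.
  rewrite dot_theta /=; last by rewrite ltnW.
  by rewrite coef_sdot subnSK.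
move=> jl; exists 0%N, 0; split=> [|w f]; first exact: leq_ltn_trans lj.
have E : (j - l)%N = 1%N.
  by have /eqP -> : j == l.+1; rewrite ?eqn_leq ?jl ?lj// subSnn.
by rewrite ap0 dot0 coef_sdot E b1 ap0 dot0.
Qed.

Lemma alpha_nablaE (a : sser) p : alpha_nabla a p = nabla (fun=> a) p.
Proof.
rewrite /alpha_nabla to_VE//; apply: nabla_lowers => j l lj.
exact: alpha_entry.
Qed.

Lemma M_nablaE (b : ser 1) p : b 1%N = 0 -> M_nabla b p = nabla (fun w => sdot w b) p.
Proof.
move=> b1; have E q : \sum_(k \in [set k | (2 <= k)%N])
    to_poly (fun w => dot w (ap (b k) (grad k q w))) = nabla (fun w => sdot w b) q.
  rewrite /nabla (fsbig_widen [set k | (2 <= k)%N] [set k | (1 <= k)%N]) /=; last 2 first.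
  - by move=> k /ltnW.
  - move=> k [/= k0 /negP]; rewrite -leqNgt => k1.
    have -> : k = 1%N by apply/eqP; rewrite eqn_leq k0 k1.
    rewrite (_ : (fun w => _) = 0); last by apply/funext => w; rewrite b1 ap0 dot0.
    by apply: polytP => w; rewrite /to_poly -[LHS]/(val (insubd _ _) w) insubdK ?rpred0.
  apply: eq_fsbigr => k _; congr to_poly; apply/funext => w.
  by rewrite coef_sdot.
rewrite /M_nabla to_VE ?E//.
apply: (lowers_ext (fun q => esym (E q))); apply: nabla_lowers => j l lj.
exact: beta_entry.
Qed.

Lemma alpha_nabla_mono (a : sser) k (f : symt k) w : a 0%N = 0 ->
  alpha_nabla a (mono f) w = k`!%:R * coef (sexp w * a) f.
Proof.
move=> a0; rewrite alpha_nablaE (@nabla_mono (fun=> a))// => j l lj.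
exact: alpha_entry.
Qed.

Lemma M_nabla_mono (b : ser 1) k (f : symt k) w : b 0%N = 0 -> b 1%N = 0 ->
  M_nabla b (mono f) w = k`!%:R * coef (sexp w * sdot w b) f.
Proof.
move=> b0 b1; rewrite M_nablaE// (@nabla_mono (fun w => sdot w b))// => [j l lj|].
  exact: beta_entry.
by apply: symHomP => g; apply: symt0P; rewrite -/(coef (sdot w b) g) coef_sdot b0 ap0 dot0.
Qed.

End Gradient.

(** * Exponential and logarithm as polynomial identities *)

Section LogExp.
Context (R : realType) (U : lmodType R[i]) (V : U -> U).
Local Notation C := R[i].
Hypothesis Vl : forall c p q, V (c *: p + q) = c *: V p + V q.
Implicit Types (P Q : {poly C}) (p : U).

(** Substitution of an operator for the variable of a polynomial, pointwise so that no ring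
    of operators is involved. *)
Definition opoly P p : U := \sum_(i < size P) P`_i *: iter i V p.

Let V0 : V 0 = 0.
Proof. by have := Vl (-1) 0 0; rewrite scaler0 addr0 scaleN1r addNr. Qed.

Let VZ c p : V (c *: p) = c *: V p.
Proof. by have := Vl c p 0; rewrite !addr0 V0 addr0. Qed.

Let VD p q : V (p + q) = V p + V q.
Proof. by have := Vl 1 p q; rewrite !scale1r. Qed.

Lemma opoly_widen P p N : (size P <= N)%N -> opoly P p = \sum_(i < N) P`_i *: iter i V p.
Proof.
move=> PN; rewrite /opoly (big_ord_widen N (fun i => P`_i *: iter i V p) PN) big_mkcond.
by apply: eq_bigr => i _; case: ltnP => // Pi; rewrite nth_default// scale0r.
Qed.

Lemma opoly_lin c P Q p : opoly (c *: P + Q) p = c *: opoly P p + opoly Q p.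
Proof.
pose N := maxn (size (c *: P + Q)) (maxn (size P) (size Q)).
rewrite !(@opoly_widen _ _ N) ?leq_max ?leqnn ?orbT// scaler_sumr -big_split.
by apply: eq_bigr => i _; rewrite /= coefD coefZ scalerDl scalerA.
Qed.

Lemma opoly0 p : opoly 0 p = 0.
Proof. by rewrite /opoly size_poly0 big_ord0. Qed.

Lemma opolyD P Q p : opoly (P + Q) p = opoly P p + opoly Q p.
Proof. by have := opoly_lin 1 P Q p; rewrite !scale1r. Qed.

Lemma opolyZ c P p : opoly (c *: P) p = c *: opoly P p.
Proof. by have := opoly_lin c P 0 p; rewrite !addr0 opoly0 addr0. Qed.

Lemma opoly_sum I (r : seq I) (B : pred I) (F : I -> {poly C}) p :
  opoly (\sum_(x <- r | B x) F x) p = \sum_(x <- r | B x) opoly (F x) p.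
Proof. by elim/big_rec2: _ => [|x y z _ <-]; rewrite ?opoly0 ?opolyD. Qed.

Lemma opoly1 p : opoly 1 p = p.
Proof. by rewrite /opoly size_poly1 big_ord1 coef1 scale1r. Qed.

Lemma opolyMX P p : opoly (P * 'X) p = V (opoly P p).
Proof.
have sz : (size (P * 'X)%R <= (size P).+1)%N.
  have [->|P0] := eqVneq P 0; first by rewrite mul0r size_poly0.
  by rewrite size_mulX.
rewrite (opoly_widen _ sz) big_ord_recl coefMX eqxx scale0r add0r /opoly.
have Vsum n (F : nat -> U) : V (\sum_(i < n) F i) = \sum_(i < n) V (F i).
  by elim/big_rec2: _ => [|i y z _ <-]; [exact: V0|exact: VD].
rewrite (Vsum _ (fun i => P`_i *: iter i V p)); apply: eq_bigr => i _.
by rewrite coefMX /= VZ.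
Qed.

Lemma opolyX p : opoly 'X p = V p.
Proof. by have := opolyMX 1 p; rewrite mul1r opoly1. Qed.

Lemma opolyM P Q p : opoly (P * Q) p = opoly P (opoly Q p).
Proof.
elim/poly_ind: P => [|P c IH]; first by rewrite mul0r !opoly0.
rewrite mulrDl opolyD opolyD; congr (_ + _).
  by rewrite -mulrA -commr_polyX mulrA !opolyMX IH.
by rewrite -!alg_polyC mulrC -scalerAr !opolyZ mulr1 opoly1.
Qed.

Lemma opolyXn n p : opoly ('X^n) p = iter n V p.
Proof. by elim: n => [|n IH]; rewrite ?opoly1// exprSr opolyMX IH. Qed.

(** Only the coefficients below the order of nilpotency matter. *)
Lemma opoly_nil P p k : iter k.+1 V p = 0 -> (forall i, (i <= k)%N -> P`_i = 0) ->
  opoly P p = 0.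
Proof.
move=> pk P0; rewrite /opoly big1// => i _; have [ik|ki] := leqP i k.
  by rewrite P0// scale0r.
rewrite -(subnK ki) iterD pk (_ : iter _ V 0 = 0) ?scaler0//.
by elim: (_ - _)%N => //= n ->.
Qed.

Lemma opoly_iter_nil P p k : iter k V p = 0 -> iter k V (opoly P p) = 0.
Proof.
move=> pk; rewrite -opolyXn -opolyM mulrC opolyM opolyXn pk /opoly big1// => i _.
rewrite (_ : iter _ V 0 = 0) ?scaler0//.
by elim: (nat_of_ord i) => //= n ->.
Qed.

End LogExp.

Section LogExpPoly.
Context (F : numFieldType).

Definition exp_poly k : {poly F} := \sum_(m < k.+1) (m`!%:R)^-1 *: 'X^m.

Definition log_poly k (Y : {poly F}) : {poly F} :=
  \sum_(1 <= n < k.+1) ((-1) ^+ n.+1 / n%:R) *: Y ^+ n.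

Lemma coef_exp_poly k j : (exp_poly k)`_j = if (j <= k)%N then (j`!%:R)^-1 else 0.
Proof.
rewrite /exp_poly coef_sum; case: leqP => jk.
  have jk' : (j < k.+1)%N by [].
  rewrite (bigD1 (Ordinal jk'))//= coefZ coefXn eqxx mulr1 big1 ?addr0// => i ij.
  have /negbTE ji : j != i by move: ij; apply: contra => /eqP ji; apply/eqP/val_inj.
  by rewrite coefZ coefXn ji mulr0.
rewrite big1// => i _; rewrite coefZ coefXn gtn_eqF ?mulr0//.
exact: leq_trans (ltn_ord i) jk.
Qed.

Lemma deriv_exp_poly k : (exp_poly k)^`() = exp_poly k - (k`!%:R)^-1 *: 'X^k.
Proof.
apply/polyP => j; rewrite coef_deriv coefB coefZ coefXn !coef_exp_poly.
have [jk|jk] := ltnP j k.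
  rewrite ltnW// ltn_eqF// mulr0 subr0 -[LHS]mulr_natl factS natrM invfM mulrA.
  by rewrite mulfV ?mul1r// pnatr_eq0.
rewrite mul0rn; have [<-|kj] := eqVneq j k; first by rewrite leqnn mulr1 subrr.
by rewrite leqNgt ltn_neqAle jk eq_sym kj mulr0 subr0.
Qed.

(** Truncated form of [log (exp X) = X]: the derivative of the left-hand side is a
    geometric sum. *)
Lemma log_exp_poly k i : (i <= k)%N -> (log_poly k (exp_poly k - 1))`_i = ('X : {poly F})`_i.
Proof.
set Y := exp_poly k - 1; set L := log_poly k Y.
pose G : {poly F} := \sum_(n < k) (- Y) ^+ n.
have Y0 : Y`_0 = 0 by rewrite /Y coefB coef_exp_poly coef1 /= fact0 invr1 subrr.
have YX : exists Z, Y = Z * 'X.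
  exists (drop_poly 1 Y); rewrite -{1}(poly_take_drop 1 Y) (_ : take_poly 1 Y = 0) ?add0r//.
  by apply/polyP => -[|j]; rewrite coef_take_poly coef0.
(* [L' = G Y'] with [G] the partial sum of [1 / (1 + Y)]. *)
have dL : L^`() = G * (exp_poly k)^`().
  rewrite /L /log_poly big_add1 /= big_mkord raddf_sum /G mulr_suml; apply: eq_bigr => n _.
  have dY : Y^`() = (exp_poly k)^`() by rewrite /Y derivB derivC subr0.
  rewrite /= derivZ deriv_exp /= dY -scalerMnr scalerMnl.
  have -> : ((-1) ^+ n.+2 / n.+1%:R) *+ n.+1 = (-1) ^+ n :> F.
    rewrite -[LHS]mulr_natr divfK ?pnatr_eq0//.
    by rewrite !exprS !mulN1r opprK.
  have s1 : (-1 : {poly F}) ^+ n = ((-1) ^+ n)%:P by rewrite polyC_exp polyCN.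
  by rewrite [(- Y) ^+ n]exprNn s1 mul_polyC -scalerAl [_^`() * _]mulrC.
have GE : G * exp_poly k = 1 - (- Y) ^+ k.
  have -> : exp_poly k = 1 - (- Y) by rewrite opprK /Y addrCA subrr addr0.
  rewrite mulrC -[1 - _ in LHS]opprB mulNr -subrX1 opprB//.
have [Z YZ] := YX.
have dL0 j : (j < k)%N -> (L^`())`_j = (1 : {poly F})`_j.
  move=> jk; rewrite dL deriv_exp_poly mulrBr GE YZ -scalerAr.
  have c0 (Q : {poly F}) : (Q * 'X^k)`_j = 0 by rewrite coefMXn jk.
  by rewrite !coefB coefZ c0 mulr0 subr0 -mulNr exprMn_comm ?c0 ?subr0//; exact: commr_polyX.
case: i => [_|i ik].
  rewrite coefX /L /log_poly coef_sum big1_seq// => n; rewrite mem_index_iota => /andP[_ /andP[n0 _]].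
  by rewrite coefZ -(prednK n0) [Y ^+ _]exprS coef0M Y0 mul0r mulr0.
have := dL0 i ik; rewrite coef_deriv coef1 coefX => H.
have i1 : (i.+1%:R : F) != 0 by rewrite pnatr_eq0.
apply: (mulfI i1); rewrite mulr_natl H.
by case: i {ik H i1} => [|i]; rewrite /= ?mulr1 ?mulr0.
Qed.

End LogExpPoly.

(** * Exponentials of operators and generating functions *)

Section ExpLogOperators.
Context (R : realType) (Phi : LBspace R).
Local Notation C := R[i].
Local Notation dual := (dual Phi).
Local Notation forms := (seq dual -> C^o).
Local Notation symt := (@symt R Phi).
Local Notation symHom := (@symHom R Phi).
Local Notation polyt := (polyt Phi).
Local Notation Op := (Op Phi).
Local Notation VPhi := (VPhi Phi).
Local Notation sser := (sser Phi).
Local Notation ser := (ser Phi).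
Local Notation sexp := (@sexp R Phi).
Implicit Types (w : dual) (n k m l e : nat) (p q : polyt).

Lemma lowers_iter1 n T : lowers 1 T -> lowers n (iter n T : polyt -> polyt).
Proof. by move=> lT; have := lowers_iter n lT; rewrite muln1. Qed.

Lemma iter_mono_nil T k (f : symt k) : lowers 1 T -> iter k.+1 T (mono f) = 0.
Proof. by move=> lT; apply: lowers_vanish (lowers_iter1 k.+1 lT). Qed.

Lemma iter_nil (T : polyt -> polyt) p k n : plinear T -> iter k T p = 0 -> (k <= n)%N -> iter n T p = 0.
Proof.
move=> Tl pk kn; rewrite -(subnK kn) iterD pk.
by elim: (n - k)%N => //= j ->; exact: plinear0.
Qed.

Definition pexp (V : polyt -> polyt) p := locsum [set: nat] (fun n => (n`!%:R)^-1) (fun n => iter n V) p.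

Definition plog (N : polyt -> polyt) p :=
  locsum [set n | (0 < n)%N] (fun n => (-1) ^+ n.+1 / n%:R) (fun n => iter n N) p.

Lemma pexp_nil V p k : plinear V -> iter k V p = 0 ->
  pexp V p = \sum_(n < k) (n`!%:R)^-1 *: iter n V p.
Proof.
move=> Vl pk; rewrite /pexp /locsum (@fsbig_nat_trunc _ _ _ _ k).
  by apply: eq_bigl => n; rewrite in_setT.
by move=> n kn; rewrite (iter_nil Vl pk kn) scaler0.
Qed.

Lemma pexp_lowers V : lowers 1 V -> lowers 0 (pexp V).
Proof.
move=> lV; apply: lowers_locsum => [|n _].
  by apply: lowers_locfinite => n; exact: lowers_iter1.
exact: lowers_mono (leq0n n) (lowers_iter1 n lV).
Qed.

Lemma plog_lowers N : lowers 1 N -> lowers 1 (plog N).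
Proof.
move=> lN; apply: lowers_locsum => [|n /set_mem /= n0].
  by apply: lowers_locfinite => n; exact: lowers_iter1.
exact: lowers_mono n0 (lowers_iter1 n lN).
Qed.

Lemma pexp_sub1_lowers V : lowers 1 V -> lowers 1 (fun p => pexp V p - p).
Proof.
move=> lV; have [Vl _] := lV.
have lT : lowers 1 (locsum [set n | (0 < n)%N] (fun n => (n`!%:R)^-1) (fun n => iter n V)).
  apply: lowers_locsum => [|n /set_mem /= n0].
    by apply: lowers_locfinite => n; exact: lowers_iter1.
  exact: lowers_mono n0 (lowers_iter1 n lV).
apply: (lowers_ext _ lT); apply: plinear_ext => [||k f].
- by case: lT.
- move=> c p q; have [-> _] := pexp_lowers lV.
  by rewrite scalerBr opprD addrACA.
have lf : locfinite (fun n => iter n V) by apply: lowers_locfinite => n; exact: lowers_iter1.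
rewrite (pexp_nil Vl (iter_mono_nil f lV)) (locsum_mono _ _ f lf (leqnn k.+1)).
rewrite big_mkcond big_ord_recl [RHS]addrC big_ord_recl.
rewrite memNset//= add0r fact0 invr1 scale1r addrA addNr add0r; apply: eq_bigr => n _.
by rewrite mem_set.
Qed.

Lemma expVE (V : VPhi) p : expV V p = pexp V p.
Proof.
rewrite /expV to_opE//; apply: pexp_lowers; exact: V_lowers.
Qed.

Lemma logME (P : Op) : lowers 1 (fun p => P p - p) ->
  forall p, logM P p = plog (fun q => P q - q) p.
Proof. by move=> lP p; rewrite /logM to_VE//; exact: plog_lowers. Qed.

(** As [V] is nilpotent on each polynomial, this is a truncated polynomial identity. *)
Lemma plog_pexp V p k : lowers 1 V -> iter k.+1 V p = 0 ->
  plog (fun q => pexp V q - q) p = V p.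
Proof.
move=> lV pk; have [Vl _] := lV; pose N q := pexp V q - q.
pose Y : {poly C} := exp_poly C k - 1.
have nilY q n : iter k.+1 V q = 0 -> iter k.+1 V (opoly V (Y ^+ n) q) = 0.
  exact: (opoly_iter_nil Vl).
have NY q : iter k.+1 V q = 0 -> N q = opoly V Y q.
  move=> qk; rewrite /N (pexp_nil Vl qk) /Y.
  have -> : exp_poly C k - 1 = (-1) *: 1 + exp_poly C k by rewrite scaleN1r addrC.
  rewrite opoly_lin opoly1 scaleN1r addrC; congr (- _ + _).
  rewrite /exp_poly opoly_sum; apply: eq_bigr => n _.
  by rewrite opolyZ (opolyXn Vl).
have NYn n : iter n N p = opoly V (Y ^+ n) p.
  elim: n => [|n IH]; first by rewrite expr0 opoly1.
  by rewrite iterS IH NY ?nilY// exprS (opolyM Vl).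
have Nk n : (k < n)%N -> iter n N p = 0.
  move=> kn; rewrite NYn; apply: (opoly_nil Vl pk) => i ik.
  have Y0 : Y`_0 = 0 by rewrite /Y coefB coef_exp_poly coef1 /= fact0 invr1 subrr.
  have -> : Y = drop_poly 1 Y * 'X.
    rewrite -{1}(poly_take_drop 1 Y) (_ : take_poly 1 Y = 0) ?add0r//.
    by apply/polyP => -[|j]; rewrite coef_take_poly coef0.
  rewrite exprMn_comm; last exact: commr_polyX.
  by rewrite coefMXn (leq_ltn_trans ik kn).
rewrite /plog /locsum (@fsbig_nat_trunc _ _ _ _ k.+1); last first.
  by move=> n kn; rewrite Nk// scaler0.
have -> : \sum_(n < k.+1 | (n : nat) \in [set n | (0 < n)%N])
    ((-1) ^+ n.+1 / n%:R) *: iter n N p = opoly V (log_poly k Y) p.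
  rewrite /log_poly opoly_sum big_add1 big_mkord big_mkcond big_ord_recl.
  rewrite memNset// Monoid.mul1m; apply: eq_bigr => n _.
  by rewrite lift0 mem_set// opolyZ NYn.
rewrite -[RHS](opolyX Vl) -[opoly V 'X p]add0r.
have -> : log_poly k Y = (log_poly k Y - 'X) + 'X by rewrite subrK.
rewrite opolyD; congr (_ + _); apply: (opoly_nil Vl pk) => i ik.
by rewrite coefB /Y log_exp_poly// subrr.
Qed.

Lemma logM_expV (V : VPhi) : logM (expV V) = V.
Proof.
have lV := V_lowers V; have lE := pexp_sub1_lowers lV.
have lP : lowers 1 (fun p => expV V p - p).
  by apply: lowers_ext lE => p; rewrite expVE.
apply: VP; apply: plinear_ext => [||k f]; do ?exact: op_plinear.
have EN : (fun q => expV V q - q) = (fun q => pexp V q - q).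
  by apply/funext => q; rewrite expVE.
have EL := logME lP (mono f); have EV := plog_pexp lV (iter_mono_nil f lV).
by rewrite EN in EL; exact: etrans EL EV.
Qed.

Lemma in_M_lowers (P : Op) : lowers 1 (fun p => P p - p) -> in_M P.
Proof.
move=> lP; have [m [m0 mE]] := lowers_matrix lP.
exists (fun i k => (if k == i then hom_cast k i (id_hom Phi k) else 0) + m i k); split; [split|].
- by move=> i k ki; rewrite ltn_eqF// add0r m0// addn1 ltnS ltnW.
- move=> k f w; rewrite -[P (mono f)](subrK (mono f)) mE pvalD pval_sum addrC.
  under [RHS]eq_bigr => i _ do rewrite apD dotD.
  rewrite big_split /=; congr (_ + _).
  rewrite big_ord_recr /= eqxx hom_cast_id id_homE big1 ?add0r ?monoE// => i _.
  by rewrite gtn_eqF ?dot0.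
- by move=> k; rewrite eqxx hom_cast_id m0 ?addr0// addn1.
Qed.

Lemma in_M_expV (V : VPhi) : in_M (expV V).
Proof.
apply: in_M_lowers; apply: lowers_ext (pexp_sub1_lowers (V_lowers V)) => p.
by rewrite expVE.
Qed.

Lemma gen_fun_unique (P Q : Op) X : has_gen_fun P X -> has_gen_fun Q X -> P = Q.
Proof.
move=> PX QX; apply: OpP; apply: plinear_ext => [||k f]; do ?exact: op_plinear.
apply: polytP => w; have := PX w k f; rewrite -(QX w k f).
by apply: mulfI; rewrite invr_eq0 fact_neq0.
Qed.

Lemma Imap_eq (P : Op) X : in_M P -> has_gen_fun P X -> Imap X = P.
Proof.
move=> PM PX; rewrite /Imap; apply: xget_unique => // Q [_ QX].
exact: gen_fun_unique QX PX.
Qed.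

(** Through exponentials, an operator on polynomials acts on scalar series. This transposed
    action reverses the order of compositions. *)
Definition symbol (V : polyt -> polyt) (S : sser -> sser) :=
  forall k (f : symt k) w, V (mono f) w = k`!%:R * coef (S (sexp w)) f.

(** Both sides are finite functionals of [a w], so the case of exponentials suffices, where
    this is the definition of the symbol. *)
Lemma symbol_transpose (V : polyt -> polyt) S : lowers 0 V -> finite_map S -> symbol V S ->
  forall (T : polyt -> polyt) (a : dual -> sser), plinear T ->
  (forall k (f : symt k) w, T (mono f) w = k`!%:R * coef (a w) f) ->
  forall k (f : symt k) w, T (V (mono f)) w = k`!%:R * coef (S (a w)) f.
Proof.
move=> lV Sf VS T a Tl Ta k f w; have [m [_ mE]] := lowers_matrix lV.
rewrite mE plinear_sum// pval_sum.
under eq_bigr => i _ do rewrite Ta.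
apply/eqP; rewrite -subr_eq0; apply/eqP; move: (a w).
have fin : finite_functional (fun b => \sum_(i < k.+1) i`!%:R * coef b (ap (m i k) f) -
    k`!%:R * coef (S b) f).
  have F1 : finite_functional (fun b => \sum_(i < k.+1) i`!%:R * coef b (ap (m i k) f)).
    by apply: ff_sum => i; apply: ffZ; exact: ff_coef.
  apply: ff_ext (ff_lin (- k`!%:R) (Sf k f) F1) => b.
  by rewrite mulNr addrC.
apply: (ff_sexp_eq0 fin) => w'; rewrite -VS mE pval_sum -sumrB big1// => i _.
by rewrite coef_sexp mulrA mulfV ?fact_neq0// mul1r monoE subrr.
Qed.

Section VectorField.
Context (al : sser) (be : ser 1).
Hypotheses (al0 : al 0%N = 0) (be0 : be 0%N = 0) (be1 : be 1%N = 0).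

Definition vfield : VPhi := alpha_nabla al + M_nabla be.

Lemma VPhi_addE (V W : VPhi) p : (V + W : VPhi) p = V p + W p. Proof. by []. Qed.

Lemma VPhi_oppE (V : VPhi) p : (- V : VPhi) p = - V p. Proof. by []. Qed.

Lemma vfield_symbol : symbol vfield (sL al be).
Proof.
move=> k f w.
rewrite /vfield VPhi_addE.
apply: (etrans (pvalD (alpha_nabla al (mono f)) (M_nabla be (mono f)) w)).
have Ea := alpha_nabla_mono f w al0; have Eb := M_nabla_mono f w be0 be1.
apply: (etrans (f_equal2 +%R Ea Eb)).
rewrite -mulrDr -coef_add; congr (_ * coef _ f).
by rewrite /sL sD_sexp// addrC [al * _]mulrC.
Qed.

Lemma fm_sL : finite_map (sL al be).
Proof.
have mf : finite_map (fun a => al * a) by exact: fm_mull.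
move=> k f; apply: ff_ext (fm_lin 1 (fm_sD be) mf (k := k) f) => x.
by rewrite scale1r.
Qed.

Lemma iter_vfield n k (f : symt k) w :
  iter n vfield (mono f) w = k`!%:R * coef (iter n (sL al be) (sexp w)) f.
Proof.
have lV := V_lowers vfield.
elim: n k f w => [|n IH] k f w.
  rewrite -[iter 0 vfield _]/(mono f) -[iter 0 (sL al be) _]/(sexp w).
  by rewrite monoE coef_sexp mulrA mulfV ?fact_neq0// mul1r.
rewrite iterSr iterS.
have Tl : plinear (iter n vfield : polyt -> polyt) by have [] := lowers_iter1 n lV.
exact: (symbol_transpose (lowers_mono (leq0n 1) lV) fm_sL vfield_symbol
  (a := fun w => iter n (sL al be) (sexp w)) Tl IH).
Qed.

(** The generating function of [exp V] at [w] is [exp(L) e^w], the image of [e^w] under the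
    flow at time 1. *)
Lemma expV_gen_fun : has_gen_fun (expV vfield) (flowA al be 1, flowB be 1).
Proof.
move=> w k f; rewrite expVE.
have lV := V_lowers vfield; have [Vl _] := lV.
rewrite (pexp_nil Vl (iter_mono_nil f lV)) pval_sum.
rewrite [(_, _).1]/= [(_, _).2]/= sdotE sEXPE smulE -/(coef (_ : sser) f) -lexp_sL_sexp//.
rewrite /coef /lexp ap_sum val_sum mulr_sumr; apply: eq_bigr => n _.
rewrite pvalZ iter_vfield apZ valZ expr1n mul1r mulrCA; congr (_ * _).
by rewrite mulrA mulVf ?fact_neq0// mul1r.
Qed.

End VectorField.
End ExpLogOperators.

(** * Evaluation of operators *)

Section WeakDerivatives.
Context (R : realType) (Phi : LBspace R).
Local Notation C := R[i].
Local Notation dual := (dual Phi).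
Local Notation forms := (seq dual -> C^o).
Local Notation symt := (@symt R Phi).
Local Notation symHom := (@symHom R Phi).
Local Notation sser := (sser Phi).
Local Notation ser := (ser Phi).
Local Notation sexp := (@sexp R Phi).
Implicit Types (s : seq dual) (w : dual) (n k m l i : nat).

Lemma stens_scale n k c (f : forms) : stens n k f -> stens n k (c *: f).
Proof.
move=> fn; have [z lz] := stens_lin Phi n k.
by have := lz c f 0 fn z; rewrite addr0.
Qed.

(** The evaluation at [f] and [s] only depends on the restriction to a step containing [f],
    and is bounded there by the operator norm. *)
Lemma eval_seminorm k i (f : symt k) s : size s = i ->
  exists2 q : seminorm (clin (indlim (symc Phi k)) (indlim (symc Phi i))),
    hom_seminorms q & forall T : symHom k i, q T = `|ap T f s|.
Proof.
move=> si; have [n fst] := symt_stens f.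
have Fl : linear ((fun S => S f s) :
    ch_sort (hom_chain (symc Phi k) (symc Phi i) n) -> (C^o : lmodType C)).
  by move=> a S T; exact: (val_lin a (S f) (T f) s).
have Gl : linear ((fun S => S f s) :
    clin (indlim (symc Phi k)) (indlim (symc Phi i)) -> (C^o : lmodType C)).
  by move=> a S T; exact: (val_lin a (S f) (T f) s).
exists (sn_comp (abs_seminorm C) Gl) => //.
exists n, (sn_comp (abs_seminorm C) Fl) => // m.
pose N := inj_norm n k f + 1; have N0 : 0 < N by rewrite ltr_wpDl// inj_norm_ge0.
exists (N * \prod_(w <- s) dnorm m w) => S [Sl Sm [M SM]].
have S0 : S (0 : symt k) = 0.
  have z : step (c := symc Phi k) n (0 : symt k).
    by apply/stensP; have [z _] := stens_lin Phi n k; exact: z.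
  have := Sl (-1) 0 0 z z; rewrite scaler0 addr0 => ->.
  by rewrite scaleN1r addNr.
have z : step (c := symc Phi k) n (0 : symt k).
  by apply/stensP; have [z _] := stens_lin Phi n k; exact: z.
pose g : symt k := N^-1 *: f.
have gst : stens n k g by exact: (stens_scale N^-1 fst).
have gn : step (c := symc Phi k) n g by apply/stensP.
have g1 : inj_norm n k g <= 1.
  apply: inj_norm_le => // u uk; rewrite mul1r.
  have fb := bnd_inj_norm (proj1 fst) uk.
  rewrite valZ normrM gtr0_norm ?invr_gt0// ler_pdivrMl// (le_trans fb)//.
  by rewrite ler_wpM2r ?prod_dnorm_ge0// lerDl.
have fg : S f = N *: S g.
  have := Sl N g 0 gn z; rewrite addr0 S0 addr0 => <-.
  by rewrite /g scalerA mulfV ?gt_eqF// scale1r.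
rewrite /= /sn_comp_fun fg valZ normrM gtr0_norm// -mulrA ler_pM2l//.
have Sg := Sm _ gn; have /stensP[Si _] := Sg.
rewrite (le_trans (bnd_inj_norm Si si))// mulrC ler_wpM2l ?prod_dnorm_ge0//.
apply: (@csup_ub R _ `|M|) => [_ [x [xn x1] <-]|]; last by exists g.
have q0 := le_trans (inj_norm_ge0 m i (S x)) (SM x xn).
rewrite inj_norm_ge0 (le_trans (SM x xn))//= -(ger0_norm q0) normrM.
by rewrite (ger0_norm (inj_norm_ge0 _ _ _)) ler_piMr.
Qed.

End WeakDerivatives.

(** * Pointwise derivatives of curves *)

Section ScalarDerivatives.
Context (R : realType) (Phi : LBspace R).
Local Notation C := R[i].
Local Notation dual := (dual Phi).
Local Notation symt := (@symt R Phi).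
Local Notation symHom := (@symHom R Phi).
Local Notation sser := (sser Phi).
Local Notation ser := (ser Phi).
Implicit Types (s : seq dual) (w : dual) (n k m l i : nat).

(** Difference quotients of scalar curves, as [rderiv] for operators. *)
Definition quot_cvg (g : R -> C) (t : R) (z : C) :=
  (fun h : R => (h^-1)%:C%C * (g (t + h) - g t)) @ (0 : R)^' --> (z : C^o).

Lemma quot_cvg_sum I (r : seq I) (P : pred I) (g : I -> R -> C) t (z : I -> C) :
  (forall x, P x -> quot_cvg (g x) t (z x)) ->
  quot_cvg (fun t => \sum_(x <- r | P x) g x t) t (\sum_(x <- r | P x) z x).
Proof.
move=> gz; have FF : Filter (0 : R)^' by exact: dnbhs_filter.
rewrite /quot_cvg (_ : (fun h => _) = fun h : R =>
    \sum_(x <- r | P x) (h^-1)%:C%C * (g x (t + h) - g x t)); last first.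
  by apply/funext => h; rewrite -sumrB mulr_sumr.
elim: r => [|x r IH].
  have H : (fun=> 0) @ (0 : R)^' --> (0 : C^o) by exact: cvg_cst.
  rewrite big_nil; apply: (cvg_trans _ H); apply: near_eq_cvg.
  by apply: nearW => h; rewrite big_nil.
rewrite big_cons (_ : (fun h => _) = fun h : R => (if P x then
    (h^-1)%:C%C * (g x (t + h) - g x t) else 0) +
    \sum_(x <- r | P x) (h^-1)%:C%C * (g x (t + h) - g x t)); last first.
  by apply/funext => h; rewrite big_cons; case: ifP => //; rewrite add0r.
have -> : (if P x then z x + \sum_(j <- r | P j) z j else \sum_(j <- r | P j) z j) =
    (if P x then z x else 0) + \sum_(j <- r | P j) z j.
  by case: ifP => //; rewrite add0r.
have Hx : (fun h : R => if P x then (h^-1)%:C%C * (g x (t + h) - g x t) else 0) @ (0 : R)^' -->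
    ((if P x then z x else 0) : C^o).
  case: (boolP (P x)) => Px; first exact: gz.
  exact: (@cvg_cst (C^o : topologicalType) 0 R (0 : R)^' FF).
have H := @tvs_cvgD R (C^o : tvsType C) R _ _ _ _ _ FF Hx IH.
exact: H.
Qed.

(** The real and imaginary parts have zero derivative. *)
Lemma quot_cvg0_cst (g : R -> C) x y : (forall t, quot_cvg g t 0) -> g x = g y.
Proof.
move=> g0.
have FF : Filter (0 : R)^' by exact: dnbhs_filter.
have part (P : C -> R) : (forall a b, P (a - b) = P a - P b) ->
    (forall (r : R) a, P (r%:C%C * a) = r * P a) -> (forall a, (`|P a|)%:C%C <= `|a|) ->
    P (g x) = P (g y).
  move=> PB PZ Pn; apply: (@is_derive_0_is_cst R (P \o g)) => t.
  have lim : (fun h : R => h^-1 *: (((P \o g) \o shift t) (h *: 1) - (P \o g) t)) @ (0 : R)^' --> (0 : R).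
    apply/cvgrPdist_lt => e e0.
    have e0' : (0 : C) < e%:C%C by rewrite ltcR.
    have H := proj1 (@cvgrPdist_lt _ (C^o : normedModType C) _ _ FF _ _) (g0 t); have := H _ e0'.
    apply: filterS => h.
    rewrite !sub0r !normrN /= -ltcR => /(le_lt_trans _); apply.
    rewrite /GRing.scale /= mulr1 [h + t]addrC -PB -PZ.
    exact: Pn.
  apply: DeriveDef; first by apply/cvg_ex; exists 0.
  exact/cvg_lim.
have ReZ (r : R) a : complex.Re (r%:C%C * a) = r * complex.Re a.
  by case: a => a b /=; rewrite mul0r subr0.
have ImZ (r : R) a : complex.Im (r%:C%C * a) = r * complex.Im a.
  by case: a => a b /=; rewrite mul0r addr0.
apply/eqP; rewrite eq_complex; apply/andP; split; apply/eqP.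
  have H := part (@complex.Re R) (raddfB _) ReZ (@normc_ge_Re R); exact: H.
have Imn (a : C) : (`|complex.Im a|)%:C%C <= `|a|; last first.
  have H := part (@complex.Im R) (raddfB _) ImZ Imn; exact: H.
 have := normc_ge_Re (a * 'i%C); rewrite ReiNIm normrN normrM.
suff -> : `|'i%C : C| = 1 by rewrite mulr1.
by rewrite normc_def /= expr0n expr1n add0r sqrtr1.
Qed.

(** Evaluations are continuous, hence differentiate curves of operators. *)
Lemma rderiv_eval k i (c : R -> symHom k i) t (v : symHom k i) (f : symt k) s :
  size s = i -> rderiv c t v -> quot_cvg (fun t => ap (c t) f s) t (ap v f s).
Proof.
move=> si cv; have [q Qq qE] := eval_seminorm f si.
have FF : Filter (0 : R)^' by exact: dnbhs_filter.
have H := proj1 (@lc_cvgP _ _ _ _ v (@fmap_filter _ _ _ _ FF)) cv q _ Qq.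
apply/(@cvgrPdist_lt _ (C^o : normedModType C) _ _ FF) => e e0.
apply: (@filterS _ _ FF _ _ _ (H e e0)) => h qh.
pose T : symHom k i := (h^-1)%:C%C *: (c (t + h) - c t) - v.
have E : ap T f s = (h^-1)%:C%C * (ap (c (t + h)) f s - ap (c t) f s) - ap v f s.
  by rewrite /T apD apN apZ apD apN !valD !valN valZ valD valN.
have {}qh : `|ap T f s| < e by rewrite -qE; exact: qh.
rewrite E in qh.
have D (x y : C) : `|y - x| < e -> `|x - y| < e by rewrite distrC.
exact: (D _ _ qh).
Qed.

(** Curves of series are differentiated on each symmetric tensor: this is weaker than
    differentiating them as operators, and enough for uniqueness. *)
Definition wderiv (a : R -> sser) (t : R) (a' : sser) := forall k (f : symt k),
  quot_cvg (fun t => coef (a t) f) t (coef a' f).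

Lemma quot_cvg_ff T (a : R -> sser) t a' : finite_functional T -> wderiv a t a' ->
  quot_cvg (fun t => T (a t)) t (T a').
Proof.
move=> [N [g Tg]] aa; rewrite Tg (_ : (fun t => T (a t)) = fun t => \sum_(l < N) coef (a t) (g l)).
  by apply: quot_cvg_sum => l _; exact: aa.
by apply/funext => u; rewrite Tg.
Qed.

End ScalarDerivatives.

(** * Uniqueness of one-parameter subgroups *)

Section SubgroupUniqueness.
Context (R : realType) (Phi : LBspace R).
Local Notation C := R[i].
Local Notation dual := (dual Phi).
Local Notation symt := (@symt R Phi).
Local Notation symHom := (@symHom R Phi).
Local Notation sser := (sser Phi).
Local Notation ser := (ser Phi).
Local Notation sexp := (@sexp R Phi).
Implicit Types (w : dual) (n k m l i : nat).

Lemma eq_belowB n (a b : sser) : eq_below n a b <-> eq_below n (a - b) 0.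
Proof.
split=> ab k kn.
  by rewrite serDE serNE ab// subrr.
apply/eqP; rewrite -subr_eq0; have := ab k kn.
by rewrite serDE serNE ser0E => ->.
Qed.

Lemma eq_below_exp n (u v : sser) l : u 0%N = 0 -> v 0%N = 0 -> eq_below n u v ->
  eq_below (n + l) (u ^+ l.+1) (v ^+ l.+1).
Proof.
move=> u0 v0 uv; elim: l => [|l IH]; first by rewrite addn0 !expr1.
apply: (proj2 (eq_belowB _ _ _)).
have -> : u ^+ l.+2 - v ^+ l.+2 = (u - v) * u ^+ l.+1 + v * (u ^+ l.+1 - v ^+ l.+1).
  by rewrite !(exprS _ l.+1) mulrBl mulrBr addrA subrK.
have e1 : eq_below (n + l.+1) ((u - v) * u ^+ l.+1) 0.
  by apply: order_mul; [exact: (proj1 (eq_belowB _ _ _) uv)|exact: order_exp].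
have e2 : eq_below (1 + (n + l)) (v * (u ^+ l.+1 - v ^+ l.+1)) 0.
  apply: order_mul; last exact: (proj1 (eq_belowB _ _ _) IH).
  by move=> k; rewrite ltnS leqn0 => /eqP ->.
move=> k kn; rewrite serDE (e1 k kn) (e2 k) ?ser0E ?addr0//.
by rewrite add1n -addnS.
Qed.

Lemma coef_sdot0 w (B : ser 1) k (g : symt k) : B k = 0 -> coef (sdot w B) g = 0.
Proof. by move=> Bk; rewrite coef_sdot Bk ap0 dot0. Qed.

(** In a product of at least two factors without constant terms, the coefficient of degree [k]
    of a factor only contributes to higher degrees: this makes the differential system
    triangular. *)
Lemma psi_below (B B' : ser 1) k l (f : symt k) : B 0%N = 0 -> B' 0%N = 0 ->
  eq_below k B B' -> ap (psi B k.+1 k l.+2) f = ap (psi B' k.+1 k l.+2) f.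
Proof.
move=> B0 B'0 BB; apply: symt_dot_ext => w.
apply: (etrans (dot_psi w l.+2 f B0 (ltnSn k))); apply: esym.
apply: (etrans (dot_psi w l.+2 f B'0 (ltnSn k))); apply: esym.
have s0 (D : ser 1) : D 0%N = 0 -> sdot w D 0%N = 0.
  move=> D0; apply: symHomP => g; apply: symt0P.
  by rewrite -/(coef (sdot w D) g) coef_sdot D0 ap0 dot0 ap0.
rewrite /coef; congr (ap _ f [::]).
have sBB : eq_below k (sdot w B) (sdot w B').
  move=> j jk; apply: symHomP => g; apply: symt0P.
  by rewrite -!/(coef (sdot w _) g) !coef_sdot BB.
by apply: (eq_below_exp (s0 _ B0) (s0 _ B'0) sBB); rewrite addnS ltnS leq_addr.
Qed.

Lemma psi_one (B : ser 1) k (f : symt k) : B 0%N = 0 -> ap (psi B k.+1 k 1) f = ap (B k) f.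
Proof.
move=> B0; apply: symt_dot_ext => w.
by rewrite (dot_psi w 1 f B0 (ltnSn k)) expr1 coef_sdot.
Qed.

Lemma psi_diag (B : ser 1) k (f : symt k) : B 0%N = 0 -> B 1%N = id_hom Phi 1 ->
  ap (psi B k.+1 k k) f = f.
Proof.
move=> B0 B1; apply: symt_dot_ext => w; rewrite (dot_psi w k f B0 (ltnSn k)).
have B2 : eq_below 2 (sdot w B) (sdot w (sid Phi)).
  by move=> j jk; apply: symHomP => g; apply: symt0P;
    rewrite -!/(coef (sdot w _) g) !coef_sdot; case: j jk g => [|[|//]] _ g; rewrite ?B0 ?B1.
have s0 (D : ser 1) : D 0%N = 0 -> sdot w D 0%N = 0.
  move=> D0; apply: symHomP => g; apply: symt0P.
  by rewrite -/(coef (sdot w D) g) coef_sdot D0 ap0 dot0 ap0.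
case: k f => [|k] f; first by rewrite expr0 -soneE coef_one.
have E := eq_below_exp (l := k) (s0 B B0) (s0 (sid Phi) erefl) B2.
by rewrite /coef E// -/(coef _ f) coef_sdot_sid_exp eqxx.
Qed.

(** The value at 0 of a one-parameter subgroup is idempotent. In degree [k], where lower
    coefficients are those of the identity, idempotency says [B_k = 2 B_k]. *)
Lemma scomp_idempotent (B : ser 1) : B 0%N = 0 -> B 1%N = id_hom Phi 1 ->
  scomp B B = B -> B = sid Phi.
Proof.
move=> B0 B1 BB; apply: serP => k.
elim/ltn_ind: k => -[|[|k]] IH; [by rewrite B0|by rewrite B1|].
apply: symHomP => f; have := ap_scomp B B f; rewrite BB.
rewrite big_ord_recl B0 ap0 add0r big_ord_recl big_ord_recr /= big1 ?add0r => [|l _]; last first.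
  by rewrite /bump !leq0n !add1n IH ?ltnS//; exact: ap0.
rewrite /bump !leq0n !add1n psi_diag// psi_one// B1 id_homE => /eqP.
by rewrite -subr_eq subrr eq_sym => /eqP ->.
Qed.

Lemma scomp_sid (a : sser) : scomp0 a (sid Phi) = a.
Proof.
move: a; apply: fm_sexp_eq => [||w]; [exact: fm_scomp|exact: fm_id|].
by rewrite scomp_sexp// -sexp_sEXP.
Qed.

(** From [a - 1 = - (a - 1)^2], the order of [a - 1] at least doubles. *)
Lemma mul_idempotent (a : sser) : a 0%N = id_hom Phi 0 -> a * a = a -> a = 1.
Proof.
move=> a0 aa; have E : a - 1 = - ((a - 1) * (a - 1)).
  by rewrite mulrBl mul1r mulrBr mulr1 aa subrr sub0r opprK.
suff H k : eq_below k.+1 (a - 1) 0.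
  apply: serP => k; apply/eqP; rewrite -subr_eq0; apply/eqP.
  by have := H k k (ltnSn k); rewrite serDE serNE ser0E.
elim: k => [|k IH].
  move=> j; rewrite ltnS leqn0 => /eqP ->.
  by rewrite serDE serNE a0 subrr.
rewrite E => j jk; rewrite serNE (order_mul IH IH) ?ser0E ?oppr0//.
by rewrite (leq_trans jk)// addSn addnS ltnS ltnS leq_addr.
Qed.

Lemma quot_cvgB (g g' : R -> C) t z z' : quot_cvg g t z -> quot_cvg g' t z' ->
  quot_cvg (fun t => g t - g' t) t (z - z').
Proof.
move=> gz gz'; have FF : Filter (0 : R)^' by exact: dnbhs_filter.
have H := @cvgB C (C^o : normedModType C) R _ FF _ _ _ _ gz gz'.
apply: (cvg_trans _ H); apply: near_eq_cvg; apply: nearW => h.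
by rewrite /= !fctE -mulrBr; congr (_ * _); ring.
Qed.

Section ODE.
Context (al : sser) (be : ser 1).
Hypotheses (al0 : al 0%N = 0) (be0 : be 0%N = 0) (be1 : be 1%N = 0).

Lemma scomp_below (B B' : ser 1) w k (f : symt k) : B 0%N = 0 -> B' 0%N = 0 ->
  eq_below k B B' -> coef (scomp0 (sdot w be) B) f = coef (scomp0 (sdot w be) B') f.
Proof.
move=> B0 B'0 BB; rewrite !coef_scomp; apply: eq_bigr => -[[|[|l]] lk] _ /=.
- exact: etrans (coef_sdot0 w _ be0) (esym (coef_sdot0 w _ be0)).
- exact: etrans (coef_sdot0 w _ be1) (esym (coef_sdot0 w _ be1)).
- exact: (congr1 (fun g => coef (sdot w be) g) (psi_below l f B0 B'0 BB)).
Qed.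

(** The equation [B_t' = be(B_t)]: in degree [k] its right-hand side only involves lower
    degrees, as [be] starts in degree 2. *)
Lemma ode_unique1 (B B' : R -> ser 1) :
  (forall t, B t 0%N = 0) -> (forall t, B' t 0%N = 0) -> B 0 = B' 0 ->
  (forall w t, wderiv (fun t => sdot w (B t)) t (scomp0 (sdot w be) (B t))) ->
  (forall w t, wderiv (fun t => sdot w (B' t)) t (scomp0 (sdot w be) (B' t))) ->
  forall t, B t = B' t.
Proof.
move=> B0 B'0 BB0 Bd B'd t; apply: serP => k; move: t; elim/ltn_ind: k => k IH t.
apply: symHom_dotP => w f; rewrite -!coef_sdot; apply/eqP; rewrite -subr_eq0; apply/eqP.
have H : forall t, quot_cvg (fun t => coef (sdot w (B t)) f - coef (sdot w (B' t)) f) t 0.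
  move=> u; have := quot_cvgB (Bd w u k f) (B'd w u k f).
  by rewrite (scomp_below w f (B0 u) (B'0 u)) ?subrr// => j jk; exact: IH.
have := quot_cvg0_cst t 0 H; rewrite /= => ->.
by rewrite BB0 subrr.
Qed.

(** The equation [A_t' = al(B_t) A_t], triangular since [al] has no constant term. *)
Lemma ode_unique0 (B : R -> ser 1) (A A' : R -> sser) : A 0 = A' 0 ->
  (forall t, wderiv A t (scomp0 al (B t) * A t)) ->
  (forall t, wderiv A' t (scomp0 al (B t) * A' t)) ->
  forall t, A t = A' t.
Proof.
move=> A0 Ad A'd t; apply: serP => k; move: t; elim/ltn_ind: k => k IH t.
apply: symHomP => f; apply: symt0P; rewrite -[LHS]/(coef (A t) f) -[RHS]/(coef (A' t) f).
apply/eqP; rewrite -subr_eq0; apply/eqP.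
have H : forall t, quot_cvg (fun t => coef (A t) f - coef (A' t) f) t 0.
  move=> u; have := quot_cvgB (Ad u k f) (A'd u k f).
  suff -> : coef (scomp0 al (B u) * A u) f = coef (scomp0 al (B u) * A' u) f.
    by rewrite subrr.
  have s1 : eq_below 1 (scomp0 al (B u)) 0.
    move=> j; rewrite ltnS leqn0 => /eqP ->; apply: symHomP => g; apply: symt0P.
    by rewrite -/(coef (scomp0 al (B u)) g) coef_scomp big_ord1 /coef al0 !ap0.
  have AA : eq_below k (A u - A' u) 0.
    by apply: (proj1 (eq_belowB _ _ _)) => j jk; exact: IH.
  have := order_mul s1 AA; rewrite mulrBr => E.
  by rewrite /coef (proj2 (eq_belowB _ _ _) E)// add1n.
have := quot_cvg0_cst t 0 H; rewrite /= => ->.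
by rewrite A0 subrr.
Qed.

End ODE.

Definition has_generator (c : R -> series2 Phi) (x : series2 Phi) :=
  [/\ one_parameter_subgroup c,
      forall k, rderiv (fun t => (c t).1 k) 0 (x.1 k)
    & forall k, rderiv (fun t => (c t).2 k) 0 (x.2 k)].

Section Generator.
Context (c : R -> series2 Phi) (x : series2 Phi).
Hypothesis cx : has_generator c x.

Let A t : sser := (c t).1.
Let B t : ser 1 := (c t).2.

Lemma subgroup_in_S t : [/\ A t 0%N = id_hom Phi 0, B t 0%N = 0 & B t 1%N = id_hom Phi 1].
Proof. by have [[cS _ _ _] _ _] := cx; exact: cS. Qed.

Lemma subgroupD1 s t : A (s + t) = scomp0 (A s) (B t) * A t.
Proof.
have [[_ cM _ _] _ _] := cx.
have E2 := scompE (A s) (B t); have E3 := smulE (scomp (A s) (B t)) (A t).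
rewrite {1}/A cM; exact: (etrans (congr1 (fun a => series_mul a (A t)) E2) E3).
Qed.

Lemma subgroupD2 s t : B (s + t) = scomp (B s) (B t).
Proof.
have [[_ cM _ _] _ _] := cx.
by rewrite {1}/B cM; exact: (scompE (B s) (B t)).
Qed.

Lemma subgroup_at0 : A 0 = 1 /\ B 0 = sid Phi.
Proof.
have [A0 B0 B1] := subgroup_in_S 0.
have B00 : B 0 = sid Phi.
  by apply: scomp_idempotent => //; rewrite -subgroupD2 addr0.
split=> //; apply: mul_idempotent => //.
by have := subgroupD1 0 0; rewrite addr0 B00 scomp_sid.
Qed.

(** The group law transports derivatives at 0 to any time. *)
Lemma subgroup_deriv_shift (a : R -> sser) (a' : sser) S t : finite_map S ->
  wderiv a 0 a' -> (forall h, a (h + t) = S (a h)) -> wderiv a t (S a').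
Proof.
move=> Sf aa aS k f; have H := quot_cvg_ff (Sf k f) aa.
have E : (fun h : R => (h^-1)%:C%C * (coef (a (t + h)) f - coef (a t) f)) =
    (fun h : R => (h^-1)%:C%C * (coef (S (a (0 + h))) f - coef (S (a 0)) f)).
  apply/funext => h.
  by have a0 := aS 0; rewrite add0r in a0; rewrite a0 add0r [t + h]addrC aS.
by rewrite /quot_cvg E.
Qed.

Lemma subgroup_deriv1 t : wderiv A t (scomp0 (x.1 : sser) (B t) * A t).
Proof.
have mf : finite_map (fun a => a * A t) by exact: fm_mulr.
apply: (@subgroup_deriv_shift A x.1 (fun a => scomp0 a (B t) * A t)).
- exact: fm_comp mf (fm_scomp (B t)).
- have [_ Ad _] := cx; move=> k f.
  have H := @rderiv_eval R Phi k 0 _ _ _ f [::] erefl (Ad k).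
  exact: H.
- by move=> h; exact: subgroupD1.
Qed.

Lemma subgroup_deriv2 w t :
  wderiv (fun t => sdot w (B t)) t (scomp0 (sdot w x.2) (B t)).
Proof.
apply: (@subgroup_deriv_shift (fun t => sdot w (B t)) (sdot w x.2) (fun a => scomp0 a (B t))).
- exact: fm_scomp.
- have [_ _ Bd] := cx; move=> k f.
  have := @rderiv_eval R Phi k 1 _ _ _ f (nseq 1 w) erefl (Bd k).
  have E : coef (sdot w x.2) f = ap (x.2 k) f (nseq 1 w) := coef_sdot w x.2 f.
  have E' : (fun t => coef (sdot w (B t)) f) = (fun t => ap ((c t).2 k) f (nseq 1 w)).
    by apply/funext => u; exact: coef_sdot.
  by rewrite E E'.
- by move=> h; rewrite subgroupD2 sdot_scomp.
Qed.

End Generator.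

(** A one-parameter subgroup solves a triangular system of linear differential
    equations, hence is determined by its generator. *)
Lemma generator_unique (c c' : R -> series2 Phi) x : in_W x ->
  has_generator c x -> has_generator c' x -> c = c'.
Proof.
move=> [al0 be0 be1] cx cx'.
have [A0 B0] := subgroup_at0 cx; have [A'0 B'0] := subgroup_at0 cx'.
have BB t : (c t).2 = (c' t).2.
  apply: (ode_unique1 be0 be1 (B := fun t => (c t).2) (B' := fun t => (c' t).2)) => [u|u||w u|w u].
  - by have [] := subgroup_in_S cx u.
  - by have [] := subgroup_in_S cx' u.
  - exact: etrans B0 (esym B'0).
  - exact: (subgroup_deriv2 cx).
  - exact: (subgroup_deriv2 cx').
have AA t : (c t).1 = (c' t).1.
  apply: (ode_unique0 al0 (B := fun t => (c t).2) (A := fun t => (c t).1) (A' := fun t => (c' t).1)) => [|u|u].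
  - exact: etrans A0 (esym A'0).
  - exact: (subgroup_deriv1 cx).
  - by rewrite BB; exact: (subgroup_deriv1 cx').
apply/funext => t; rewrite [c t]surjective_pairing [c' t]surjective_pairing.
by rewrite AA BB.
Qed.

End SubgroupUniqueness.

(** * The exponential map *)

Section FlowGenerator.
Context (R : realType) (Phi : LBspace R).
Local Notation C := R[i].
Local Notation dual := (dual Phi).
Local Notation symt := (@symt R Phi).
Local Notation symHom := (@symHom R Phi).
Local Notation sser := (sser Phi).
Local Notation ser := (ser Phi).
Implicit Types (w : dual) (n k m l i : nat).

Lemma lexp_iter i (S : ser i -> ser i) t a : raising S -> lexp S t (S a) = S (lexp S t a).
Proof.
move=> Sr; apply: serP => k.
have E := @iter_below R Phi i S Sr 1 _ _ _ (lexp_trunc Sr t a (N := k.+1)).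
rewrite -[S (lexp S t a)]/(iter 1 S (lexp S t a)) (E k (ltnSn k)).
rewrite (iter_sum Sr) ser_sumE /lexp; apply: eq_bigr => n _.
by rewrite (iterZ Sr) serZE -iterSr.
Qed.

Lemma real_complex_cvg0 : (fun h : R => h%:C%C) @ (0 : R)^' --> (0 : C^o).
Proof.
have FF : Filter (0 : R)^' by exact: dnbhs_filter.
apply/(@cvgrPdist_lt _ (C^o : normedModType C) _ _ FF) => e e0.
have r0 : 0 < complex.Re e by rewrite -ltcR RRe_real// gtr0_real.
have H : \forall h \near (0 : R)^', `|h| < complex.Re e.
  exact: dnbhs0_lt.
apply: (@filterS _ _ FF _ _ _ H) => h.
rewrite !sub0r !normrN -ltcR RRe_real ?gtr0_real//.
by rewrite normc_def /= expr0n addr0 sqrtr_sqr.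
Qed.

(** In each degree the flow is a polynomial in time. *)
Lemma lexp_rderiv i (S : ser i -> ser i) a k t : raising S ->
  rderiv (fun t : R => lexp S t%:C%C a k) t (lexp S t%:C%C (S a) k).
Proof.
move=> Sr; have FF : Filter (0 : R)^' by exact: dnbhs_filter.
pose b := lexp S t%:C%C a.
pose u n : symHom k i := (n`!%:R)^-1 *: iter n S b k.
have n0 : \forall h \near (0 : R)^', h%:C%C != 0 :> C.
  have := @nbhs_dnbhs_neq (R : topologicalType) 0; apply: filterS => h h0.
  by rewrite (eq_complex _ 0) /= eqxx andbT.
have H := @poly_quotient_cvg R (symHom k i) R _ _ FF real_complex_cvg0 n0 k u.
have u1 : u 1%N = lexp S t%:C%C (S a) k by rewrite /u factS fact0 invr1 scale1r (lexp_iter _ _ Sr).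
rewrite u1 in H; apply: (cvg_trans _ H); apply: near_eq_cvg; apply: nearW => h /=.
rewrite -[h^-1%:C%C]/((real_complex R) h^-1) fmorphV /=; congr (_ *: (_ - _)).
  rewrite addrC rmorphD /= -(lexp_add Sr) -/b (lexp_widen Sr _ _ (ltnW (ltnSn k.+1))).
  by apply: eq_bigr => n _; rewrite /u scalerA.
by rewrite /u fact0 invr1 scale1r.
Qed.

Lemma lexp_smooth i (S : ser i -> ser i) a k : raising S ->
  smooth (fun t : R => lexp S t%:C%C a k).
Proof.
move=> Sr; exists (fun m t => lexp S t%:C%C (iter m S a) k); split=> // n t.
exact: lexp_rderiv.
Qed.

Lemma sderiv_sid (b : ser 1) : b 0%N = 0 -> sderiv b (sid Phi) = b.
Proof.
move=> b0; apply: serP1 => w; rewrite sdot_sderiv; apply: sserP => k f.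
rewrite coef_sD coef_sdot; case: k f => [|k] f.
  by rewrite big_ord1 mul0r b0 ap0 dot0.
rewrite big_ord_recl mul0r add0r big_ord_recl big1 ?addr0 => [|l _]; last first.
  by rewrite coef_sdot_sid mulr0.
rewrite coef_sdot_sid /= mul1r dot_theta//.
by rewrite /= slice0 /bump /= subn1 /= to_symtK.
Qed.

Section Exp.
Context (x : series2 Phi).
Hypothesis xW : in_W x.

Let al : sser := x.1.
Let be : ser 1 := x.2.

Definition flow (t : R) : series2 Phi := (flowA al be t%:C%C, flowB be t%:C%C).

Lemma flow_generator : has_generator flow x.
Proof.
have [al0 be0 be1] := xW.
have rD := @raising_sderiv R Phi be be1 1; have rL := raising_sL al0 be1.
split; first split.
- by move=> t; split; [exact: flowA0|exact: flowB0|exact: flowB1].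
- move=> s t.
  have E1 := scompE (flowA al be s%:C%C) (flowB be t%:C%C).
  have E2 := smulE (scomp (flowA al be s%:C%C) (flowB be t%:C%C)) (flowA al be t%:C%C).
  have E3 := flowA_add al0 be0 be1 s%:C%C t%:C%C.
  have E4 := etrans E3 (esym (etrans (congr1 (fun a => series_mul a (flowA al be t%:C%C)) E1) E2)).
  have E5 := etrans (flowB_add s%:C%C t%:C%C be0 be1) (esym (scompE (flowB be s%:C%C) (flowB be t%:C%C))).
  by rewrite /flow rmorphD /= /S_mul; exact: (f_equal2 pair E4 E5).
- by move=> k; exact: (lexp_smooth _ _ rL).
- by move=> k; exact: (lexp_smooth _ _ rD).
- move=> k; have H := @lexp_rderiv 0 (sL al be) (1 : sser) k 0 rL; move: H.
  rewrite lexp0 /sL sD1// add0r mulr1; exact.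
- move=> k; have H := @lexp_rderiv 1 (sderiv be) (sid Phi) k 0 rD; move: H.
  by rewrite lexp0 sderiv_sid.
Qed.

Lemma EXP_flow : EXP x = flow 1.
Proof.
rewrite /EXP; apply: xget_unique.
  by exists flow; have [] := flow_generator.
move=> X [c [c1 cA cB ->]]; have cx : has_generator c x by split.
by rewrite (generator_unique xW cx flow_generator).
Qed.

Lemma Rmap_vfield : Rmap x = vfield al be.
Proof.
have [al0 be0 be1] := xW.
rewrite /Rmap EXP_flow (Imap_eq (in_M_expV (vfield al be))); first exact: logM_expV.
exact: expV_gen_fun.
Qed.

End Exp.
End FlowGenerator.

(** * Expansions in two parameters *)

Section BiExpansions.
Context (R : realType) (Phi : LBspace R).
Local Notation C := R[i].
Local Notation dual := (dual Phi).
Local Notation symt := (@symt R Phi).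
Local Notation symHom := (@symHom R Phi).
Local Notation polyt := (polyt Phi).
Local Notation VPhi := (VPhi Phi).
Implicit Types (w : dual) (n m k l e N r : nat) (p q : polyt).

(** Polynomials of bounded degree, on which the expansions below are finite sums. *)
Definition deg_lt N q := exists f : forall k, symt k, q = \sum_(k < N) mono (f k).

Lemma deg_lt_lin N c p q : deg_lt N p -> deg_lt N q -> deg_lt N (c *: p + q).
Proof.
move=> [f ->] [g ->]; exists (fun k => c *: f k + g k).
by rewrite scaler_sumr -big_split; apply: eq_bigr => k _; rewrite mono_lin.
Qed.

Lemma deg_lt0 N : deg_lt N 0.
Proof. by exists (fun=> 0); rewrite big1// => k _; rewrite mono0. Qed.

Lemma deg_lt_sum N I (s : seq I) (P : pred I) (c : I -> C) (F : I -> polyt) :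
  (forall x, P x -> deg_lt N (F x)) -> deg_lt N (\sum_(x <- s | P x) c x *: F x).
Proof.
move=> FN; elim/big_rec: _ => [|x q Px]; first exact: deg_lt0.
exact: deg_lt_lin (FN x Px).
Qed.

Lemma deg_lt_mono N k (f : symt k) : (k < N)%N -> deg_lt N (mono f).
Proof.
move=> kN; exists (fun j => if j == k then to_symt j f else 0).
rewrite (bigD1 (Ordinal kN))//= eqxx to_symtK big1 ?addr0// => j jk.
by rewrite ifN ?mono0//; move: jk; apply: contra => /eqP jk; apply/eqP/val_inj.
Qed.

Lemma deg_lt_lowers N T q : lowers 0 T -> deg_lt N q -> deg_lt N (T q).
Proof.
move=> lT [f ->]; have [Tl _] := lT; have [m [_ mE]] := lowers_matrix lT.
rewrite plinear_sum// (eq_bigr (fun k : 'I_N => 1 *: T (mono (f k)))) => [|k _]; last first.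
  by rewrite scale1r.
apply: deg_lt_sum => k _; rewrite mE.
rewrite (eq_bigr (fun i : 'I_k.+1 => 1 *: mono (ap (m i k) (f k)))) => [|i _]; last first.
  by rewrite scale1r.
by apply: deg_lt_sum => i _; apply: deg_lt_mono; rewrite (leq_ltn_trans _ (ltn_ord k))// -ltnS.
Qed.

Lemma deg_lt_vanish N e T q : lowers e T -> (N <= e)%N -> deg_lt N q -> T q = 0.
Proof.
move=> lT Ne [f ->]; have [Tl _] := lT; rewrite plinear_sum// big1// => k _.
exact: lowers_vanish (leq_trans (ltn_ord k) Ne) lT.
Qed.

Lemma deg_lt_all p : exists N, deg_lt N.+3 p.
Proof.
have [K [f ->]] := poly_decomp p; exists K.
rewrite (eq_bigr (fun k : 'I_K => 1 *: mono (f k))) => [|k _]; last by rewrite scale1r.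
apply: deg_lt_sum => k _; apply: deg_lt_mono.
by apply: leq_trans (ltn_ord k) _; rewrite -addn3 leq_addr.
Qed.

(** Power series in two parameters with coefficients lowering degrees: on polynomials of
    degree less than [N] all terms of total degree at least [N] vanish. *)
Definition bip e (Z : C -> C -> polyt -> polyt) (U : nat -> nat -> polyt -> polyt) :=
  (forall n m, lowers (maxn e (n + m)) (U n m)) /\
  forall N q s1 s2, deg_lt N q ->
    Z s1 s2 q = \sum_(n < N) \sum_(m < N) (s1 ^+ n * s2 ^+ m) *: U n m q.

Definition conv (U U' : nat -> nat -> polyt -> polyt) n m p :=
  \sum_(i < n.+1) \sum_(j < m.+1) U i j (U' (n - i)%N (m - j)%N p).

Lemma lowers_sum e I (s : seq I) (P : pred I) (T : I -> polyt -> polyt) :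
  (forall x, P x -> lowers e (T x)) -> lowers e (fun p => \sum_(x <- s | P x) T x p).
Proof.
move=> lT; elim: s => [|x s IH].
  by apply: lowers_ext (lowers_zero _ e) => p; rewrite big_nil.
case Px: (P x); last by apply: lowers_ext IH => p; rewrite big_cons Px.
by apply: lowers_ext (lowers_lin 1 (lT x Px) IH) => p; rewrite big_cons Px scale1r.
Qed.

Lemma lowers_conv e e' U U' n m : (forall n m, lowers (maxn e (n + m)) (U n m)) ->
  (forall n m, lowers (maxn e' (n + m)) (U' n m)) ->
  lowers (maxn (e + e') (n + m)) (conv U U' n m).
Proof.
move=> lU lU'; apply: lowers_sum => i _; apply: lowers_sum => j _.
apply: lowers_mono (lowers_comp (lU i j) (lU' (n - i)%N (m - j)%N)).
by have := ltn_ord i; have := ltn_ord j; lia.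
Qed.

(** The coefficients of a product are convolutions; the vanishing of the terms of high degree
    allows the rearrangement of the sums. *)
Lemma bip_comp e e' Z Z' U U' : bip e Z U -> bip e' Z' U' ->
  bip (e + e') (fun s1 s2 p => Z s1 s2 (Z' s1 s2 p)) (conv U U').
Proof.
move=> [lU ZU] [lU' ZU']; split=> [n m|N q s1 s2 qN]; first exact: lowers_conv.
have Ul n m : plinear (U n m) by case: (lU n m).
rewrite (ZU N) => [|]; last first.
  rewrite (ZU' N)//.
  rewrite (eq_bigr (fun n : 'I_N => 1 *: \sum_(m < N) (s1 ^+ n * s2 ^+ m) *: U' n m q)) => [|n _].
    apply: deg_lt_sum => n _; apply: deg_lt_sum => m _.
    exact: deg_lt_lowers (lowers_mono (leq0n _) (lU' n m)) qN.
  by rewrite scale1r.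
pose F n m n' m' := ((s1 ^+ n * s2 ^+ m) * (s1 ^+ n' * s2 ^+ m')) *: U n m (U' n' m' q).
have F0 n m n' m' : (N <= n + n')%N || (N <= m + m')%N -> F n m n' m' = 0.
  move=> H; rewrite /F (deg_lt_vanish (lowers_comp (lU n m) (lU' n' m')) _ qN) ?scaler0//.
  by move: H; lia.
transitivity (\sum_(n < N) \sum_(m < N) \sum_(n' < N) \sum_(m' < N) F n m n' m').
  apply: eq_bigr => n _; apply: eq_bigr => m _; rewrite (ZU' N)//.
  rewrite plinear_sum// scaler_sumr; apply: eq_bigr => n' _.
  rewrite plinear_sum// scaler_sumr; apply: eq_bigr => m' _.
  by rewrite plinearZ// scalerA.
pose G n n' := \sum_(b < N) \sum_(j < b.+1) F n j n' (b - j)%N.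
transitivity (\sum_(n < N) \sum_(n' < N) G n n').
  apply: eq_bigr => n _; rewrite exchange_big; apply: eq_bigr => n' _.
  rewrite (@sum_triangle _ (fun m m' => F n m n' m'))// => m m' H.
  by apply: F0; rewrite H orbT.
rewrite (@sum_triangle _ G) => [|n n' H]; last first.
  by rewrite /G big1// => b _; rewrite big1// => j _; apply: F0; rewrite H.
apply: eq_bigr => a _; rewrite exchange_big; apply: eq_bigr => b _.
rewrite /conv scaler_sumr; apply: eq_bigr => i _; rewrite scaler_sumr; apply: eq_bigr => j _.
have ia : (i <= a)%N by rewrite -ltnS.
have jb : (j <= b)%N by rewrite -ltnS.
by rewrite /F mulrACA -!exprD !subnKC.
Qed.

Definition bip1 n m p : polyt := if (n == 0%N) && (m == 0%N) then p else 0.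

Lemma bip_id : bip 0 (fun _ _ => id) bip1.
Proof.
split=> [[|n] [|m]|N q s1 s2 [f qf]]; do ?exact: lowers_zero.
  by rewrite maxnn; exact: lowers_id.
case: N qf => [|N] qf; first by rewrite big_ord0 qf big_ord0.
rewrite big_ord_recl [X in X + _]big_ord_recl mul1r scale1r big1 => [|m _]; last first.
  by rewrite /bip1 scaler0.
by rewrite big1 ?addr0// => n _; rewrite big1// => m _; rewrite /bip1 scaler0.
Qed.

Definition convn r U := iter r (conv U) bip1.
Arguments convn : simpl never.

Lemma bip_iter r Z U : bip 1 Z U -> bip r (fun s1 s2 => iter r (Z s1 s2)) (convn r U).
Proof.
move=> ZU; elim: r => [|r IH]; first exact: bip_id.
by have := bip_comp ZU IH; rewrite add1n.
Qed.

Lemma conv_id U n m p : (forall n m, plinear (U n m)) -> conv U bip1 n m p = U n m p.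
Proof.
move=> Ul; rewrite /conv big_ord_recr big1 ?add0r /= => [|i _]; last first.
  by rewrite big1// => j _; rewrite /bip1 subn_eq0 leqNgt ltn_ord plinear0.
rewrite big_ord_recr big1 ?add0r /= => [|j _]; last first.
  by rewrite /bip1 (subn_eq0 m) leqNgt ltn_ord andbF plinear0.
by rewrite add0r /bip1 !subnn.
Qed.

(** A power of a series without constant term starts at its exponent, so that only the first
    two powers contribute to the coefficient [s1 s2] of the logarithm. *)
Lemma convn_low r U n m p : (forall n m, plinear (U n m)) -> (forall p, U 0%N 0%N p = 0) ->
  (n + m < r)%N -> convn r U n m p = 0.
Proof.
move=> Ul U0; elim: r n m => // r IH n m nm.
rewrite /convn iterS /conv big1// => i _; rewrite big1// => j _.
have [ij|ij] := posnP (i + j)%N.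
  by move/eqP: ij; rewrite addn_eq0 => /andP[/eqP -> /eqP ->].
rewrite -/(convn r U) IH ?plinear0//.
by have := ltn_ord i; have := ltn_ord j; move: nm; lia.
Qed.

Definition log_coef r : C := (-1) ^+ r.+1 / r%:R.

Definition bilog U n m := locsum [set r | (0 < r)%N] log_coef (fun r => convn r U n m).

Lemma convn_locfinite Z U n m : bip 1 Z U -> locfinite (fun r => convn r U n m).
Proof.
move=> ZU; apply: lowers_locfinite => r; have [lU _] := bip_iter r ZU.
exact: lowers_mono (leq_maxl _ _) (lU n m).
Qed.

Lemma bilogE Z U n m N q : bip 1 Z U -> deg_lt N q ->
  bilog U n m q = \sum_(r < N | (r : nat) \in [set r | (0 < r)%N]) log_coef r *: convn r U n m q.
Proof. by move=> ZU [f ->]; exact: locsum_trunc (convn_locfinite n m ZU) (leqnn N). Qed.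

(** On each degree only finitely many powers contribute to the logarithm. *)
Lemma bip_log Z U : bip 1 Z U -> bip 1 (fun s1 s2 => plog (Z s1 s2)) (bilog U).
Proof.
move=> ZU; split=> [n m|N q s1 s2 qN].
  apply: lowers_locsum => [|r /set_mem /= r0]; first exact: convn_locfinite ZU.
  have [lU _] := bip_iter r ZU; apply: lowers_mono (lU n m).
  by rewrite geq_max !leq_max r0 leqnn orbT.
have iZ r : iter r (Z s1 s2) q = \sum_(n < N) \sum_(m < N) (s1 ^+ n * s2 ^+ m) *: convn r U n m q.
  by have [_ H] := bip_iter r ZU; exact: H.
rewrite /plog /locsum (@fsbig_nat_trunc _ _ _ _ N) => [|r Nr]; last first.
  rewrite iZ big1 ?scaler0// => n _; rewrite big1// => m _.
  have [lU _] := bip_iter r ZU.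
  by rewrite (deg_lt_vanish (lU n m) _ qN) ?scaler0// leq_max Nr.
under eq_bigr => r _ do rewrite iZ scaler_sumr.
rewrite exchange_big; apply: eq_bigr => n _.
under eq_bigr => r _ do rewrite scaler_sumr.
rewrite exchange_big; apply: eq_bigr => m _.
rewrite (bilogE n m ZU qN) scaler_sumr; apply: eq_bigr => r _.
by rewrite !scalerA mulrC.
Qed.

Lemma bilog11 Z U p : bip 1 Z U -> (forall p, U 0%N 0%N p = 0) ->
  bilog U 1 1 p = U 1%N 1%N p - 2^-1 *: (U 1%N 0%N (U 0%N 1%N p) + U 0%N 1%N (U 1%N 0%N p)).
Proof.
move=> ZU U0; have Ul n m : plinear (U n m) by have [lU _] := ZU; case: (lU n m).
have c1 n m q : convn 1 U n m q = U n m q by exact: conv_id.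
have c2 q : convn 2 U 1 1 q = U 1%N 0%N (U 0%N 1%N q) + U 0%N 1%N (U 1%N 0%N q).
  rewrite -[convn 2 U 1 1 q]/(conv U (convn 1 U) 1 1 q) /conv !big_ord_recl !big_ord0 /=.
  rewrite !c1 /bump /= !addn0 !subn0 subnn !U0.
  by rewrite !(plinear0 (Ul _ _)) !addr0 add0r addrC.
have [N pN] := deg_lt_all p.
rewrite (bilogE 1 1 ZU pN) big_mkcond !big_ord_recl /= big1 => [|r _]; last first.
  by rewrite mem_set// convn_low ?scaler0.
rewrite memNset//= !mem_set//= add0r addr0 c1 c2 /log_coef /bump /=.
rewrite -[(1 + 0)%N]/1%N -[(1 + (1 + 0))%N]/2%N sqrrN !expr1n divr1 scale1r.
by rewrite exprS sqrrN expr1n mulr1 mulN1r scaleNr.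
Qed.

End BiExpansions.

(** * The topology of entries *)

Section EntryTopology.
Context (R : realType) (Phi : LBspace R).
Local Notation C := R[i].
Local Notation dual := (dual Phi).
Local Notation symt := (@symt R Phi).
Local Notation symHom := (@symHom R Phi).
Local Notation polyt := (polyt Phi).
Local Notation Op := (Op Phi).
Local Notation VPhi := (VPhi Phi).
Implicit Types (w : dual) (n k l i : nat) (X Y : VPhi).

(** The homogeneous parts of a polynomial are determined by it. *)
Lemma op_matrix_unique (P : Op) m m' : op_matrix P m -> op_matrix P m' ->
  forall i k, m i k = m' i k.
Proof.
move=> [m0 mP] [m'0 m'P] i k; have [ik|ki] := leqP i k; last by rewrite m0// m'0.
apply/eqP; rewrite -subr_eq0; apply/eqP; apply: symHomP => f; rewrite ap0.
apply: (@sum_dot_eq0 _ _ k.+1 (fun i => ap (m i k - m' i k) f)) => [w|]; last by rewrite ltnS.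
transitivity (\sum_(i < k.+1) dot w (ap (m i k) f) - \sum_(i < k.+1) dot w (ap (m' i k) f)).
  rewrite -sumrB; apply: eq_bigr => j _.
  by rewrite apD apN dotD -[- ap (m' j k) f]scaleN1r dotZ mulN1r.
by rewrite -mP -m'P subrr.
Qed.

Lemma entryP X : op_matrix X (entry X).
Proof.
have /asboolP[m [mP _]] := valP (X : Vt Phi).
by apply: (@xgetPex _ (fun _ _ => 0) [set m | op_matrix X m]); exists m.
Qed.

Lemma entry_diag X k : entry X k k = 0.
Proof.
have /asboolP[m [mP m0]] := valP (X : Vt Phi).
by rewrite -(m0 k); exact: (op_matrix_unique (entryP X) mP k k).
Qed.

Lemma entry_lin a X Y i k : entry (a *: X + Y : VPhi) i k = a *: entry X i k + entry Y i k.
Proof.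
have [X0 XP] := entryP X; have [Y0 YP] := entryP Y.
apply: (op_matrix_unique (entryP (a *: X + Y)) (m' := fun i k => a *: entry X i k + entry Y i k)).
split=> [j l lj|l f w]; first by rewrite X0// Y0// scaler0 addr0.
have E : (a *: X + Y : VPhi) (mono f) w = a * X (mono f) w + Y (mono f) w.
  exact: (op_linear a X Y (mono f) w).
rewrite E XP YP mulr_sumr -big_split; apply: eq_bigr => j _.
by rewrite ap_linear dot_linear.
Qed.

Lemma entry_eq0 X k : (forall f : symt k, X (mono f) = 0) -> forall i, entry X i k = 0.
Proof.
move=> X0 i; have [E0 EP] := entryP X; have [ik|ki] := leqP i k; last exact: E0.
apply: symHomP => f; rewrite ap0.
apply: (@sum_dot_eq0 _ _ k.+1 (fun i => ap (entry X i k) f)) => [w|]; last by rewrite ltnS.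
by rewrite -EP X0.
Qed.

(** Each defining seminorm only sees one entry, hence the action on one degree. This is
    why degree-dependent expansions suffice for differentiation. *)
Lemma V_seminorm_local (q : seminorm (Vt Phi)) : V_seminorms q -> exists k,
  forall X, (forall f : symt k, X (mono f) = 0) -> q X = 0.
Proof.
move=> [i [k [q' [_ _ qE]]]]; exists k => X X0.
by rewrite qE (entry_eq0 X0) sn0.
Qed.

(** Evaluations of the entries are continuous and separate operators. *)
Lemma VPhi_hausdorff : hausdorff_space VPhi.
Proof.
apply: lc_hausdorff => X X0; apply: VP_mono => k f w.
have [E0 EP] := entryP X; rewrite EP; apply: big1 => i _.
suff H (j : nat) : entry X j k = 0 by rewrite H ap0 dot0.
have [jk|kj|->] := ltngtP j k; [|exact: E0|exact: entry_diag].
apply: symHomP => g; rewrite ap0; apply: symt_dot_ext => u; rewrite dot0.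
have [q' Qq' qE] := eval_seminorm g (size_nseq j u).
have el : linear (fun Y : Vt Phi => entry (Y : VPhi) j k :
    clin (indlim (symc Phi k)) (indlim (symc Phi j))).
  by move=> a Y Z; exact: entry_lin.
have := X0 (sn_comp q' el) _; rewrite /= /sn_comp_fun qE => H.
by apply/eqP; rewrite -normr_eq0; apply/eqP; apply: H; exists j, k, q'; split.
Qed.

Lemma VPhi_linE a X Y (p : polyt) : (a *: X + Y : VPhi) p = a *: X p + Y p.
Proof. by []. Qed.

Lemma VPhi_sumE I (r : seq I) (P : pred I) (c : I -> C) (W : I -> VPhi) (p : polyt) :
  (\sum_(x <- r | P x) c x *: W x : VPhi) p = \sum_(x <- r | P x) c x *: W x p.
Proof. by elim/big_rec2: _ => [//|x y z _ <-]; rewrite VPhi_linE. Qed.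

(** On each degree the curve is polynomial with coefficients in the space of operators, and
    a seminorm only sees one degree. *)
Lemma cderiv_poly (T : C -> VPhi) (W : nat -> VPhi) :
  (forall k (f : symt k) z, T z (mono f) = \sum_(n < k.+2) z ^+ n *: W n (mono f)) ->
  cderiv T 0 (W 1%N).
Proof.
move=> TW; have FF : Filter (0 : C^o)^' by exact: dnbhs_filter.
apply: (proj2 (@lc_cvgP _ _ _ _ (W 1%N) (@fmap_filter _ _ _ _ FF))) => q e Qq e0.
have [k qk] := V_seminorm_local Qq.
have id0 : id @ (0 : C^o)^' --> (0 : C^o) by exact: nbhs_dnbhs.
have n0 : \forall x \near (0 : C^o)^', x != 0 by exact: (@nbhs_dnbhs_neq (C^o : topologicalType) 0).
have H := @poly_quotient_cvg R VPhi C (0 : C^o)^' id FF id0 n0 k W.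
have {}H := proj1 (@lc_cvgP _ _ _ _ (W 1%N) (@fmap_filter _ _ _ _ FF)) H q e Qq e0.
apply: (@filterS _ _ FF _ _ _ H) => h qh.
pose S z : VPhi := \sum_(n < k.+2) z ^+ n *: W n.
have X0 z : q (T z - S z) = 0.
  apply: qk => f.
  have -> : T z - S z = (-1) *: S z + T z by rewrite scaleN1r addrC.
  rewrite VPhi_linE /S (VPhi_sumE _ _ (fun n : 'I_k.+2 => z ^+ n)) TW.
  by rewrite scaleN1r addNr.
have S0 : S 0 = W 0%N.
  by rewrite /S big_ord_recl expr0 scale1r big1 ?addr0// => n _; rewrite exprS mul0r scale0r.
pose Q : VPhi := h^-1 *: (T (0 + h) - T 0) - W 1%N.
pose P : VPhi := h^-1 *: (S h - W 0%N) - W 1%N.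
have QP : Q = h^-1 *: (T h - S h) + ((- h^-1) *: (T 0 - S 0) + P).
  rewrite /Q /P add0r S0 scaleNr -scalerN [RHS]addrA [RHS]addrA -!scalerDr.
  by congr (h^-1 *: _ - _); rewrite opprB -addrA [_ + (S h - _)]addrC addrA !subrKA.
have qP : q P < e by exact: qh.
have : q Q <= q P.
  rewrite QP (le_trans (sn_triangle q _ _))// sn_scale X0 mulr0 add0r.
  by rewrite (le_trans (sn_triangle q _ _))// sn_scale X0 mulr0 add0r.
by move=> /le_lt_trans; apply.
Qed.

Lemma cderiv_unique (T : C -> VPhi) z X Y : cderiv T z X -> cderiv T z Y -> X = Y.
Proof.
move=> TX TY; have FF : ProperFilter (0 : C^o)^' by exact: Proper_dnbhs_numFieldType.
exact: (@cvg_unique VPhi VPhi_hausdorff _ _ _ _ TX TY).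
Qed.

(** The space being Hausdorff, limits of difference quotients are unique. *)
Lemma taylor11_unique (F : C -> C -> VPhi) X Y : taylor11 F X -> taylor11 F Y -> X = Y.
Proof.
move=> [g Fg gX] [g' Fg' gY].
have gg : \forall s \near (0 : C^o), g s = g' s.
  by apply: filterS2 Fg Fg' => s; exact: cderiv_unique.
have gg0 : g 0 = g' 0 by exact: nbhs_singleton gg.
apply: (cderiv_unique gX); rewrite /cderiv.
apply: (cvg_trans _ gY); apply: near_eq_cvg.
have gg' : \forall s \near (0 : C^o)^', g s = g' s by exact: nbhs_dnbhs.
by apply: filterS gg' => s gs; rewrite !add0r gs gg0.
Qed.

End EntryTopology.

(** * The Lie bracket *)

Section LieBracket.
Context (R : realType) (Phi : LBspace R).
Local Notation C := R[i].
Local Notation dual := (dual Phi).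
Local Notation symt := (@symt R Phi).
Local Notation polyt := (polyt Phi).
Local Notation Op := (Op Phi).
Local Notation VPhi := (VPhi Phi).
Local Notation sser := (sser Phi).
Local Notation ser := (ser Phi).
Local Notation sexp := (@sexp R Phi).
Implicit Types (w : dual) (n m k N : nat) (p q : polyt) (V W : VPhi).

Lemma iter_scale V s n p : iter n (s *: V : VPhi) p = s ^+ n *: iter n V p.
Proof.
elim: n => [|n IH]; first by rewrite expr0 scale1r.
rewrite !iterS IH.
have -> : (s *: V : VPhi) (s ^+ n *: iter n V p) = s *: V (s ^+ n *: iter n V p) by [].
by rewrite (plinearZ _ _ (op_plinear V)) scalerA exprS.
Qed.

Lemma pexp_scale V s N q : deg_lt N q ->
  pexp (s *: V : VPhi) q = \sum_(n < N) s ^+ n *: ((n`!%:R)^-1 *: iter n V q).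
Proof.
move=> qN; have lV := V_lowers (s *: V : VPhi); have [Vl _] := lV.
have q0 : iter N (s *: V : VPhi) q = 0 := deg_lt_vanish (lowers_iter1 N lV) (leqnn N) qN.
rewrite (pexp_nil Vl q0); apply: eq_bigr => n _.
by rewrite iter_scale !scalerA mulrC.
Qed.

Section Product.
Context (V W : VPhi).

Definition exp_prod s1 s2 : Op := op_comp (expV (s1 *: V)) (expV (s2 *: W)).

(** The coefficients of [exp (s1 V) exp (s2 W) - 1]. *)
Definition exp_coef n m p :=
  ((n`!%:R)^-1 / m`!%:R) *: iter n V (iter m W p) - bip1 n m p.

Lemma exp_prodE s1 s2 p :
  exp_prod s1 s2 p = pexp (s1 *: V : VPhi) (pexp (s2 *: W : VPhi) p).
Proof.
have l0 s X : lowers 0 (expV (s *: X : VPhi)).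
  apply: lowers_ext (pexp_lowers (V_lowers (s *: X : VPhi))) => q.
  by rewrite expVE.
rewrite /exp_prod /op_comp to_opE; last exact: lowers_comp (l0 s1 V) (l0 s2 W).
by rewrite !expVE.
Qed.

Lemma exp_prod_lowers s1 s2 : lowers 1 (fun p => exp_prod s1 s2 p - p).
Proof.
have l1 s X := pexp_sub1_lowers (V_lowers (s *: X : VPhi)).
have l0 s X := pexp_lowers (V_lowers (s *: X : VPhi)).
have := lowers_lin 1 (lowers_comp (l1 s1 V) (l0 s2 W)) (l1 s2 W); rewrite addn0.
by apply: lowers_ext => p; rewrite scale1r exp_prodE subrKA.
Qed.

Lemma bip_exp : bip 1 (fun s1 s2 p => exp_prod s1 s2 p - p) exp_coef.
Proof.
have lit n m : lowers (n + m) (fun p => iter n V (iter m W p)).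
  exact: lowers_comp (lowers_iter1 n (V_lowers V)) (lowers_iter1 m (V_lowers W)).
have [lid Eid] := bip_id Phi.
split=> [n m|N q s1 s2 qN].
  have [nm|nm] := posnP (n + m)%N.
    move/eqP: nm; rewrite addn_eq0 => /andP[/eqP -> /eqP ->].
    apply: lowers_ext (lowers_zero _ _) => p.
    by rewrite /exp_coef /bip1 !fact0 !invr1 mulr1 scale1r subrr.
  have -> : maxn 1 (n + m) = (n + m)%N by apply/maxn_idPr.
  have H := lowers_lin ((n`!%:R)^-1 / m`!%:R) (lit n m) (lowers_zero Phi (n + m)).
  have := lid n m; rewrite max0n => Hb.
  apply: lowers_ext (lowers_lin (-1) Hb H) => p.
  by rewrite /exp_coef addr0 scaleN1r addrC.
have E : pexp (s1 *: V : VPhi) (pexp (s2 *: W : VPhi) q) = \sum_(n < N) \sum_(m < N)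
    (s1 ^+ n * s2 ^+ m) *: (((n`!%:R)^-1 / m`!%:R) *: iter n V (iter m W q)).
  rewrite (pexp_scale W s2 qN) (pexp_scale V s1 (N := N)); last first.
    apply: deg_lt_sum => m _; rewrite -[_ *: _]addr0; apply: deg_lt_lin (deg_lt0 _ N).
    exact: deg_lt_lowers (lowers_mono (leq0n _) (lowers_iter1 m (V_lowers W))) qN.
  apply: eq_bigr => n _; have [il _] := lowers_iter1 n (V_lowers V).
  rewrite plinear_sum// !scaler_sumr; apply: eq_bigr => m _.
  rewrite (plinearZ _ _ il) (plinearZ _ _ il) !scalerA; congr (_ *: _).
  by rewrite mulrACA [_ * s2 ^+ m]mulrC !mulrA.
rewrite exp_prodE; apply: (etrans (f_equal2 (fun a b => a - b) E (Eid N q s1 s2 qN))).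
rewrite -sumrB; apply: eq_bigr => n _; rewrite -sumrB; apply: eq_bigr => m _.
by rewrite /exp_coef scalerBr.
Qed.

(** The coefficients of the Baker-Campbell-Hausdorff series. *)
Definition bch n m := bilog exp_coef n m.

Lemma logM_exp_prod s1 s2 N q : deg_lt N q ->
  logM (exp_prod s1 s2) q = \sum_(n < N) \sum_(m < N) (s1 ^+ n * s2 ^+ m) *: bch n m q.
Proof.
move=> qN; rewrite (logME (exp_prod_lowers s1 s2)).
by have [_ H] := bip_log bip_exp; exact: H.
Qed.

Lemma bch_lowers n m : lowers (maxn 1 (n + m)) (bch n m).
Proof. by have [H _] := bip_log bip_exp; exact: H. Qed.

Lemma bch11 p : bch 1 1 p = V (W p) - 2^-1 *: (V (W p) + W (V p)).
Proof.
rewrite /bch (bilog11 _ bip_exp) => [|q]; last first.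
  by rewrite /exp_coef /bip1 !fact0 !invr1 mulr1 scale1r subrr.
by rewrite /exp_coef /bip1 /= !factS !fact0 !invr1 !mulr1 !scale1r !subr0.
Qed.

(** The coefficient of [s2^m] as a function of [s1], an operator by local finiteness. *)
Definition bch_row s m : VPhi := to_V (to_op (locsum [set: nat] (fun n => s ^+ n) (fun n => bch n m))).

Lemma bch_row_mono s m k (f : symt k) N : (k < N)%N ->
  bch_row s m (mono f) = \sum_(n < N) s ^+ n *: bch n m (mono f).
Proof.
move=> kN; have lf : locfinite (fun n => bch n m).
  apply: lowers_locfinite => n; apply: lowers_mono (bch_lowers n m).
  by rewrite leq_max leq_addr orbT.
rewrite /bch_row to_VE; last first.
  by apply: lowers_locsum => // n _; exact: lowers_mono (leq_maxl _ _) (bch_lowers n m).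
rewrite (locsum_mono _ _ f lf kN).
by apply: eq_bigl => n; rewrite in_setT.
Qed.

(** The part of this symmetric in [V] and [W] disappears from the bracket. *)
Lemma lie_bE p : lie_b V W p = V (W p) - 2^-1 *: (V (W p) + W (V p)).
Proof.
have l1 n m : lowers 1 (bch n m) := lowers_mono (leq_maxl _ _) (bch_lowers n m).
suff H : taylor11 (fun s1 s2 => logM (exp_prod s1 s2)) (to_V (to_op (bch 1 1))).
  have -> : lie_b V W = to_V (to_op (bch 1 1)).
    by rewrite /lie_b; apply: xget_unique => // X HX; exact: taylor11_unique HX H.
  by rewrite to_VE// bch11.
exists (fun s => bch_row s 1).
  apply: (@filterE _ (nbhs (0 : C^o)) (nbhs_filter _)) => s; apply: (cderiv_poly (W := fun m => bch_row s m)) => k f z.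
  have kN : (k < k.+2)%N by exact: leqnSn.
  apply: (etrans (logM_exp_prod s z (deg_lt_mono f kN))); rewrite exchange_big.
  apply: eq_bigr => m _; rewrite (bch_row_mono s m f kN) scaler_sumr.
  by apply: eq_bigr => n _; rewrite scalerA mulrC.
apply: (cderiv_poly (W := fun n => to_V (to_op (bch n 1)))) => k f z.
have kN : (k < k.+2)%N by exact: leqnSn.
apply: (etrans (bch_row_mono z 1 f kN)).
by apply: eq_bigr => n _; rewrite to_VE.
Qed.

End Product.

Lemma lie_bracketE V W p : lie_bracket V W p = V (W p) - W (V p).
Proof.
have E := f_equal2 (fun x y : polyt => x - y) (lie_bE V W p) (lie_bE W V p).
by apply: (etrans E); rewrite [W (V p) + V (W p)]addrC opprB subrKA.
Qed.

Lemma series_deriv_low i (al : ser i) (be : ser 1) : be 1%N = 0 -> al 0%N = 0 ->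
  sderiv be al 0%N = 0 /\ sderiv be al 1%N = 0.
Proof.
move=> be1 al0; have a1 : eq_below 1 al 0 by move=> k; rewrite ltnS leqn0 => /eqP ->.
by have H := sderiv_order be1 a1; split; rewrite H.
Qed.

Section VectorFields.
Context (al1 al2 : sser) (be1 be2 : ser 1).
Hypotheses (al10 : al1 0%N = 0) (be10 : be1 0%N = 0) (be11 : be1 1%N = 0).
Hypotheses (al20 : al2 0%N = 0) (be20 : be2 0%N = 0) (be21 : be2 1%N = 0).

Lemma pvalB p q w : (p - q : polyt) w = p w - q w. Proof. by []. Qed.

Lemma VPhi_combE V W (X : VPhi) p w : (V - W + X : VPhi) p w = V p w - W p w + X p w.
Proof.
rewrite (VPhi_addE (V - W) X p) (VPhi_addE V (- W) p) (VPhi_oppE W p).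
exact: etrans (pvalD (V p - W p) (X p) w) (congr1 (fun z => z + X p w) (pvalB (V p) (W p) w)).
Qed.

Lemma sL_sexp (al : sser) (be : ser 1) w : be 0%N = 0 ->
  sL al be (sexp w) = sexp w * (sdot w be + al).
Proof. by move=> be0; rewrite /sL sD_sexp// mulrDr [al * _]mulrC. Qed.

(** The second order terms of the two compositions agree, since multiplications commute. *)
Lemma sL_commutator w :
  sL al2 be2 (sL al1 be1 (sexp w)) - sL al1 be1 (sL al2 be2 (sexp w)) =
  sexp w * (sderiv be2 al1 - sderiv be1 al2 + sdot w (sderiv be2 be1 - sderiv be1 be2)).
Proof.
rewrite !sL_sexp// /sL !sDM// !sD_sexp// !sDD.
have -> : sdot w (sderiv be2 be1 - sderiv be1 be2) = sD be2 (sdot w be1) - sD be1 (sdot w be2).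
  by rewrite -!sdot_sderiv -[- sderiv be1 be2]scaleN1r sdotD sdotZ scaleN1r.
rewrite -/(sD be2 al1) -/(sD be1 al2); ring.
Qed.

(** The symbol reverses compositions, whence the sign of the bracket. *)
Lemma lie_bracket_vfield : lie_bracket (vfield al1 be1) (vfield al2 be2) =
  alpha_nabla (sderiv be2 al1) - alpha_nabla (sderiv be1 al2) +
  M_nabla (sderiv be2 be1 - sderiv be1 be2 : ser 1).
Proof.
apply: VP_mono => k f w; rewrite lie_bracketE.
have comp alx bex aly bey : alx 0%N = 0 -> bex 0%N = 0 -> bex 1%N = 0 ->
    aly 0%N = 0 -> bey 0%N = 0 -> bey 1%N = 0 ->
    vfield alx bex (vfield aly bey (mono f)) w =
    k`!%:R * coef (sL aly bey (sL alx bex (sexp w))) f.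
  move=> x0 x1 x2 y0 y1 y2.
  apply: (symbol_transpose (lowers_mono (leq0n 1) (V_lowers (vfield aly bey))) (fm_sL aly bey)
    (vfield_symbol y0 y1 y2) (a := fun w => sL alx bex (sexp w)) (op_plinear (vfield alx bex))).
  exact: (vfield_symbol x0 x1 x2).
have [d1 _] := series_deriv_low be21 al10; have [d2 _] := series_deriv_low be11 al20.
have [e1 e1'] := series_deriv_low be21 be10; have [e2 e2'] := series_deriv_low be11 be20.
pose D : ser 1 := sderiv be2 be1 - sderiv be1 be2.
have D0 : D 0%N = 0 by rewrite /D serDE serNE e1 e2 subrr.
have D1 : D 1%N = 0 by rewrite /D serDE serNE e1' e2' subrr.
have Ea := alpha_nabla_mono f w d1; have Eb := alpha_nabla_mono f w d2.
have Ec := M_nabla_mono f w D0 D1.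
pose V1 := vfield al1 be1; pose V2 := vfield al2 be2.
have L := f_equal2 (fun x y : C => x - y) (comp _ _ _ _ al10 be10 be11 al20 be20 be21)
  (comp _ _ _ _ al20 be20 be21 al10 be10 be11).
apply: (etrans (pvalB (V1 (V2 (mono f))) (V2 (V1 (mono f))) w)); apply: (etrans L).
apply: esym.
apply: (etrans (VPhi_combE (alpha_nabla (sderiv be2 al1)) (alpha_nabla (sderiv be1 al2)) (M_nabla D)
  (mono f) w)).
apply: (etrans (f_equal2 +%R (f_equal2 (fun x y : C => x - y) Ea Eb) Ec)).
rewrite -!mulrBr -mulrDr -!coef_opp -!coef_add; congr (_ * coef _ f).
by rewrite sL_commutator -mulrBr -mulrDr.
Qed.

End VectorFields.
End LieBracket.

Theorem theorem5p10 (R : realType) (Phi : LBspace R) :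
  (forall x : series2 Phi, in_W x ->
     Rmap x = alpha_nabla x.1 + M_nabla x.2)
  /\
  ((forall v w : VPhi Phi, lie_algebra v -> lie_algebra w ->
      forall p : polyt Phi, lie_bracket v w p = v (w p) - w (v p)) /\
   (forall x1 x2 : series2 Phi, in_W x1 -> in_W x2 ->
      lie_bracket (alpha_nabla x1.1 + M_nabla x1.2)
                  (alpha_nabla x2.1 + M_nabla x2.2) =
      alpha_nabla (series_deriv x2.2 x1.1)
      - alpha_nabla (series_deriv x1.2 x2.1)
      + M_nabla (fun k => series_deriv x2.2 x1.2 k
                          - series_deriv x1.2 x2.2 k))).
Proof.
split; first by move=> x xW; exact: Rmap_vfield.
split=> [v w _ _ p|x1 x2 [al10 be10 be11] [al20 be20 be21]]; first exact: lie_bracketE.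
rewrite (sderivE x2.2 (x1.1 : ser Phi 0)) (sderivE x1.2 (x2.1 : ser Phi 0)).
have -> : (fun k => series_deriv x2.2 x1.2 k - series_deriv x1.2 x2.2 k) =
    (sderiv x2.2 x1.2 - sderiv x1.2 x2.2 : ser Phi 1).
  by apply: serP => k; rewrite serDE serNE -!sderivE.
exact: (lie_bracket_vfield al10 be10 be11 al20 be20 be21).
Qed.
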